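(* Let $p\ge 5$ be a prime and let $$K_p=\frac{(2\pi)^{(p-1)/2}}{\sqrt p\,\left(\frac{p-3}{2}\right)!\,\sum_{j=1}^{p-1}\left(\frac{j}{p}\right)\zeta\left(\frac{p-1}{2},\frac{j}{p}\right)}.$$ Then $K_p=1/c_p$, where $c_p$ is a positive integer given by each of the following (equal) expressions: (i) $\displaystyle c_p=\frac{\sqrt p\,\left(\frac{p-3}{2}\right)!}{(2\pi)^{(p-1)/2}}\sum_{j=1}^{p-1}\left(\frac{j}{p}\right)\zeta\left(\frac{p-1}{2},\frac{j}{p}\right)$; (ii) $\displaystyle c_p=\frac12\left(\frac{-2}{p}\right)p^{(p-1)/2}\sum_{j=1}^{p-1}\left(\frac{j}{p}\right)\zeta\left(-\frac{p-3}{2},\frac{j}{p}\right)$; (iii) $\displaystyle c_p=(-1)^{(p-3)/2}\frac{\sqrt p}{2^{(p+1)/2}}\sum_{j=1}^{p-1}\left(\frac{j}{p}\right)\cot^{((p-3)/2)}\left(\frac{\pi j}{p}\right)$; (iv) $\displaystyle c_p=-\left(\frac{-2}{p}\right)\frac{p^{(p-1)/2}}{p-1}\sum_{j=1}^{p-1}\left(\frac{j}{p}\right)B_{(p-1)/2}\left(\frac{j}{p}\right)$. If moreover $p\equiv 3 \pmod 4$, then also (v) $\displaystyle c_p=\frac{\sqrt p}{2^{(p+1)/2}}\sum_{j=1}^{p-1}\cot^{((p-3)/2)}\left(\frac{\pi j^2}{p}\right)$; (vi) $\displaystyle c_p=-\left(\frac{-2}{p}\right)\frac{p^{(p-1)/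2}}{p-1}\sum_{j=1}^{p-1}B_{(p-1)/2}\left(\mathrm{frac}\left(\frac{j^2}{p}\right)\right)$.
   Context: $\left(\frac{a}{p}\right)$ is the Legendre symbol. $\zeta(s,a)$ is the Hurwitz zeta function, $\zeta(s,a)=\sum_{n=0}^\infty (n+a)^{-s}$ for $\mathrm{Re}\,s>1$, extended by analytic continuation to other $s\neq 1$. $B_n(x)$ is the $n$-th Bernoulli polynomial, defined by $\frac{te^{xt}}{e^t-1}=\sum_{n\ge0}B_n(x)\frac{t^n}{n!}$. $\cot^{(m)}$ denotes the $m$-th derivative of the cotangent function. $\mathrm{frac}(x)=x-[x]$ is the fractional part of $x$. *)

(* Defs.v *)
From HB Require Import structures.
From mathcomp Require Import all_boot all_order all_algebra complex.
From mathcomp Require Import all_classical all_reals all_analysis.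

Set Implicit Arguments.
Unset Strict Implicit.
Unset Printing Implicit Defensive.

Import Order.TTheory GRing.Theory Num.Theory.
Import numFieldNormedType.Exports.

Local Open Scope classical_set_scope.
Local Open Scope complex_scope.
Local Open Scope ring_scope.

Definition legendre (a : int) (p : nat) : int :=
  if (p %| a)%Z then 0
  else if [exists x : 'I_p, (x%:Z ^+ 2 == a %[mod p])%Z] then 1 else -1.

Definition cot (R : realType) (x : R) : R := cos x / sin x.

Definition frac_part (R : realType) (x : R) : R := x - (Num.floor x)%:~R.

(* x ^ s = exp (s * ln x), with the real logarithm; meaningful for x > 0. *)
Definition rpowC (R : realType) (x : R) (s : R[i]) : R[i] :=
  let: u +i* v := s in
  (expR (u * ln x))%:C * (cos (v * ln x) +i* sin (v * ln x)).

(* The topology on a numFieldType is the one given by its norm; below,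
   K is R or R[i]. *)
Definition sums_to (K : numFieldType) (u : nat -> K) (l : K) : Prop :=
  series u @ \oo --> l.

Definition analytic_at (K : numFieldType) (f : K -> K) (z0 : K) : Prop :=
  exists c : nat -> K, \forall z \near z0,
    sums_to (fun n => c n * (z - z0) ^+ n) (f z).

(* The complement of 1 is connected, so for a > 0 the values f s with s != 1
   are determined by this predicate; f 1 is arbitrary. *)
Definition is_hurwitz_zeta (R : realType) (a : R) (f : R[i] -> R[i]) : Prop :=
  (forall s : R[i], 1 < complex.Re s ->
     sums_to (fun n => rpowC (n%:R + a) (- s)) (f s)) /\
  (forall s : R[i], s != 1 -> analytic_at f s).

Definition hurwitz_zeta (R : realType) (s : R[i]) (a : R) : R[i] :=
  xget (fun=> 0) [set f | is_hurwitz_zeta a f] s.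

(* The generating function is required only for t near 0: this already
   determines all the coefficients. *)
Definition is_bernoulli_poly (R : realType) (B : nat -> {poly R}) : Prop :=
  forall x : R, \forall t \near (0 : R)^',
    sums_to (fun n => (B n).[x] * (t ^+ n / n`!%:R))
      (t * expR (x * t) / (expR t - 1)).

Definition bernoulli_poly (R : realType) : nat -> {poly R} :=
  xget (fun=> 0) [set B | is_bernoulli_poly B].

Definition Kp (R : realType) (p : nat) : R[i] :=
  ((2 * pi) ^+ ((p - 1) %/ 2))%:C /
  ((Num.sqrt (p%:R : R) * ((p - 3) %/ 2)`!%:R)%:C *
   \sum_(1 <= j < p) (legendre j p)%:~R *
     hurwitz_zeta ((p - 1) %/ 2)%:R (j%:R / p%:R : R)).

(* Main.v *)
Require Import Defs.
From HB Require Import structures.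
From mathcomp Require Import all_boot all_order all_algebra complex.
From mathcomp Require Import all_classical all_reals all_analysis.
From mathcomp Require Import algC algnum.
From mathcomp Require Import ring lra zify.

(** Put [m = (p - 1) / 2], let [chi] be the quadratic character modulo [p] and
    [e = chi (-2)]. Every expression for the constant is the same number [cval], which
    is shown to be rational by its Bernoulli expression, an algebraic integer by its
    cotangent expression, and positive by its zeta expression.

    From zeta values to cotangents. Partial fractions express the derivative of order
    [m - 1] of the cotangent at [pi a] by the series of the [(n + a)^-m] over all
    integers [n] ([cotp_zeta]); they follow from the duplication formula of the
    cotangent by dominated convergence. Since [chi (- x) = (-1)^m chi x], summing
    against [chi] gives [cval_cotsum].

    From cotangents to Bernoulli polynomials. With [w = exp (2 pi i / p)] and
    [u = 1 / (w^j - 1)], the cotangent of [pi j / p] is [i (1 + 2 u)], and its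
    derivatives become polynomials [dpol] in [u] ([cotp_dpol]), whose values are the
    derivatives at [t = 0] of [1 / (w^j e^t - 1)]. Their finite Fourier transform
    consists of values of Bernoulli polynomials at the points [j / p] ([dfourierE]),
    so that the Gauss sum times the sum of the [chi x * dpol] is a sum of Bernoulli
    values ([gauss_dval]). The factor in front of the cotangent sum is the square root of
    [p]; up to a power of [i] it is the product [sinprod] of the [w^k - w^-k] for
    [1 <= k <= m] ([sinprod_sqrt]), and the Gauss sum is [e * sinprod]
    ([gauss_sinprod], by comparison modulo a power of [w - 1]). This gives
    [cval_bernsum].

    Integrality and sign. The product [sinprod] clears the denominators of [dpol] at
    [u], of degree at most [m] ([sinprod_dpol_aint]), and pairing [j] with [p - j]
    absorbs the remaining factor [1 / 2] ([cval_int]). Positivity is that of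
    [L(m, chi)], whose first term dominates the others ([zsum_gt0]).

    The Hurwitz zeta function is given by analyticity alone. Its continuation is
    constructed by Euler-Maclaurin summation: correcting the partial sums by the
    truncated asymptotic expansion makes them converge, and at a negative integer the
    corrected sums are constant, up to a factorial the value of a Bernoulli
    polynomial ([hurwitz_exists]). Analyticity of the limit is obtained without complex
    integration, by carrying bounds on the coefficients of power series ([pser])
    through every step. The continuation is unique by the identity theorem along a
    line ([hurwitz_unique]).

    When [p = 3 mod 4], [m] is odd and so are the two summands as functions of [j]
    modulo [p]; summing an odd function over squares amounts to summing it against
    [chi] ([sum_squares_odd]). *)

Set Implicit Arguments.
Unset Strict Implicit.
Unset Printing Implicit Defensive.

Import Order.TTheory GRing.Theory Num.Theory.
Import numFieldNormedType.Exports.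

Local Open Scope classical_set_scope.
Local Open Scope complex_scope.
Local Open Scope ring_scope.

Notation normc := ComplexField.Normc.normc.
Notation Re := complex.Re.
Notation Im := complex.Im.
Arguments ComplexField.Normc.normc : simpl never.

(** * Complex series, measured by the real-valued modulus *)

Section ComplexSeries.
Variable R : realType.
Implicit Types (u v : nat -> R[i]) (z l : R[i]).

Lemma normrC z : `|z| = (normc z)%:C. Proof. by []. Qed.

Lemma normc_ge0 z : 0 <= normc z.
Proof. by case: z => a b; rewrite sqrtr_ge0. Qed.

Lemma normc0 : normc (0 : R[i]) = 0.
Proof. by rewrite /ComplexField.Normc.normc /= expr0n addr0 sqrtr0. Qed.

Lemma normc_eq0 z : (normc z == 0) = (z == 0).
Proof.
by apply/eqP/eqP => [/ComplexField.Normc.eq0_normc|->]; rewrite ?normc0.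
Qed.

Lemma normcM z w : normc (z * w) = normc z * normc w.
Proof. exact: ComplexField.Normc.normcM. Qed.

Lemma normcD z w : normc (z + w) <= normc z + normc w.
Proof. exact: le_normcD. Qed.

Lemma normcN z : normc (- z) = normc z.
Proof. exact: normcN. Qed.

Lemma normcB z w : normc (z - w) <= normc z + normc w.
Proof. by rewrite -(normcN w) normcD. Qed.

Lemma normcR (x : R) : normc x%:C = `|x|.
Proof. by rewrite /ComplexField.Normc.normc /= expr0n addr0 sqrtr_sqr. Qed.

Lemma normc1 : normc (1 : R[i]) = 1.
Proof. by rewrite -[1]/(1%:C) normcR normr1. Qed.

Lemma normcX z n : normc (z ^+ n) = normc z ^+ n.
Proof. by elim: n => [|n IHn]; rewrite ?normc1// !exprS normcM IHn. Qed.

Lemma normcV z : normc z^-1 = (normc z)^-1.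
Proof. exact: ComplexField.Normc.normcV. Qed.

Lemma normc_nat n : normc (n%:R : R[i]) = n%:R.
Proof. by rewrite -(rmorph_nat (real_complex R)) normcR normr_nat. Qed.

Lemma normc_sum n (F : nat -> R[i]) :
  normc (\sum_(k < n) F k) <= \sum_(k < n) normc (F k).
Proof.
elim: n => [|n IHn]; first by rewrite !big_ord0 normc0.
by rewrite !big_ord_recr/= (le_trans (normcD _ _))// lerD2r.
Qed.

Lemma ReD z w : Re (z + w) = Re z + Re w. Proof. by case: z w => ? ? []. Qed.
Lemma ImD z w : Im (z + w) = Im z + Im w. Proof. by case: z w => ? ? []. Qed.
Lemma ReN z : Re (- z) = - Re z. Proof. by case: z. Qed.
Lemma ImN z : Im (- z) = - Im z. Proof. by case: z. Qed.

Lemma Re_sum n (F : nat -> R[i]) : Re (\sum_(k < n) F k) = \sum_(k < n) Re (F k).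
Proof. by apply: (big_morph (@complex.Re R) ReD). Qed.

Lemma Im_sum n (F : nat -> R[i]) : Im (\sum_(k < n) F k) = \sum_(k < n) Im (F k).
Proof. by apply: (big_morph (@complex.Im R) ImD). Qed.

Lemma Re_le_normc z : `|Re z| <= normc z.
Proof.
by case: z => a b ; rewrite /ComplexField.Normc.normc /= -sqrtr_sqr ler_sqrt ?lerDl ?sqr_ge0// addr_ge0 ?sqr_ge0.
Qed.

Lemma Im_le_normc z : `|Im z| <= normc z.
Proof.
by case: z => a b ; rewrite /ComplexField.Normc.normc /= -sqrtr_sqr ler_sqrt ?lerDr ?sqr_ge0// addr_ge0 ?sqr_ge0.
Qed.

Lemma normc_le_ReIm z : normc z <= `|Re z| + `|Im z|.
Proof.
case: z => a b ; rewrite /ComplexField.Normc.normc /= -[leRHS]ger0_norm ?addr_ge0// -sqrtr_sqr ler_sqrt ?sqr_ge0//.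
rewrite sqrrD !real_normK ?num_real// -addrA lerD2l addrC lerDl.
by rewrite mulrn_wge0// mulr_ge0.
Qed.

(** The norm of [R[i]] takes its values in [R[i]] itself. Measuring distances by
    the real-valued modulus instead gives access to the order and to the monotone
    convergence of [R]. *)
Definition cvgC u l := (fun n => normc (u n - l)) @ \oo --> (0 : R).

Lemma sums_to_dist (K : numFieldType) (u : nat -> K) (l : K) :
  sums_to u l <-> forall e : K, 0 < e ->
    \forall n \near \oo, `|l - \sum_(k < n) u k| < e.
Proof.
rewrite /sums_to /series; under eq_fun do rewrite big_mkord.
exact: (@cvgrPdist_lt K K).
Qed.

Definition csum u l := cvgC (fun n => \sum_(k < n) u k) l.

Lemma sums_toE u l : sums_to u l <-> csum u l.
Proof.
rewrite sums_to_dist /csum /cvgC; split.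
  move=> H; apply/cvgrPdist_lt => e e0.
  have := H e%:C; rewrite ltcR => /(_ e0) [N _ HN].
  exists N => // n /= /HN /=; rewrite sub0r normrN (ger0_norm (normc_ge0 _)).
  by rewrite normrC ltcR -normcN opprB.
move=> /cvgrPdist_lt H e.
rewrite ltcE => /andP[/eqP e0 e1].
have -> : e = (Re e)%:C by case: e e0 e1 => a b /= ->.
have [N _ HN] := H _ e1; exists N => // n /= /HN /=.
rewrite sub0r normrN (ger0_norm (normc_ge0 _)).
by rewrite normrC ltcR -normcN opprB.
Qed.

Lemma sums_toRE (u : nat -> R) (l : R) :
  sums_to u l <-> (fun n => \sum_(k < n) u k) @ \oo --> l.
Proof.
rewrite /sums_to /series.
by under eq_fun do rewrite big_mkord.
Qed.

Lemma cvgC_ReIm u l :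
  cvgC u l <-> ((fun n => Re (u n)) @ \oo --> Re l) /\
               ((fun n => Im (u n)) @ \oo --> Im l).
Proof.
split=> [h|[hr hi]].
  split; apply/subr_cvg0; apply/norm_cvg0P;
    apply: (squeeze_cvgr _ (cvg_cst _) h); apply: nearW => n /=;
    rewrite normr_ge0/= -?ReN -?ImN -?ReD -?ImD ?Re_le_normc ?Im_le_normc//.
have h : (fun n => `|Re (u n) - Re l| + `|Im (u n) - Im l|) @ \oo --> (0 : R).
  rewrite -[0 : R]addr0; apply: cvgD; apply/norm_cvg0P/subr_cvg0; assumption.
apply: (squeeze_cvgr _ (cvg_cst _) h); apply: nearW => n /=.
by rewrite normc_ge0/= -ReN -ImN -ReD -ImD normc_le_ReIm.
Qed.

Lemma cvgC_unique u l l' : cvgC u l -> cvgC u l' -> l = l'.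
Proof.
move=> /cvgC_ReIm[a b] /cvgC_ReIm[c d].
by apply/eqP; rewrite eq_complex (cvg_unique _ a c)// (cvg_unique _ b d)// !eqxx.
Qed.

Lemma cvgC_ext u v l : (forall n, u n = v n) -> cvgC u l -> cvgC v l.
Proof. by move=> e; have -> : u = v by apply: funext. Qed.

Lemma cvgC_cst l : cvgC (fun=> l) l.
Proof. by rewrite /cvgC subrr normc0; exact: cvg_cst. Qed.

Lemma cvgC_D u v l l' : cvgC u l -> cvgC v l' -> cvgC (fun n => u n + v n) (l + l').
Proof.
move=> /cvgC_ReIm[a b] /cvgC_ReIm[c d]; apply/cvgC_ReIm.
rewrite ReD ImD; split; under eq_fun do rewrite ?ReD ?ImD; exact: cvgD.
Qed.

Lemma cvgC_Z c u l : cvgC u l -> cvgC (fun n => c * u n) (c * l).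
Proof.
rewrite /cvgC => h; under eq_fun do rewrite -mulrBr normcM.
by rewrite -[0 : R](mulr0 (normc c)); exact: cvgMl_tmp.
Qed.

Lemma cvgC_R (u : nat -> R) (l : R) : cvgC (fun n => (u n)%:C) l%:C <-> u @ \oo --> l.
Proof.
by split=> [/cvgC_ReIm[]//|h]; apply/cvgC_ReIm; split=> //; exact: cvg_cst.
Qed.

Lemma cvgC_le u l (B : R) : cvgC u l -> (forall n, normc (u n) <= B) -> normc l <= B.
Proof.
move=> h hB; apply/ler_addgt0Pr => e e0.
move/cvgrPdist_lt : h => /(_ e e0)[N _ /(_ N (leqnn N))] /=.
rewrite sub0r normrN (ger0_norm (normc_ge0 _)) => H.
have -> : l = u N - (u N - l) by ring.
by rewrite (le_trans (normcB _ _))// lerD// ltW.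
Qed.

Lemma cvgC_shift u l k : cvgC (fun n => u (n + k)%N) l <-> cvgC u l.
Proof. by rewrite /cvgC -(cvg_shiftn k (fun n => normc (u n - l))). Qed.

Lemma csum_R (u : nat -> R) (l : R) : csum (fun n => (u n)%:C) l%:C <-> sums_to u l.
Proof.
rewrite /csum sums_toRE -cvgC_R.
by under [X in cvgC X _ <-> _]eq_fun do rewrite -(rmorph_sum (real_complex R)).
Qed.

Lemma cvgn_eps (u : nat -> R) (l e : R) : u @ \oo --> l -> 0 < e ->
  exists N, forall n, (N <= n)%N -> `|l - u n| < e.
Proof.
by move=> /cvgrPdist_lt h e0; have [N _ HN] := h e e0; exists N.
Qed.

Lemma sum_bounded_cvg (M : nat -> R) (B : R) :
  (forall k, 0 <= M k) -> (forall n, \sum_(k < n) M k <= B) ->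
  exists S : R, ((fun n => \sum_(k < n) M k) @ \oo --> S) /\ S <= B.
Proof.
move=> M0 MB.
have nd : {homo (fun n => \sum_(k < n) M k) : n m / (n <= m)%N >-> n <= m}.
  apply/nondecreasing_seqP => n; by rewrite big_ord_recr lerDl.
have c : cvgn (fun n => \sum_(k < n) M k).
  apply: nondecreasing_is_cvgn => //; exists B => _ [n _ <-] /=; exact: MB.
by exists (limn (fun n => \sum_(k < n) M k)); split=> //; apply: limr_le => //; apply: nearW.
Qed.

Lemma cvg_sum_ord (u : nat -> nat -> R) (l : nat -> R) n :
  (forall k, (fun N => u k N) @ \oo --> l k) ->
  (fun N => \sum_(k < n) u k N) @ \oo --> \sum_(k < n) l k.
Proof.
move=> ul; elim: n => [|n IH].
  by under eq_fun do rewrite big_ord0; rewrite big_ord0; exact: cvg_cst.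
by under eq_fun do rewrite big_ord_recr/=; rewrite big_ord_recr/=; exact: cvgD.
Qed.

(** Dominated convergence for series (Tannery): the tails of all the series are
    controlled by the single tail of the majorant. *)
Lemma tanneryR (a : nat -> nat -> R) (M : nat -> R) (B : R) (l s : nat -> R) :
  (forall k, (fun N => a k N) @ \oo --> l k) ->
  (forall k N, `|a k N| <= M k) ->
  (forall n, \sum_(k < n) M k <= B) ->
  (forall N, (fun n => \sum_(k < n) a k N) @ \oo --> s N) ->
  exists S : R, ((fun n => \sum_(k < n) l k) @ \oo --> S) /\ (s @ \oo --> S).
Proof.
move=> al aM MB as_.
have M0 k : 0 <= M k by rewrite (le_trans _ (aM k 0%N)).
have [T [MT _]] := sum_bounded_cvg M0 MB.
have lM k : `|l k| <= M k.
  apply: (ler_cvg_to (cvg_norm (al k)) (cvg_cst (M k))).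
  exact: nearW.
have cl : cvgn (series l).
  apply: normed_cvg; apply: (@series_le_cvg R _ M) => // [n|]; first exact: normr_ge0.
  by rewrite /series; under eq_fun do rewrite big_mkord; apply/cvg_ex; exists T.
pose S := limn (series l).
have lS : (fun n => \sum_(k < n) l k) @ \oo --> S.
  by move: cl; rewrite /S /series; under eq_fun do rewrite big_mkord.
exists S; split=> //.
have tail K (b : nat -> R) (t : R) : (forall k, `|b k| <= M k) ->
    (fun n => \sum_(k < n) b k) @ \oo --> t ->
    `|t - \sum_(k < K) b k| <= T - \sum_(k < K) M k.
  move=> bM bt.
  have h1 : (fun n => `|\sum_(k < n) b k - \sum_(k < K) b k|) @ \oo
      --> `|t - \sum_(k < K) b k|.
    by apply: cvg_norm; apply: cvgB => //; exact: cvg_cst.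
  have h2 : (fun n => \sum_(k < n) M k - \sum_(k < K) M k) @ \oo
      --> T - \sum_(k < K) M k.
    by apply: cvgB => //; exact: cvg_cst.
  apply: (ler_cvg_to h1 h2); exists K => // n /= Kn.
  rewrite -(subnKC Kn) !big_split_ord/= !(addrC (\sum_(k < K) _)) !addrK.
  by rewrite (le_trans (ler_norm_sum _ _ _))// ler_sum.
apply/cvgrPdist_lt => e e0.
have e3 : 0 < e / 3 by rewrite divr_gt0.
have [K /(_ K (leqnn K)) HK] := cvgn_eps MT e3.
have fin := @cvg_sum_ord a l K al.
have [N0 HN] := cvgn_eps fin e3.
exists N0 => // N /= /HN h3.
have h1 := tail K l S lM lS.
have h2 := tail K (a^~ N) (s N) (aM^~ N) (as_ N).
have h4 := ler_norm (T - \sum_(k < K) M k).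
move: h1 h2 h3 HK h4; set X := \sum_(k < K) l k; set Y := \sum_(k < K) a k N.
set D := T - _ => h1 h2 h3 h4 h5.
have -> : S - s N = (S - X) + (X - Y) - (s N - Y) by ring.
have := ler_normB (S - X + (X - Y)) (s N - Y).
have := ler_normD (S - X) (X - Y). lra.
Qed.

Lemma csum_ReIm u l : csum u l <->
  sums_to (fun n => Re (u n)) (Re l) /\ sums_to (fun n => Im (u n)) (Im l).
Proof.
rewrite /csum cvgC_ReIm !sums_toRE.
have -> : (fun n => Re (\sum_(k < n) u k)) = (fun n => \sum_(k < n) Re (u k)).
  by apply: funext => n; rewrite Re_sum.
have -> // : (fun n => Im (\sum_(k < n) u k)) = (fun n => \sum_(k < n) Im (u k)).
by apply: funext => n; rewrite Im_sum.
Qed.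

Lemma tannery (a : nat -> nat -> R[i]) (M : nat -> R) (B : R) (l s : nat -> R[i]) :
  (forall k, cvgC (fun N => a k N) (l k)) ->
  (forall k N, normc (a k N) <= M k) ->
  (forall n, \sum_(k < n) M k <= B) ->
  (forall N, csum (fun k => a k N) (s N)) ->
  exists S, csum l S /\ cvgC s S.
Proof.
move=> al aM MB as_.
have aR k N : `|Re (a k N)| <= M k := le_trans (Re_le_normc _) (aM k N).
have aI k N : `|Im (a k N)| <= M k := le_trans (Im_le_normc _) (aM k N).
have [|S1 [l1 s1]] := tanneryR (fun k => ((cvgC_ReIm _ _).1 (al k)).1) aR MB (s := fun N => Re (s N)).
  by move=> N; have /csum_ReIm[/sums_toRE] := as_ N.
have [|S2 [l2 s2]] := tanneryR (fun k => ((cvgC_ReIm _ _).1 (al k)).2) aI MB (s := fun N => Im (s N)).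
  by move=> N; have /csum_ReIm[_ /sums_toRE] := as_ N.
exists (S1 +i* S2); split; last by apply/cvgC_ReIm.
by apply/csum_ReIm; split; apply/sums_toRE.
Qed.

(** Used for sums of fixed length that Tannery's theorem wants to see as series. *)
Lemma csum_fin u K : (forall k, (K <= k)%N -> u k = 0) -> csum u (\sum_(k < K) u k).
Proof.
move=> u0; apply/(cvgC_shift _ _ K).
apply: cvgC_ext (cvgC_cst _) => n; rewrite addnC big_split_ord/= [X in _ + X]big1 ?addr0//.
by move=> i _; apply: u0; rewrite leq_addr.
Qed.

(** The partial sums of the Cauchy product are
    sum_(k < N) a_k * (sum_(l < N - k) b_l), to which Tannery applies. *)
Lemma cauchy_product (a b : nat -> R[i]) (Ma Mb : R) (A B : R[i]) :
  (forall n, \sum_(k < n) normc (a k) <= Ma) ->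
  (forall n, \sum_(k < n) normc (b k) <= Mb) ->
  csum a A -> csum b B ->
  csum (fun n => \sum_(k < n.+1) a k * b (n - k)%N) (A * B).
Proof.
move=> aM bM aA bB.
pose t k N := a k * \sum_(l < N - k) b l.
have tB k : cvgC (fun N => t k N) (a k * B).
  apply: cvgC_Z; apply/(cvgC_shift _ _ k).
  apply: cvgC_ext bB => n; by rewrite addnK.
have tM k N : normc (t k N) <= normc (a k) * Mb.
  rewrite normcM ler_wpM2l ?normc_ge0//.
  by rewrite (le_trans _ (bM (N - k)%N))// normc_sum.
have MB n : \sum_(k < n) normc (a k) * Mb <= Ma * Mb.
  rewrite -mulr_suml ler_wpM2r//; by have := bM 0%N; rewrite big_ord0.
have ts N : csum (fun k => t k N) (\sum_(k < N) t k N).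
  apply: csum_fin => k Nk.
  by rewrite /t (eqP (_ : N - k == 0)%N) ?subn_eq0// big_ord0 mulr0.
have [S [h1 h2]] := tannery tB tM MB ts.
have SE : S = A * B.
  apply: (cvgC_unique h1); rewrite mulrC.
  apply: cvgC_ext (cvgC_Z B aA) => n.
  by rewrite mulr_sumr; apply: eq_bigr => i _; rewrite mulrC.
rewrite -SE; apply: cvgC_ext h2 => N; rewrite /t.
elim: N => [|N IH]; first by rewrite !big_ord0.
rewrite [RHS]big_ord_recr/= -IH [LHS]big_ord_recr/= subSn// subnn big_ord1.
rewrite [X in _ = _ + X]big_ord_recr/= subnn addrA; congr (_ + _).
rewrite -big_split/=; apply: eq_bigr => k _.
by rewrite subSn ?(ltnW (ltn_ord k))// big_ord_recr/= mulrDr.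
Qed.
End ComplexSeries.

(** * Power series with a bound on their coefficients *)

Section PowerSeries.
Variable R : realType.
Implicit Types (u v c : nat -> R[i]) (z w l : R[i]) (f g : R[i] -> R[i]) (r M B : R).

Lemma csum_unique u l l' : csum u l -> csum u l' -> l = l'.
Proof. by exact: cvgC_unique. Qed.

Lemma csum_ext u v l : (forall n, u n = v n) -> csum u l -> csum v l.
Proof. by move=> e; have -> : u = v by apply: funext. Qed.

Lemma csumD u v l l' : csum u l -> csum v l' ->
  csum (fun n => u n + v n) (l + l').
Proof.
move=> a b; apply: cvgC_ext (cvgC_D a b) => n.
by rewrite big_split.
Qed.

Lemma csumZ z u l : csum u l -> csum (fun n => z * u n) (z * l).
Proof.
move=> a; apply: cvgC_ext (cvgC_Z z a) => n.
by rewrite mulr_sumr.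
Qed.

Lemma csumS u l : csum (fun n => u n.+1) l <-> csum u (u 0%N + l).
Proof.
split=> h.
  apply/(cvgC_shift _ _ 1); apply: cvgC_ext (cvgC_D (cvgC_cst (u 0%N)) h) => n.
  by rewrite addn1 big_ord_recl.
have {}h := (cvgC_shift _ _ 1).2 h.
have -> : l = u 0%N + l + - u 0%N by rewrite addrAC subrr add0r.
apply: cvgC_ext (cvgC_D h (cvgC_cst _)) => n.
by rewrite addn1 big_ord_recl/= addrAC subrr add0r.
Qed.

Lemma csum_sum I (s : seq I) (F : I -> nat -> R[i]) (L : I -> R[i]) :
  (forall i, csum (F i) (L i)) ->
  csum (fun n => \sum_(i <- s) F i n) (\sum_(i <- s) L i).
Proof.
move=> h; elim: s => [|i s IH].
  rewrite big_nil; apply: (csum_ext (u := fun=> 0)); first by move=> n; rewrite big_nil.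
  by rewrite /csum; apply: cvgC_ext (cvgC_cst 0) => n; rewrite big1.
rewrite big_cons; apply: csum_ext (csumD (h i) IH) => n.
by rewrite big_cons.
Qed.

Lemma abs_csum u B : (forall n, \sum_(k < n) normc (u k) <= B) ->
  exists2 S, csum u S & normc S <= B.
Proof.
move=> uB.
have [|k N|N|S [h _]] := @tannery R (fun k N => if (k < N)%N then u k else 0)
    (fun k => normc (u k)) B u (fun N => \sum_(k < N) u k) _ _ uB.
- move=> k; apply/(cvgC_shift _ _ k.+1); apply: cvgC_ext (cvgC_cst _) => n.
  by rewrite addnS ltnS leq_addl.
- by case: ifP => // _; rewrite normc0 normc_ge0.
- have /= := @csum_fin R (fun k => if (k < N)%N then u k else 0) N.
  have -> : \sum_(k < N) (if (k < N)%N then u k else 0) = \sum_(k < N) u k.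
    by apply: eq_bigr => k _; rewrite ltn_ord.
  by apply => k Nk; rewrite ltnNge Nk.
exists S => //; apply: (cvgC_le h) => n.
by rewrite (le_trans (normc_sum _ _)).
Qed.

(** [f] is given on the closed disc of centre [z0] and radius [r] by a power
    series whose l^1 norm at radius [r] is at most [M]: unlike a bound on [f]
    itself, such a bound passes to infinite sums without Cauchy's formula. *)
Definition pser f z0 r M := exists c,
  (forall n, \sum_(k < n) normc (c k) * r ^+ k <= M) /\
  forall z, normc (z - z0) <= r -> csum (fun k => c k * (z - z0) ^+ k) (f z).

Lemma pser_ge0 f z0 r M : pser f z0 r M -> 0 <= M.
Proof. by case=> c [/(_ 0%N)]; rewrite big_ord0. Qed.

Lemma ler_term c r z k : normc z <= r -> normc (c k * z ^+ k) <= normc (c k) * r ^+ k.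
Proof.
move=> h; rewrite normcM normcX ler_wpM2l ?normc_ge0// lerXn2r ?nnegrE ?normc_ge0//.
by rewrite (le_trans (normc_ge0 z)).
Qed.

Lemma pser_bound f z0 r M z : pser f z0 r M -> normc (z - z0) <= r -> normc (f z) <= M.
Proof.
move=> [c [cM cf]] zr; apply: (cvgC_le (cf z zr)) => n.
rewrite (le_trans (normc_sum _ (fun k => c k * (z - z0) ^+ k)))// (le_trans _ (cM n))//.
by apply: ler_sum => i _; exact: ler_term.
Qed.

Lemma pser_ext f g z0 r M : (forall z, normc (z - z0) <= r -> f z = g z) ->
  pser f z0 r M -> pser g z0 r M.
Proof. by move=> e [c [cM cf]]; exists c; split=> // z zr; rewrite -e//; exact: cf. Qed.

Lemma pser_le f z0 r M M' : M <= M' -> pser f z0 r M -> pser f z0 r M'.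
Proof. by move=> e [c [cM cf]]; exists c; split=> // n; exact: le_trans e. Qed.

Lemma pser_cst a z0 r : pser (fun=> a) z0 r (normc a).
Proof.
exists (fun k => if k is 0%N then a else 0); split=> [[|n]|z _].
- by rewrite big_ord0 normc_ge0.
- by rewrite big_ord_recl/= big1 ?addr0 ?mulr1// => i _; rewrite normc0 mul0r.
- apply/(cvgC_shift _ _ 1); apply: cvgC_ext (cvgC_cst _) => n.
  by rewrite addn1 big_ord_recl/= expr0 mulr1 big1 ?addr0// => i _; rewrite mul0r.
Qed.

Lemma pserD f g z0 r M M' : 0 <= r -> pser f z0 r M -> pser g z0 r M' ->
  pser (fun z => f z + g z) z0 r (M + M').
Proof.
move=> r0 [c [cM cf]] [d [dM dg]]; exists (fun k => c k + d k); split=> [n|z zr].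
  rewrite (le_trans _ (lerD (cM n) (dM n)))// -big_split/= ler_sum// => i _.
  by rewrite -mulrDl ler_wpM2r ?exprn_ge0 ?normcD.
by apply: csum_ext (csumD (cf z zr) (dg z zr)) => n; rewrite mulrDl.
Qed.

Lemma pserZ a f z0 r M : pser f z0 r M -> pser (fun z => a * f z) z0 r (normc a * M).
Proof.
move=> [c [cM cf]]; exists (fun k => a * c k); split=> [n|z zr].
  under eq_bigr do rewrite normcM -mulrA.
  by rewrite -mulr_sumr ler_wpM2l ?normc_ge0.
by apply: csum_ext (csumZ a (cf z zr)) => n; rewrite mulrA.
Qed.

Lemma pser_sum I (s : seq I) (F : I -> R[i] -> R[i]) z0 r (M : I -> R) : 0 <= r ->
  (forall i, pser (F i) z0 r (M i)) ->
  pser (fun z => \sum_(i <- s) F i z) z0 r (\sum_(i <- s) M i).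
Proof.
move=> r0 h; elim: s => [|i s IH].
  rewrite big_nil; have := pser_cst 0 z0 r; rewrite normc0.
  by apply: pser_ext => z _; rewrite big_nil.
rewrite big_cons; apply: pser_ext (pserD r0 (h i) IH) => z _.
by rewrite big_cons.
Qed.

Definition shift_coef c k := if k is k'.+1 then c k' else 0.

Lemma shift_coef_sums c z l : csum (fun k => c k * z ^+ k) l ->
  csum (fun k => shift_coef c k * z ^+ k) (z * l).
Proof.
move=> h; have := (csumS (fun k => shift_coef c k * z ^+ k) (z * l)).1.
rewrite /= mul0r add0r; apply.
by apply: csum_ext (csumZ z h) => n; rewrite mulrCA exprS.
Qed.

Lemma shift_coef_bound c r M : 0 <= r ->
  (forall n, \sum_(k < n) normc (c k) * r ^+ k <= M) ->
  forall n, \sum_(k < n) normc (shift_coef c k) * r ^+ k <= r * M.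
Proof.
move=> r0 cM [|n]; first by rewrite big_ord0 mulr_ge0//; have := cM 0%N; rewrite big_ord0.
rewrite big_ord_recl/= normc0 mul0r add0r.
rewrite (le_trans _ (ler_wpM2l r0 (cM n)))// mulr_sumr ler_sum// => i _.
by rewrite /bump/= mulrCA exprS.
Qed.

(** About [z0] the factor is [(z0 + a) + (z - z0)], and [z - z0] only shifts the
    coefficients. *)
Lemma pser_affine a f z0 r M : 0 <= r -> pser f z0 r M ->
  pser (fun z => (z + a) * f z) z0 r ((normc (z0 + a) + r) * M).
Proof.
move=> r0 [c [cM cf]]; exists (fun k => (z0 + a) * c k + shift_coef c k); split=> [n|z zr].
  apply: (@le_trans _ _ (\sum_(k < n) (normc (z0 + a) * (normc (c k) * r ^+ k) +
       normc (shift_coef c k) * r ^+ k))).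
    apply: ler_sum => i _; rewrite mulrA -mulrDl ler_wpM2r ?exprn_ge0//.
    by rewrite -normcM normcD.
  rewrite big_split/= -mulr_sumr mulrDl lerD ?shift_coef_bound//.
  by rewrite ler_wpM2l ?normc_ge0// cM.
have -> : (z + a) * f z = (z0 + a) * f z + (z - z0) * f z by ring.
apply: csum_ext (csumD (csumZ (z0 + a) (cf z zr)) (shift_coef_sums (cf z zr))) => n.
by rewrite mulrA -mulrDl.
Qed.

(** Weierstrass: the double series converges absolutely, so that its two orders
    of summation agree by Tannery's theorem. *)
Lemma pser_series (F : nat -> R[i] -> R[i]) f z0 r (M : nat -> R) B : 0 < r ->
  (forall n, pser (F n) z0 r (M n)) ->
  (forall N, \sum_(n < N) M n <= B) ->
  (forall z, normc (z - z0) <= r -> csum (fun n => F n z) (f z)) ->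
  pser f z0 r B.
Proof.
move=> r0 FM MB Ff.
have [c Hc] := choice FM.
have cM n k : normc (c n k) * r ^+ k <= M n.
  have := (Hc n).1 k.+1; rewrite big_ord_recr/=; apply: le_trans.
  by rewrite lerDr sumr_ge0// => i _; rewrite mulr_ge0 ?normc_ge0 ?exprn_ge0// ltW.
have nr0 n k : 0 <= normc (c n k) * r ^+ k.
  by rewrite mulr_ge0 ?normc_ge0 ?exprn_ge0// ltW.
have HT k : exists T : R, ((fun N => \sum_(n < N) normc (c n k) * r ^+ k) @ \oo --> T) /\ T <= B.
  apply: (sum_bounded_cvg (M := fun n => normc (c n k) * r ^+ k)) => // N; rewrite (le_trans _ (MB N))//.
  by apply: ler_sum => n _.
have [T {}HT] := choice HT.
have TB K : \sum_(k < K) T k <= B.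
  have h := @cvg_sum_ord R (fun k N => \sum_(n < N) normc (c n k) * r ^+ k) T K (fun k => (HT k).1).
  apply: (ler_cvg_to h (cvg_cst B)); apply: nearW => N.
  rewrite exchange_big/= (le_trans _ (MB N))// ler_sum// => n _; exact: (Hc n).1.
have HC k : exists S, csum (fun n => c n k) S.
  have [|S hS _] := @abs_csum (fun n => c n k) (B / r ^+ k); last by exists S.
  move=> N; rewrite ler_pdivlMr ?exprn_gt0// mulr_suml (le_trans _ (MB N))//.
  by apply: ler_sum.
have [C {}HC] := choice HC.
have ndT k : {homo (fun N => \sum_(n < N) normc (c n k) * r ^+ k) : n m / (n <= m)%N >-> n <= m}.
  by apply/nondecreasing_seqP => n; rewrite big_ord_recr lerDl.
have le1 k N : normc (\sum_(n < N) c n k) * r ^+ k <= \sum_(n < N) normc (c n k) * r ^+ k.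
  rewrite -mulr_suml ler_wpM2r ?exprn_ge0// ?(ltW r0)//.
  exact: (normc_sum N (fun n => c n k)).
have leT k N : \sum_(n < N) normc (c n k) * r ^+ k <= T k.
  have -> : T k = limn (fun N => \sum_(n < N) normc (c n k) * r ^+ k).
    by apply/esym/cvg_lim => //; exact: (HT k).1.
  by apply: nondecreasing_cvgn_le => //; apply/cvg_ex; exists (T k); exact: (HT k).1.
have CT k : normc (C k) * r ^+ k <= T k.
  rewrite -ler_pdivlMr ?exprn_gt0//.
  apply: (cvgC_le (HC k)) => N.
  by rewrite ler_pdivlMr ?exprn_gt0// (le_trans (le1 k N)).
exists C; split=> [K|z zr].
  by rewrite (le_trans _ (TB K))// ler_sum.
have [k|k N||N|S [h1 h2]] := @tannery R (fun k N => (\sum_(n < N) c n k) * (z - z0) ^+ k) T B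
   (fun k => C k * (z - z0) ^+ k) (fun N => \sum_(n < N) F n z).
- rewrite mulrC; apply: cvgC_ext (cvgC_Z _ (HC k)) => n.
  by rewrite mulrC.
- rewrite (le_trans (@ler_term (fun k => \sum_(n < N) c n k) r (z - z0) k zr))//.
  by rewrite (le_trans (le1 k N)).
- exact: TB.
- rewrite -(big_mkord xpredT (fun n => F n z)).
  apply: csum_ext (csum_sum (index_iota 0 N) (fun n => (Hc n).2 z zr)) => k.
  by rewrite mulr_suml -(big_mkord xpredT (fun n => c n k * (z - z0) ^+ k)).
by rewrite (cvgC_unique (Ff z zr) h2).
Qed.

Lemma nearC (P : set (R[i] : numFieldType)) (z0 : R[i]) : nbhs (z0 : (R[i] : numFieldType)) P <->
  exists2 r, 0 < r & forall z, normc (z - z0) < r -> P z.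
Proof.
split.
  move=> /nbhs_ballP[e /= e0 eP].
  exists (Re e); first by move: e0; rewrite ltcE => /andP[].
  move=> z zr; apply: eP; rewrite /ball/= /ball_ /=.
  move: e0; rewrite ltcE => /andP[/eqP e1 _].
  have -> : e = (Re e)%:C by case: e e1 zr => a b /= ->.
  by rewrite -normcN opprB in zr; rewrite ltcR.
move=> [r r0 rP]; apply/nbhs_ballP; exists r%:C; first by rewrite /= ltcR.
move=> z; rewrite /ball/= /ball_ /= => zr; apply: rP.
by move: zr; rewrite -normcN opprB ltcR.
Qed.

Lemma pser_analytic f z0 r M : 0 < r -> pser f z0 r M ->
  analytic_at (f : (R[i] : numFieldType) -> _) z0.
Proof.
move=> r0 [c [_ cf]]; exists c; apply/nearC; exists r => // z /ltW zr.
by apply/sums_toE; apply: cf.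
Qed.

Lemma pser_reflect f a z0 r M : pser f (a - z0) r M -> pser (fun z => f (a - z)) z0 r M.
Proof.
move=> [c [cM cf]]; exists (fun k => (-1) ^+ k * c k); split=> [n|z zr].
  rewrite (le_trans _ (cM n))// ler_sum// => i _.
  by rewrite normcM normcX normcN normc1 expr1n mul1r.
have e : a - z - (a - z0) = - (z - z0) by ring.
have /cf : normc (a - z - (a - z0)) <= r by rewrite e normcN.
apply: csum_ext => n.
rewrite e [in LHS]exprNn.
by rewrite [LHS]mulrA [c n * _]mulrC.
Qed.

(** Isolated zeros: near the origin the lowest nonzero term dominates. *)
Lemma power_series_zero c r B : 0 < r ->
  (forall n, normc (c n) * r ^+ n <= B) ->
  (forall e : R, 0 < e -> exists w, [/\ w != 0, normc w < e & csum (fun k => c k * w ^+ k) 0]) ->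
  forall k, c k = 0.
Proof.
move=> r0 cB small k; elim/ltn_ind: k => k IH.
have B0 : 0 <= B by rewrite (le_trans _ (cB 0%N))// mulr_ge0 ?normc_ge0.
apply/eqP; rewrite -normc_eq0 eq_le normc_ge0 andbT.
apply/ler_addgt0Pr => e e0; rewrite add0r.
pose D := 2 * B / r ^+ k.+1 + 1.
have D0 : 0 < D.
  by rewrite ltr_wpDl// divr_ge0 ?mulr_ge0// exprn_ge0// ltW.
have [|w [w0 ws hw]] := small (Num.min (r / 2) (e / D)).
  by rewrite lt_min !divr_gt0.
move: ws; rewrite lt_min => /andP[wr we].
have nw : 0 < normc w by rewrite lt_neqAle eq_sym normc_eq0 w0 normc_ge0.
pose q := normc w / r.
have q0 : 0 <= q by rewrite divr_ge0 ?normc_ge0// ltW.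
have q1 : q <= 2^-1 by rewrite ler_pdivrMr// mulrC ltW.
have geo n : \sum_(i < n) q ^+ i <= 2.
  elim: n => [|n IHn]; first by rewrite big_ord0.
  rewrite big_ord_recl/= expr0.
  have -> : \sum_(i < n) q ^+ bump 0 i = q * \sum_(i < n) q ^+ i.
    by rewrite mulr_sumr; apply: eq_bigr => i _; rewrite /bump/= exprS.
  have : q * \sum_(i < n) q ^+ i <= 2^-1 * 2.
    by rewrite ler_pM// sumr_ge0// => i _; rewrite exprn_ge0.
  lra.
have h1 : cvgC (fun n => \sum_(i < n + k.+1) c i * w ^+ i) 0.
  by apply/(cvgC_shift (fun n => \sum_(i < n) c i * w ^+ i) 0 k.+1).
have h2 n : \sum_(i < n + k.+1) c i * w ^+ i =
    c k * w ^+ k + \sum_(i < n) c (k.+1 + i)%N * w ^+ (k.+1 + i).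
  rewrite addnC big_split_ord/= big_ord_recr/= big1 ?add0r// => i _.
  by rewrite IH ?mul0r//=.
have h3 : normc (0 - c k * w ^+ k) <= 2 * B * q ^+ k.+1.
  apply: (@cvgC_le _ (fun n => \sum_(i < n) c (k.+1 + i)%N * w ^+ (k.+1 + i))).
    apply: cvgC_ext (cvgC_D h1 (cvgC_cst (- (c k * w ^+ k)))) => n.
    by rewrite h2 addrAC subrr add0r.
  move=> n; rewrite (le_trans (normc_sum n (fun i => c (k.+1 + i)%N * w ^+ (k.+1 + i))))//.
  apply: (@le_trans _ _ (\sum_(i < n) (B * q ^+ k.+1) * q ^+ i)).
    apply: ler_sum => i _; rewrite -mulrA -exprD normcM normcX.
    have -> : normc w = r * q by rewrite mulrC divfK// gt_eqF.
    by rewrite exprMn mulrA ler_wpM2r ?exprn_ge0.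
  rewrite -mulr_sumr (_ : 2 * B * q ^+ k.+1 = B * q ^+ k.+1 * 2); last by ring.
  by rewrite ler_wpM2l ?mulr_ge0 ?exprn_ge0.
move: h3; rewrite sub0r normcN normcM normcX /q expr_div_n [normc w ^+ k.+1]exprSr.
have -> : 2 * B * (normc w ^+ k * normc w / r ^+ k.+1) =
   (2 * B / r ^+ k.+1 * normc w) * normc w ^+ k by ring.
rewrite ler_pM2r ?exprn_gt0// => /le_trans; apply.
apply: (@le_trans _ _ (D * normc w)).
  by rewrite ler_wpM2r ?normc_ge0// lerDl.
by rewrite mulrC -ler_pdivlMr// ltW.
Qed.

Fixpoint div_coef c (w0 : R[i]) k := 
  if k is k'.+1 then (c k - div_coef c w0 k') / w0 else c 0%N / w0.

(** Since [w = w0 + (w - w0)], the coefficients [d] of the quotient satisfy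
    [c k = w0 d k + d (k - 1)]. The bound closes on itself because [r] is at most
    half of [|w0|]. *)
Lemma pser_div f w0 r M : 0 < r -> r <= normc w0 / 2 -> pser f w0 r M ->
  pser (fun w => f w / w) w0 r (2 * M / normc w0).
Proof.
move=> r0 rw fM; have M0 := pser_ge0 fM; move: fM => [c [cM cf]].
have nw0 : 0 < normc w0 by lra.
have w00 : w0 != 0 by rewrite -normc_eq0 gt_eqF.
pose d := div_coef c w0.
have dE k : c k = w0 * d k + shift_coef d k.
  case: k => [|k] /=; first by rewrite /d/= mulrC divfK// addr0.
  by rewrite mulrC divfK// subrK.
have dM n : \sum_(k < n) normc (d k) * r ^+ k <= 2 * M / normc w0.
  elim: n => [|n IH]; first by rewrite big_ord0 divr_ge0 ?mulr_ge0// ltW.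
  rewrite ler_pdivlMr// mulr_suml.
  apply: (@le_trans _ _ (\sum_(k < n.+1) (normc (c k) * r ^+ k + normc (shift_coef d k) * r ^+ k))).
    apply: ler_sum => k _; rewrite mulrAC -mulrDl ler_wpM2r ?exprn_ge0 ?(ltW r0)//.
    rewrite -normcM (_ : d k * w0 = c k - shift_coef d k) ?normcB// dE; ring.
  rewrite big_split/= -[leRHS]/(2 * M) (_ : 2 * M = M + M); last by ring.
  rewrite lerD ?cM// big_ord_recl/= normc0 mul0r add0r.
  have -> : \sum_(i < n) normc (d i) * r ^+ bump 0 i = r * \sum_(i < n) normc (d i) * r ^+ i.
    by rewrite mulr_sumr; apply: eq_bigr => i _; rewrite /bump/= exprS mulrCA.
  apply: (@le_trans _ _ (normc w0 / 2 * (2 * M / normc w0))).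
    by rewrite ler_pM// ?(ltW r0)// sumr_ge0// => i _; rewrite mulr_ge0 ?normc_ge0 ?exprn_ge0// ltW.
  by rewrite le_eqVlt; apply/orP; left; apply/eqP; field; rewrite gt_eqF.
exists d; split=> // w wr.
have w0' : w != 0.
  apply/eqP => w0'; move: wr; rewrite w0' sub0r normcN; lra.
have [|S dS _] := @abs_csum (fun k => d k * (w - w0) ^+ k) (2 * M / normc w0).
  by move=> n; rewrite (le_trans _ (dM n))// ler_sum// => k _; exact: ler_term.
suff -> : f w / w = S by [].
have h : csum (fun k => c k * (w - w0) ^+ k) (w * S).
  have -> : w * S = w0 * S + (w - w0) * S by ring.
  apply: csum_ext (csumD (csumZ w0 dS) (shift_coef_sums dS)) => k.
  by rewrite dE; ring.
by rewrite (csum_unique (cf w wr) h) mulrC mulKf.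
Qed.
End PowerSeries.

(** * The complex exponential and the powers of a positive real *)

Section ComplexExponential.
Variable R : realType.
Implicit Types (z w : R[i]) (x y r : R).

Definition cexp z : R[i] := (expR (Re z))%:C * (cos (Im z) +i* sin (Im z)).

Lemma cexpE z : cexp z = (expR (Re z) * cos (Im z)) +i* (expR (Re z) * sin (Im z)).
Proof. by apply/eqP; rewrite eq_complex /= !mul0r subr0 addr0 !eqxx. Qed.

Lemma cexpD z w : cexp (z + w) = cexp z * cexp w.
Proof.
rewrite !cexpE ReD ImD expRD cosD sinD; apply/eqP; rewrite eq_complex /=.
by apply/andP; split; apply/eqP; ring.
Qed.

Lemma cexp_R x : cexp x%:C = (expR x)%:C.
Proof. by rewrite /cexp /= cos0 sin0 mulr1. Qed.

Lemma cexp0 : cexp 0 = 1.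
Proof. by rewrite -[0 in LHS]/(0%:C) cexp_R expR0. Qed.

Lemma normc_cexp z : normc (cexp z) = expR (Re z).
Proof.
rewrite /cexp normcM normcR ger0_norm ?expR_ge0// /ComplexField.Normc.normc.
by rewrite cos2Dsin2 sqrtr1 mulr1.
Qed.

Lemma cexp_neq0 z : cexp z != 0.
Proof. by rewrite -normc_eq0 normc_cexp gt_eqF ?expR_gt0. Qed.

Lemma cexpMn z n : cexp (n%:R * z) = cexp z ^+ n.
Proof.
elim: n => [|n IH]; first by rewrite mul0r cexp0.
by rewrite -natr1 mulrDl mul1r cexpD IH exprSr.
Qed.

Lemma cexpN z : cexp (- z) = (cexp z)^-1.
Proof.
by apply: (mulfI (cexp_neq0 z)); rewrite -cexpD subrr cexp0 divff ?cexp_neq0.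
Qed.

Lemma expR_sums x : sums_to (fun n => x ^+ n / n`!%:R) (expR x).
Proof. by rewrite /sums_to; exact: is_cvg_series_exp_coeff. Qed.

Lemma exp_sum_le x n : 0 <= x -> \sum_(k < n) x ^+ k / k`!%:R <= expR x.
Proof.
move=> x0; have /sums_toRE h := @expR_sums x.
have -> : expR x = limn (fun n => \sum_(k < n) x ^+ k / k`!%:R) by apply/esym/cvg_lim.
apply: nondecreasing_cvgn_le; last by apply/cvg_ex; exists (expR x).
by apply/nondecreasing_seqP => m; rewrite big_ord_recr lerDl divr_ge0 ?exprn_ge0.
Qed.

Lemma exp_norm_sum_le z n : \sum_(k < n) normc (z ^+ k / k`!%:R) <= expR (normc z).
Proof.
apply: le_trans (exp_sum_le n (normc_ge0 z)); apply: ler_sum => k _.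
by rewrite normcM normcX normcV normc_nat.
Qed.

Lemma iXn n : ('i%C : R[i]) ^+ n = ((~~ odd n)%:R * (-1) ^+ n./2) +i* ((odd n)%:R * (-1) ^+ n.-1./2).
Proof.
rewrite -[in LHS](odd_double_half n) -muln2 mulnC exprD exprM sqr_i.
have -> : (-1) ^+ n./2 = ((-1) ^+ n./2)%:C :> R[i] by rewrite rmorphXn rmorphN1.
case: (boolP (odd n)) => o /=.
  rewrite expr1 mul0r mul1r; apply/eqP; rewrite eq_complex /= !mul0r !mulr0 mul1r subr0.
  rewrite add0r.
  case: n o => // n; rewrite oddS => /negbTE o.
  by rewrite eqxx/= uphalf_half o.
rewrite expr0 mul1r mul0r mul1r; by [].
Qed.

Lemma cexp_sums z : csum (fun n => z ^+ n / n`!%:R) (cexp z).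
Proof.
case: z => u v.
have hu : csum (fun n => u%:C ^+ n / n`!%:R) (expR u)%:C.
  apply: csum_ext ((csum_R _ _).2 (@expR_sums u)) => n.
  by rewrite rmorphM/= rmorphXn/= fmorphV/= rmorph_nat.
have hv : csum (fun n => ('i * v%:C) ^+ n / n`!%:R) (cos v +i* sin v).
  have e n : ('i%C * v%:C) ^+ n / n`!%:R = cos_coeff v n +i* sin_coeff v n.
    rewrite exprMn iXn -rmorphXn -(rmorph_nat (real_complex R)) -fmorphV/=.
    rewrite /cos_coeff /sin_coeff /= -!exprnP; apply/eqP; rewrite eq_complex /=.
    rewrite !mulr0 !subr0 !add0r.
    by rewrite !eqxx.
  apply/csum_ReIm; split; rewrite /sums_to.
    under eq_fun do rewrite e /=; rewrite cos.unlock /=; exact: is_cvg_series_cos_coeff.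
  under eq_fun do rewrite e /=; rewrite sin.unlock /=; exact: is_cvg_series_sin_coeff.
have h := cauchy_product (exp_norm_sum_le u%:C) (exp_norm_sum_le ('i * v%:C)) hu hv.
rewrite /cexp; apply: csum_ext h => n.
have -> : u +i* v = 'i * v%:C + u%:C.
  by apply/eqP; rewrite eq_complex /= !mul0r !mul1r !subr0 !add0r addr0 !eqxx.
rewrite exprDn mulr_suml; apply: eq_bigr => k _.
have kn : (k <= n)%N by rewrite -ltnS ltn_ord.
rewrite -(bin_fact kn) !natrM -mulr_natr.
have f1 m : (m`!%:R : R[i]) != 0 by rewrite pnatr_eq0 -lt0n fact_gt0.
have b0 : ('C(n, k)%:R : R[i]) != 0 by rewrite pnatr_eq0 -lt0n bin_gt0.
by field; rewrite !f1 b0.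
Qed.

Lemma rpowCE x (s : R[i]) : rpowC x s = cexp (s * (ln x)%:C).
Proof.
case: s => u v; rewrite /rpowC /cexp /=.
by rewrite !mulr0 subr0 add0r.
Qed.

Lemma pser_cexp (a : R[i]) z0 r : 0 <= r ->
  pser (fun z => cexp (z * a)) z0 r (expR (Re (z0 * a)) * expR (normc a * r)).
Proof.
move=> r0; exists (fun k => cexp (z0 * a) * (a ^+ k / k`!%:R)); split=> [n|z _].
  under eq_bigr do rewrite normcM normc_cexp -mulrA.
  rewrite -mulr_sumr ler_wpM2l ?expR_ge0//.
  apply: le_trans (exp_sum_le n (mulr_ge0 (normc_ge0 a) r0)); apply: ler_sum => k _.
  by rewrite normcM normcX normcV normc_nat exprMn mulrAC.
have -> : cexp (z * a) = cexp (z0 * a) * cexp ((z - z0) * a).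
  by rewrite -cexpD; congr cexp; ring.
apply: csum_ext (csumZ _ (cexp_sums _)) => n.
by rewrite exprMn; ring.
Qed.

Lemma rpowCD x (s t : R[i]) : rpowC x (s + t) = rpowC x s * rpowC x t.
Proof. by rewrite !rpowCE mulrDl cexpD. Qed.

Lemma rpowC_nat x n : 0 < x -> rpowC x n%:R = (x ^+ n)%:C.
Proof.
by move=> x0; rewrite rpowCE cexpMn cexp_R lnK// rmorphXn.
Qed.

Lemma rpowCN x (s : R[i]) : rpowC x (- s) = (rpowC x s)^-1.
Proof. by rewrite !rpowCE mulNr cexpN. Qed.

Lemma rpowCB_nat x (s : R[i]) n : 0 < x -> rpowC x (s - n%:R) = rpowC x s / (x ^+ n)%:C.
Proof. by move=> x0; rewrite rpowCD rpowCN rpowC_nat. Qed.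

Lemma normc_rpowC x (s : R[i]) : normc (rpowC x s) = expR (Re s * ln x).
Proof. by rewrite rpowCE normc_cexp; case: s => u v /=; rewrite mulr0 subr0. Qed.

(** The bound is the value at the rightmost point of the disc. *)
Lemma pser_rpowC x (s0 : R[i]) r : 0 <= r -> 1 <= x ->
  pser (rpowC x) s0 r (expR ((Re s0 + r) * ln x)).
Proof.
move=> r0 x1; have := pser_cexp (ln x)%:C s0 r0.
rewrite -normc_cexp -rpowCE normc_rpowC normcR ger0_norm ?ln_ge0// -expRD.
rewrite mulrDl [r * _]mulrC.
by apply: pser_ext => z _; rewrite rpowCE.
Qed.
End ComplexExponential.

(** * The binomial series for a complex exponent *)

Section BinomialSeries.
Variable R : realType.
Implicit Types (w v : R[i]) (y r : R).

Definition ffall w n : R[i] := \prod_(i < n) (w - i%:R).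
Definition cbin w n : R[i] := ffall w n / n`!%:R.

Lemma ffallS w n : ffall w n.+1 = ffall w n * (w - n%:R).
Proof. by rewrite /ffall big_ord_recr. Qed.

Lemma ffallD w k n : ffall w (k + n) = ffall w k * ffall (w - k%:R) n.
Proof.
rewrite /ffall big_split_ord/=; congr (_ * _); apply: eq_bigr => i _.
by rewrite natrD opprD addrA.
Qed.

Lemma ffall_nat_eq0 m n : (m < n)%N -> ffall m%:R n = 0.
Proof. by move=> mn; rewrite /ffall (bigD1 (Ordinal mn))//= subrr mul0r. Qed.

Lemma factC_neq0 n : (n`!%:R : R[i]) != 0.
Proof. by rewrite pnatr_eq0 -lt0n fact_gt0. Qed.

Lemma cbinS w n : n.+1%:R * cbin w n.+1 = (w - n%:R) * cbin w n.
Proof.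
rewrite /cbin ffallS factS natrM; field.
by rewrite factC_neq0 nat1r pnatr_eq0.
Qed.

Lemma cbin_Vandermonde w v n :
  cbin (w + v) n = \sum_(k < n.+1) cbin w k * cbin v (n - k)%N.
Proof.
elim: n => [|n IH].
  by rewrite big_ord1 /cbin /ffall !big_ord0 fact0 divr1 mulr1.
have n0 : (n.+1%:R : R[i]) != 0 by rewrite pnatr_eq0.
apply: (mulfI n0); rewrite cbinS IH !mulr_sumr.
have -> : \sum_(k < n.+2) n.+1%:R * (cbin w k * cbin v (n.+1 - k)%N) =
   \sum_(k < n.+2) (k%:R * cbin w k) * cbin v (n.+1 - k)%N +
   \sum_(k < n.+2) cbin w k * ((n.+1 - k)%:R * cbin v (n.+1 - k)%N).
  rewrite -big_split/=; apply: eq_bigr => k _.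
  have kn : (k <= n.+1)%N by rewrite -ltnS ltn_ord.
  by rewrite natrB//; ring.
rewrite [X in _ = X + _]big_ord_recl/= !mul0r add0r [X in _ = _ + X]big_ord_recr/= subnn mul0r mulr0 addr0.
rewrite -big_split/=; apply: eq_bigr => k _.
have kn : (k <= n)%N by rewrite -ltnS ltn_ord.
rewrite /bump/= add1n subSS cbinS subSn// cbinS natrB//; ring.
Qed.

Definition rrise (Q n : nat) : nat := \prod_(i < n) (Q + i).

Lemma rrise_bin Q n : rrise Q.+1 n = ('C(Q + n, n) * n`!)%N.
Proof.
have h : (rrise Q.+1 n * Q`! = (Q + n)`!)%N.
  elim: n => [|n IH]; first by rewrite /rrise big_ord0 mul1n addn0.
  by rewrite /rrise big_ord_recr/= -/(rrise _ _) mulnAC IH addnS factS mulnC addSn.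
apply/eqP; rewrite -(eqn_pmul2r (fact_gt0 Q)) h.
by rewrite -(bin_fact (leq_addl Q n)) addnK mulnA.
Qed.

Lemma bin_le_exp2 n m : ('C(n, m) <= 2 ^ n)%N.
Proof.
elim: n m => [|n IH] [|m]; rewrite ?bin0 ?expn_gt0//.
by rewrite binS expnS mul2n -addnn leq_add.
Qed.

Lemma rriseD Q k n : rrise Q (k + n) = (rrise Q k * rrise (Q + k) n)%N.
Proof.
rewrite /rrise big_split_ord/=; congr (_ * _)%N; apply: eq_bigr => i _.
by rewrite addnA.
Qed.

Lemma pser_ffall_mul (g : R[i] -> R[i]) w0 r M Q n : 0 <= r -> normc w0 + r <= Q%:R ->
  pser g w0 r M -> pser (fun w => ffall w n * g w) w0 r ((rrise Q n)%:R * M).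
Proof.
move=> r0 h gM; elim: n => [|n IH].
  rewrite /rrise big_ord0 mul1r.
  by apply: pser_ext gM => z _; rewrite /ffall big_ord0 mul1r.
have := pser_affine (- n%:R) r0 IH.
rewrite /rrise big_ord_recr/= -/(rrise _ _) natrM mulrA => /pser_le h1.
apply: pser_ext (h1 _ _) => [z _|]; first by rewrite ffallS mulrA [_ * ffall _ _]mulrC.
rewrite ler_wpM2r ?(pser_ge0 gM)// [leRHS]mulrC ler_wpM2r//.
rewrite natrD (@le_trans _ _ (normc w0 + n%:R + r)) ?lerD2r//.
  by rewrite (le_trans (normcB _ _))// normc_nat.
by rewrite addrAC lerD2r.
Qed.

Lemma pser_ffall w0 r Q n : 0 <= r -> normc w0 + r <= Q%:R ->
  pser (fun w => ffall w n) w0 r (rrise Q n)%:R.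
Proof.
move=> r0 h; have := pser_ffall_mul n r0 h (pser_cst 1 w0 r).
by rewrite normc1 mulr1; apply: pser_ext => z _; rewrite mulr1.
Qed.

(** The factors [w - i] of the binomial coefficient are at most [Q + 1 + i] on the
    disc, and the resulting quotient is an ordinary binomial coefficient. *)
Lemma pser_cbin w0 r Q n : 0 <= r -> normc w0 + r <= Q.+1%:R ->
  pser (fun w => cbin w n) w0 r (2 ^+ (Q + n)).
Proof.
move=> r0 h; have := pserZ (n`!%:R^-1) (pser_ffall n r0 h).
rewrite normcV normc_nat rrise_bin natrM mulrC mulfK; last first.
  by rewrite pnatr_eq0 -lt0n fact_gt0.
move=> /pser_le H; apply: pser_ext (H _ _) => [z _|]; first by rewrite mulrC.
by rewrite -natrX ler_nat bin_le_exp2.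
Qed.

Lemma half_pow_sum n : \sum_(k < n) (2^-1 : R) ^+ k <= 2.
Proof.
suff : \sum_(k < n) (2^-1 : R) ^+ k = 2 - 2 * 2^-1 ^+ n.
  by move=> ->; rewrite lerBlDr lerDl mulr_ge0 ?exprn_ge0.
elim: n => [|n IH]; first by rewrite big_ord0 expr0; ring.
by rewrite big_ord_recr/= IH exprS; field.
Qed.

(** The coefficients grow at most like [2^k]: the radius [1/4] makes the series
    geometric of ratio [1/2], uniformly for bounded exponents. *)
Lemma cbin_bound w Q y n : 0 <= y <= 4^-1 -> normc w <= Q.+1%:R ->
  \sum_(k < n) normc (cbin w k * (y ^+ k)%:C) <= 2 ^+ Q * 2.
Proof.
move=> /andP[y0 y4] wO.
apply: (@le_trans _ _ (\sum_(k < n) 2 ^+ Q * 2^-1 ^+ k)); last first.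
  by rewrite -mulr_sumr ler_wpM2l ?exprn_ge0 ?half_pow_sum.
apply: ler_sum => k _; rewrite normcM normcR ger0_norm ?exprn_ge0//.
have h := @pser_cbin w 0 Q k (lexx 0).
have {h} := pser_bound (h _) (z := w); rewrite addr0 subrr normc0 => /(_ wO (lexx 0)) h.
apply: (@le_trans _ _ (2 ^+ (Q + k) * 4^-1 ^+ k)).
  by rewrite ler_pM ?normc_ge0 ?exprn_ge0// lerXn2r ?nnegrE// (le_trans y0).
rewrite exprD -mulrA -exprMn le_eqVlt; apply/orP; left; apply/eqP.
by congr (_ * _ ^+ _); field.
Qed.

Lemma archi_nat (x : R) : exists n : nat, x <= n.+1%:R.
Proof.
exists (Num.truncn `|x|); rewrite (le_trans (ler_norm _))// ltW//.
exact: truncnS_gt.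
Qed.

(** The binomial series for complex exponents: its sum is multiplicative in the
    exponent, so it agrees with the power at [1/n]; these points accumulate at
    [0], and both sides are entire. *)
Lemma binomial_series y w : 0 <= y <= 4^-1 ->
  csum (fun k => cbin w k * (y ^+ k)%:C) (rpowC (1 + y) w).
Proof.
move=> y04; have /andP[y0 y4] := y04.
have y1 : 0 < 1 + y by lra.
have ex v : exists S, csum (fun k => cbin v k * (y ^+ k)%:C) S.
  have [Q hO] := archi_nat (normc v).
  by have [S hS _] := @abs_csum R (fun k => cbin v k * (y ^+ k)%:C) _ (fun n => cbin_bound n y04 hO); exists S.
have [psi Hpsi] := choice ex.
have psiD v v' : psi (v + v') = psi v * psi v'.
  have [Q hO] := archi_nat (normc v); have [Q' hO'] := archi_nat (normc v').
  have h := cauchy_product (fun n => cbin_bound n y04 hO) (fun n => cbin_bound n y04 hO')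
     (Hpsi v) (Hpsi v').
  apply: (csum_unique (Hpsi _)); apply: csum_ext h => n.
  rewrite cbin_Vandermonde mulr_suml; apply: eq_bigr => k _.
  have kn : (k <= n)%N by rewrite -ltnS ltn_ord.
  have -> : y ^+ n = y ^+ k * y ^+ (n - k) by rewrite -exprD subnKC.
  by rewrite rmorphM/=; ring.
have psi1 : psi 1 = (1 + y)%:C.
  apply: (csum_unique (Hpsi _)).
  have e0 : cbin (1 : R[i]) 0 = 1 by rewrite /cbin /ffall big_ord0 fact0 divr1.
  have e1 : cbin (1 : R[i]) 1 = 1 by rewrite /cbin /ffall big_ord1 subr0 divr1.
  have := @csum_fin R (fun k => cbin 1 k * (y ^+ k)%:C) 2%N.
  rewrite !big_ord_recl big_ord0 [cbin _ _]e0 [cbin _ _]e1 !mul1r addr0 rmorphD; apply => k k2.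
  by rewrite /cbin -[X in ffall X]/(1%:R) ffall_nat_eq0// !mul0r.
have psiMn v n : psi (n%:R * v) = psi v ^+ n.
  elim: n => [|n IH].
    rewrite mul0r expr0; have := psiD 0 1; rewrite add0r => h.
    have p1 : psi 1 != 0 by rewrite psi1 -normc_eq0 normcR normr_eq0 gt_eqF.
    by apply: (mulIf p1); rewrite -h mul1r.
  by rewrite -natr1 mulrDl mul1r psiD IH exprSr.
have psi_real (x : R) : exists t : R, psi x%:C = t%:C.
  exists (Re (psi x%:C)).
  suff : Im (psi x%:C) = 0 by case: (psi x%:C) => a b /= ->.
  have e k : cbin x%:C k * (y ^+ k)%:C =
      (\prod_(i < k) (x - i%:R) / k`!%:R * y ^+ k)%:C.
    rewrite !rmorphM/= fmorphV/= rmorph_nat /cbin /ffall rmorph_prod; congr (_ / _ * _).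
    by apply: eq_bigr => i _; rewrite rmorphB/= rmorph_nat.
  have /csum_ReIm[_ /sums_toRE] := Hpsi x%:C.
  under eq_fun do under eq_bigr do rewrite e /=.
  under eq_fun do rewrite big1//.
  move=> h; exact: (cvg_unique _ h (cvg_cst 0)).
have psi_ge0 (x : R) : exists2 t : R, 0 <= t & psi x%:C = t%:C.
  have [t ht] := psi_real (x / 2); exists (t ^+ 2); rewrite ?sqr_ge0//.
  rewrite rmorphXn/= -ht -psiMn; congr psi.
  by rewrite -(rmorph_nat (real_complex R)) -rmorphM/=; congr (_%:C); field.
have psi_inv n : psi (n.+1%:R^-1) = rpowC (1 + y) (n.+1%:R^-1).
  have -> : n.+1%:R^-1 = (n.+1%:R^-1 : R)%:C by rewrite fmorphV/= rmorph_nat.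
  have [t t0 ht] := psi_ge0 n.+1%:R^-1.
  rewrite ht rpowCE -rmorphM/= cexp_R; congr (_%:C).
  apply/eqP; rewrite -(@eqrXn2 _ n.+1)// ?expR_ge0// -expRM_natl mulrA divff ?mul1r ?lnK ?pnatr_eq0//.
  apply/eqP/complexI; rewrite rmorphXn/= -ht -psiMn -psi1; congr psi.
  by rewrite fmorphV/= rmorph_nat divff// pnatr_eq0.
suff -> : rpowC (1 + y) w = psi w by exact: Hpsi.
pose r := normc w + 1.
have r0 : 0 < r by rewrite ltr_wpDl ?normc_ge0.
have [Q hO] := archi_nat r.
have hpsi : pser psi 0 r (2 ^+ Q * 2).
  apply: (@pser_series _ (fun k v => cbin v k * (y ^+ k)%:C) _ _ _
     (fun k => 2 ^+ (Q + k) * y ^+ k)) => //.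
  - move=> k; have := pserZ (y ^+ k)%:C (@pser_cbin 0 r Q k _ _).
    rewrite normc0 add0r (ltW r0) => /(_ isT hO).
    rewrite normcR ger0_norm ?exprn_ge0// mulrC.
    by apply: pser_ext => z _; rewrite mulrC.
  - move=> N; apply: (@le_trans _ _ (\sum_(k < N) 2 ^+ Q * 2^-1 ^+ k)); last first.
      by rewrite -mulr_sumr ler_wpM2l ?exprn_ge0 ?half_pow_sum.
    apply: ler_sum => k _; rewrite exprD -mulrA -exprMn ler_wpM2l ?exprn_ge0//.
    by rewrite lerXn2r ?nnegrE ?mulr_ge0//; lra.
have y1' : 1 <= 1 + y by lra.
have hd := pserD (ltW r0) hpsi (pserZ (-1) (pser_rpowC 0 (ltW r0) y1')).
have [c [cM cf]] := hd.
have c0 : forall k, c k = 0.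
  apply: (@power_series_zero R c r (2 ^+ Q * 2 + normc (-1 : R[i]) * expR ((Re (0 : R[i]) + r) * ln (1 + y))) r0).
    move=> n; apply: le_trans (cM n.+1); rewrite big_ord_recr/= lerDr sumr_ge0// => i _.
    by rewrite mulr_ge0 ?normc_ge0 ?exprn_ge0// ltW.
  move=> e e0; pose n := Num.truncn e^-1.
  have ne : n.+1%:R^-1 < e.
    by rewrite -(invrK e) ltf_pV2 ?posrE ?invr_gt0// truncnS_gt.
  exists (n.+1%:R^-1); split.
  - by rewrite invr_eq0 pnatr_eq0.
  - by rewrite normcV normc_nat.
  have := cf (n.+1%:R^-1); rewrite !subr0 normcV normc_nat psi_inv mulN1r subrr; apply.
  rewrite (@le_trans _ _ 1)//; first by rewrite invf_le1 ?ler1n.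
  by rewrite lerDr normc_ge0.
have := cf w; rewrite subr0 mulN1r => /(_ _)/csum_unique h.
apply/esym/eqP; rewrite -subr_eq0; apply/eqP; apply: h; first by rewrite lerDl.
by apply: cvgC_ext (cvgC_cst 0) => n; rewrite big1// => i _; rewrite c0 mul0r.
Qed.
End BinomialSeries.

(** * Bernoulli numbers and polynomials *)

Lemma fact_1 : 1`! = 1%N. Proof. by []. Qed.

Section BernoulliNumbers.

(** The recursion for Bernoulli numbers refers to all the previous values, hence
    the list. *)
Fixpoint betas n : seq rat :=
  if n is n'.+1 then
    rcons (betas n') ((n' == 0)%:R - \sum_(k < n') (betas n')`_k / (n'.+1 - k)`!%:R)
  else [::].

(** The Bernoulli number of index [n] divided by [n!]. *)
Definition beta n : rat := (betas n.+1)`_n.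

Lemma size_betas n : size (betas n) = n.
Proof. by elim: n => //= n IH; rewrite size_rcons IH. Qed.

Lemma nth_betas n k : (k < n)%N -> (betas n)`_k = beta k.
Proof.
elim: n => // n IH; rewrite ltnS leq_eqVlt => /orP[/eqP->//|kn].
by rewrite /= nth_rcons size_betas kn IH.
Qed.

Lemma betaE n : beta n = (n == 0)%:R - \sum_(k < n) beta k / (n.+1 - k)`!%:R.
Proof.
rewrite /beta /= nth_rcons size_betas ltnn eqxx; congr (_ - _).
by apply: eq_bigr => k _; rewrite nth_betas.
Qed.

Lemma beta_sum n : \sum_(k < n.+1) beta k / (n.+1 - k)`!%:R = (n == 0)%:R.
Proof. by rewrite big_ord_recr/= subSn// subnn fact_1 divr1 [in X in _ + X]betaE addrC subrK. Qed.

Lemma fact_ge_exp2 n : (2 ^ n <= n.+1`!)%N.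
Proof. by elim: n => // n IH; rewrite expnS factS leq_mul. Qed.

Lemma beta_le1 n : `|beta n| <= 1.
Proof.
elim/ltn_ind: n => n IH; case: n IH => [|n] IH.
  by rewrite betaE big_ord0 subr0.
rewrite betaE sub0r normrN (le_trans (ler_norm_sum _ _ _))//.
apply: (@le_trans _ _ (\sum_(k < n.+1) 2^-1 ^+ (n.+1 - k))).
  apply: ler_sum => k _; rewrite normrM normfV normr_nat exprVn.
  have kn : (k <= n.+1)%N by rewrite ltnW.
  apply: (@le_trans _ _ (1 * (n.+2 - k)`!%:R^-1)).
    by rewrite ler_wpM2r ?invr_ge0// IH.
  rewrite mul1r subSn// lef_pV2 ?posrE ?exprn_gt0 ?ltr0n ?fact_gt0//.
  by rewrite -[2 ^+ _]natrX ler_nat fact_ge_exp2.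
have -> : \sum_(k < n.+1) (2^-1 : rat) ^+ (n.+1 - k) = 1 - 2^-1 ^+ n.+1.
  elim: n {IH} => [|n IH]; first by rewrite big_ord1 subn0 expr1.
  rewrite big_ord_recl subn0/=; under eq_bigr do rewrite /bump/= add1n subSS.
  by rewrite IH [_ ^+ n.+2]exprS; field.
by rewrite lerBlDr lerDl exprn_ge0.
Qed.
End BernoulliNumbers.

Section BernoulliPolynomials.
Variable F : numFieldType.
Implicit Types x y : F.

(** The value at [x] of the Bernoulli polynomial of index [n], divided by [n!]. *)
Definition bern n x : F := \sum_(k < n.+1) ratr (beta k) * x ^+ (n - k) / (n - k)`!%:R.

Lemma fact_neq0 n : (n`!%:R : F) != 0.
Proof. by rewrite pnatr_eq0 -lt0n fact_gt0. Qed.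

Lemma sum_triangle (f : nat -> nat -> F) n :
  \sum_(k < n.+1) \sum_(j < (n - k).+1) f k j = \sum_(j < n.+1) \sum_(k < (n - j).+1) f k j.
Proof.
have e (g : nat -> nat -> F) : \sum_(k < n.+1) \sum_(j < (n - k).+1) g k j =
    \sum_(k < n.+1) \sum_(j < n.+1) if (k + j <= n)%N then g k j else 0.
  apply: eq_bigr => k _; rewrite -big_mkcond/=.
  have kn : (k <= n)%N by rewrite -ltnS ltn_ord.
  rewrite (big_ord_widen_cond n.+1 xpredT (fun j => g k j)) ?ltnS ?leq_subr//=.
  by apply: eq_bigl => j; rewrite ltnS leq_subRL.
rewrite e exchange_big/= (e (fun j k => f k j)).
by apply: eq_bigr => j _; apply: eq_bigr => k _; rewrite addnC.
Qed.

Lemma exprD_fact x y n : (x + y) ^+ n / n`!%:R =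
  \sum_(k < n.+1) (x ^+ (n - k) / (n - k)`!%:R) * (y ^+ k / k`!%:R).
Proof.
rewrite exprDn mulr_suml; apply: eq_bigr => k _.
have kn : (k <= n)%N by rewrite -ltnS ltn_ord.
rewrite -(bin_fact kn) !natrM -mulr_natr.
have b0 : ('C(n, k)%:R : F) != 0 by rewrite pnatr_eq0 -lt0n bin_gt0.
by field; rewrite !fact_neq0 b0.
Qed.

(** Taylor's formula: up to the factorials the derivative of a Bernoulli polynomial
    is the previous one. *)
Lemma bernD x y n : bern n (x + y) = \sum_(k < n.+1) bern k x * (y ^+ (n - k) / (n - k)`!%:R).
Proof.
rewrite /bern.
transitivity (\sum_(k < n.+1) \sum_(j < (n - k).+1)
    ratr (beta k) * ((x ^+ (n - k - j) / (n - k - j)`!%:R) * (y ^+ j / j`!%:R))).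
  by apply: eq_bigr => k _; rewrite -mulrA exprD_fact mulr_sumr.
rewrite (sum_triangle (fun k j => ratr (beta k) * ((x ^+ (n - k - j) / (n - k - j)`!%:R) * (y ^+ j / j`!%:R)))).
rewrite [RHS](reindex_inj rev_ord_inj)/=; apply: eq_bigr => j _.
have jn : (j <= n)%N by rewrite -ltnS ltn_ord.
rewrite subSS subKn// mulr_suml; apply: eq_bigr => k _.
by rewrite subnAC; ring.
Qed.

Lemma bern0 n : bern n 0 = ratr (beta n).
Proof.
rewrite /bern big_ord_recr/= subnn fact0 divr1 expr0 mulr1 big1 ?add0r// => k _.
by rewrite expr0n subn_eq0 leqNgt ltn_ord mulr0 mul0r.
Qed.

Lemma bern1 n : bern n 1 = ratr (beta n) + (n == 1%N)%:R.
Proof.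
rewrite /bern big_ord_recr/= subnn fact0 divr1 expr0 mulr1 addrC; congr (_ + _).
case: n => [|n]; first by rewrite big_ord0.
have := congr1 (@ratr F) (beta_sum n); rewrite rmorph_sum/= eqSS ratr_nat => <-.
by apply: eq_bigr => k _; rewrite expr1n mulr1 fmorph_div/= ratr_nat.
Qed.

(** The means of recognizing the values at [1], up to sign, as the values at [0] in
    the proof of the reflection formula. *)
Lemma beta_unique (d : nat -> F) :
  (forall n, \sum_(k < n) d k / (n - k)`!%:R = (n == 1%N)%:R) ->
  forall n, d n = ratr (beta n).
Proof.
move=> h; elim/ltn_ind => n IH.
have := h n.+1; rewrite big_ord_recr/= subSn// subnn fact_1 divr1 => /(canRL (addKr _)) ->.
rewrite betaE rmorphB/= ratr_nat rmorph_sum/= eqSS addrC; congr (_ - _).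
by apply: eq_bigr => k _; rewrite fmorph_div/= ratr_nat IH.
Qed.

Lemma bern_reflect n x : bern n (1 - x) = (-1) ^+ n * bern n x.
Proof.
pose d k : F := (-1) ^+ k * bern k 1.
have s1 k : (-1) ^+ k * (-1) ^+ k = 1 :> F by rewrite -exprMn mulrNN mulr1 expr1n.
have e y m : (-1) ^+ m * bern m (1 - y) = \sum_(k < m.+1) d k * (y ^+ (m - k) / (m - k)`!%:R).
  rewrite bernD mulr_sumr; apply: eq_bigr => k _; rewrite /d.
  have km : (k <= m)%N by rewrite -ltnS ltn_ord.
  have -> : (-1) ^+ m = (-1) ^+ k * (-1) ^+ (m - k) :> F by rewrite -exprD subnKC.
  have gen (a b B Y f : F) : b * b = 1 -> a * b * (B * (b * Y * f)) = a * B * (Y * f).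
    move=> bb; transitivity (a * (b * b) * B * (Y * f)); first by ring.
    by rewrite bb mulr1.
  by rewrite [(- y) ^+ _]exprNn gen.
have dE : forall k, d k = ratr (beta k).
  apply: beta_unique => m.
  have := e 1 m; rewrite subrr bern0 big_ord_recr/= subnn fact0 divr1 expr0 mulr1 /d bern1.
  rewrite mulrDr => h.
  have -> : \sum_(k < m) (-1) ^+ k * bern k 1 / (m - k)`!%:R = - ((-1) ^+ m * (m == 1%N)%:R).
    have -> : \sum_(k < m) (-1) ^+ k * bern k 1 / (m - k)`!%:R =
        \sum_(k < m) (-1) ^+ k * bern k 1 * (1 ^+ (m - k) / (m - k)`!%:R).
      by apply: eq_bigr => k _; rewrite expr1n div1r.
    by apply: (@addIr _ ((-1) ^+ m * ratr (beta m) + (-1) ^+ m * (m == 1%N)%:R)); rewrite -h; ring.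
  by case: eqP => [->|_]; rewrite ?mulr0 ?oppr0// expr1 mulN1r opprK.
rewrite (_ : bern n (1 - x) = (-1) ^+ n * ((-1) ^+ n * bern n (1 - x))); last first.
  by rewrite mulrA s1 mul1r.
congr (_ * _).
by rewrite e; apply: eq_bigr => k _; rewrite dE mulrA.
Qed.

Lemma bern_shift n x : bern n.+1 (x + 1) = bern n.+1 x + x ^+ n / n`!%:R.
Proof.
rewrite addrC bernD.
under eq_bigr do rewrite bern1 mulrDl.
rewrite big_split/=; congr (_ + _); first by apply: eq_bigr => k _; rewrite mulrA.
rewrite big_ord_recl/= mul0r add0r big_ord_recl/= mul1r /bump/= subSS subn0 big1 ?addr0// => k _.
by rewrite mul0r.
Qed.

Definition bernoulli n : {poly F} :=
  \sum_(k < n.+1) (n`!%:R * ratr (beta k) / (n - k)`!%:R) *: 'X^(n - k).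

Lemma bernoulliE n x : (bernoulli n).[x] = n`!%:R * bern n x.
Proof.
rewrite /bernoulli horner_sum mulr_sumr; apply: eq_bigr => k _.
by rewrite hornerZ hornerXn; ring.
Qed.
End BernoulliPolynomials.

(** * The generating function of the Bernoulli polynomials *)

Section BernoulliGenerating.
Variable R : realType.

Lemma csum_terms_bounded (u : nat -> R[i]) l : csum u l -> exists B, forall n, normc (u n) <= B.
Proof.
move=> h; have [N HN] := cvgn_eps h ltr01.
exists (\sum_(k < N) normc (u k) + 2) => n.
have s0 m : 0 <= \sum_(k < m) normc (u k) by rewrite sumr_ge0// => k _; rewrite normc_ge0.
have [nN|Nn] := ltnP n N.
  rewrite (bigD1 (Ordinal nN))//= -addrA lerDl addr_ge0// sumr_ge0// => k _; exact: normc_ge0.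
have := HN n Nn; have := HN n.+1 (leqW Nn).
rewrite !sub0r !normrN !(ger0_norm (normc_ge0 _)) big_ord_recr/= => h1 h2.
have -> : u n = (\sum_(i < n) u i + u n - l) - (\sum_(i < n) u i - l) by ring.
rewrite (le_trans (normcB _ _))//; have := s0 N; lra.
Qed.

Lemma poly_eval_inj (F : numFieldType) (p q : {poly F}) : (forall x, p.[x] = q.[x]) -> p = q.
Proof.
move=> h; apply/eqP; rewrite -subr_eq0; apply/eqP.
apply: (@roots_geq_poly_eq0 _ _ [seq (i%:R : F) | i <- iota 0 (size (p - q)).+1]).
- by apply/allP => x _; rewrite rootE hornerD hornerN h subrr.
- by rewrite map_inj_uniq ?iota_uniq// => i j /eqP; rewrite eqr_nat => /eqP.
- by rewrite size_map size_iota.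
Qed.

(** The Bernoulli numbers are the coefficients of the inverse of
    [(exp t - 1) / t], by a Cauchy product; a second one multiplies by [exp (x t)]. *)
Lemma bernoulli_gen (x t : R) : t != 0 -> `|t| <= 2^-1 ->
  sums_to (fun n => bern n x * t ^+ n) (t * expR (x * t) / (expR t - 1)).
Proof.
move=> t0 t2.
have tn0 : 0 <= `|t| by [].
have et : expR t - 1 != 0.
  by rewrite subr_eq0 -[1]expR0; apply/eqP => /expR_inj/eqP; rewrite (negbTE t0).
have b1 n : \sum_(k < n) normc ((ratr (beta k) * t ^+ k)%:C : R[i]) <= 2.
  apply: le_trans (half_pow_sum R n); apply: ler_sum => k _.
  rewrite normcR normrM normrX -[leRHS]mul1r ler_pM ?exprn_ge0//.
    by rewrite -ratr_norm -[1](ratr_nat R 1) ler_rat beta_le1.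
  by rewrite lerXn2r ?nnegrE.
have b2 n : \sum_(k < n) normc ((t ^+ k / k.+1`!%:R)%:C : R[i]) <= 2.
  apply: le_trans (half_pow_sum R n); apply: ler_sum => k _.
  rewrite normcR normrM normrX -[leRHS]mulr1 ler_pM ?exprn_ge0//.
    by rewrite lerXn2r ?nnegrE.
  by rewrite normfV normr_nat invf_le1 ?ltr0n ?fact_gt0// ler1n fact_gt0.
have [S hS _] := @abs_csum R (fun k => (ratr (beta k) * t ^+ k)%:C) _ b1.
have [E hE _] := @abs_csum R (fun k => (t ^+ k / k.+1`!%:R)%:C) _ b2.
have tE : t%:C * E = (expR t - 1)%:C.
  have h : csum (fun n => (t ^+ n.+1 / n.+1`!%:R)%:C) (expR t - 1)%:C.
    apply/(csumS (fun n => (t ^+ n / n`!%:R)%:C)).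
    rewrite /= expr0 fact0 divr1 -rmorphD/= addrC subrK.
    by apply/csum_R; exact: (@expR_sums R t).
  apply: (csum_unique _ h); apply: csum_ext (csumZ t%:C hE) => n.
  by rewrite -rmorphM/= exprS mulrA.
have SE : S * E = 1.
  have h := cauchy_product b1 b2 hS hE; apply: (csum_unique h).
  have e n : \sum_(k < n.+1) (ratr (beta k) * t ^+ k)%:C * (t ^+ (n - k) / (n - k).+1`!%:R)%:C
      = (n == 0)%:R * (t ^+ n)%:C :> R[i].
    rewrite -(rmorph_nat (real_complex R)) -rmorphM -(ratr_nat R) -(beta_sum n) rmorph_sum/= mulr_suml.
    rewrite rmorph_sum/=; apply: eq_bigr => k _.
    have kn : (k <= n)%N by rewrite -ltnS ltn_ord.
    rewrite -rmorphM; congr (_%:C); rewrite fmorph_div/= ratr_nat subSn//.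
    have -> : t ^+ n = t ^+ k * t ^+ (n - k) by rewrite -exprD subnKC.
    by ring.
  have := @csum_fin R (fun n => (n == 0)%:R * (t ^+ n)%:C) 1.
  rewrite big_ord1 expr0 mul1r => h1.
  by apply: csum_ext (h1 _) => [n|[]//k _]; rewrite ?e ?mul0r.
have hx := exp_norm_sum_le (x * t)%:C.
have hc := cauchy_product b1 hx hS (cexp_sums (x * t)%:C).
have SV : S = (t / (expR t - 1))%:C.
  have eC : (expR t - 1)%:C != 0 :> R[i] by rewrite -normc_eq0 normcR normr_eq0.
  apply: (mulIf eC); rewrite -tE mulrCA SE mulr1 tE -rmorphM/= divfK//.
apply/csum_R; move: hc; rewrite SV cexp_R -rmorphM/= [_ / _ * _]mulrAC.
apply: csum_ext => n.
rewrite /bern mulr_suml rmorph_sum/=; apply: eq_bigr => k _.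
have kn : (k <= n)%N by rewrite -ltnS ltn_ord.
rewrite -(rmorph_nat (real_complex R)) -rmorphXn -fmorphV/= -!rmorphM/=; congr (_%:C).
have -> : t ^+ n = t ^+ k * t ^+ (n - k) by rewrite -exprD subnKC.
by rewrite exprMn; ring.
Qed.

(** Two families with the same generating function near [0] have equal values, by
    the isolation of zeros of a power series, and a polynomial over an infinite
    field is determined by its values. *)
Lemma bernoulli_polyE n : bernoulli_poly R n = bernoulli R n.
Proof.
have ex : is_bernoulli_poly (bernoulli R).
  move=> x; near=> t.
  have t0 : t != 0 by near: t; exact: nbhs_dnbhs_neq.
  have t2 : `|t| <= 2^-1.
    near: t; apply: dnbhs0_le; lra.
  rewrite /sums_to; have := @bernoulli_gen x t t0 t2; rewrite /sums_to.
  set u := fun n => _; set v := fun n => _; suff -> : u = v by [].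
  apply: funext => k; rewrite /u /v bernoulliE.
  by field; exact: fact_neq0.
rewrite /bernoulli_poly (_ : xget _ _ = bernoulli R)//.
apply: xget_unique => // B hB; apply: funext => k; apply: poly_eval_inj => x.
pose D k := ((B k).[x] - (bernoulli R k).[x]) / k`!%:R.
have hn : \forall t \near (0 : R)^', csum (fun k => (D k)%:C * t%:C ^+ k) 0.
  apply: filterS2 (hB x) (ex x) => t h1 h2.
  have /csum_R h1' := h1; have /csum_R h2' := h2.
  have -> : 0 = (t * expR (x * t) / (expR t - 1))%:C + -1 * (t * expR (x * t) / (expR t - 1))%:C.
    by rewrite mulN1r subrr.
  apply: csum_ext (csumD h1' (csumZ (-1) h2')) => m.
  rewrite -rmorphXn mulN1r -rmorphB -rmorphM /D; congr (_%:C).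
  by field; exact: fact_neq0.
have /nbhs_ballP[e /= e0 He] := hn.
have e2 : 0 < e / 2 by rewrite divr_gt0.
have hball (t : R) : t != 0 -> `|t| < e -> csum (fun k => (D k)%:C * t%:C ^+ k) 0.
  by move=> t0 te; apply: He => //; rewrite /ball/= sub0r normrN.
have nC (t : R) : normc (t%:C) = `|t| by rewrite normcR.
have [Bd HBd] := csum_terms_bounded (hball (e / 2) (lt0r_neq0 e2) ltac:(rewrite ger0_norm ?ltW//; lra)).
have D0 : forall m, (D m)%:C = 0.
  apply: (@power_series_zero R (fun m => (D m)%:C) (e / 2) Bd e2) => [m|e' e'0].
    have := HBd m; rewrite normcM normcX nC ger0_norm// ltW//.
  pose t := Num.min (e / 2) (e' / 2).
  have t0 : 0 < t by rewrite lt_min e2 divr_gt0.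
  have tt : `|t| = t by rewrite ger0_norm// ltW.
  have te : t <= e / 2 by rewrite ge_min lexx.
  have te' : t <= e' / 2 by rewrite ge_min lexx orbT.
  exists t%:C; split.
  - by rewrite -normc_eq0 nC tt gt_eqF.
  - by rewrite nC tt; lra.
  - by apply: hball; [exact: lt0r_neq0|rewrite tt; lra].
have /complexI/eqP := D0 k; rewrite /D mulf_eq0 invr_eq0 (negbTE (fact_neq0 R k)) orbF subr_eq0.
by move/eqP.
Unshelve. all: by end_near. Qed.
End BernoulliGenerating.

(** * Continuation of the Hurwitz zeta function by Euler-Maclaurin summation *)

Section HurwitzZeta.
Variable R : realType.
Implicit Types (s w : R[i]) (a x r : R).

Lemma csum_drop (u : nat -> R[i]) l n : csum u l ->
  csum (fun i => u (n + i)%N) (l - \sum_(j < n) u j).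
Proof.
move=> h; apply: cvgC_ext (cvgC_D ((cvgC_shift _ _ n).2 h) (cvgC_cst _)) => N.
by rewrite addnC big_split_ord/= addrAC subrr add0r.
Qed.

Lemma sum_diag (f : nat -> nat -> R[i]) K :
  \sum_(k < K.+1) \sum_(j < (K - k).+1) f k (k + j)%N = \sum_(l < K.+1) \sum_(k < l.+1) f k l.
Proof.
elim: K => [|K IH]; first by rewrite !big_ord1.
rewrite [RHS]big_ord_recr/= -IH [LHS]big_ord_recr/= subnn big_ord1 addn0.
rewrite [X in _ = _ + X]big_ord_recr/= addrA; congr (_ + _).
rewrite -big_split/=; apply: eq_bigr => k _.
have kK : (k <= K)%N by rewrite -ltnS ltn_ord.
by rewrite subSn// big_ord_recr/= -subSn// subnKC// ltnW.
Qed.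

Lemma ratrC q : (ratr q : R[i]) = (ratr q)%:C.
Proof. by rewrite (fmorph_rat (real_complex R)). Qed.

Lemma normc_beta n : normc (ratr (beta n) : R[i]) <= 1.
Proof. by rewrite ratrC normcR -ratr_norm -[1](ratr_nat R 1) ler_rat beta_le1. Qed.

Lemma rpowCM x y s : 0 < x -> 0 < y -> rpowC (x * y) s = rpowC x s * rpowC y s.
Proof. by move=> x0 y0; rewrite !rpowCE lnM// rmorphD mulrDr cexpD. Qed.

(** The condition on [x] puts [1 / x] in the range of the binomial series. *)
Lemma rpowC_succ x w : 4 <= x ->
  csum (fun j => cbin w j * rpowC x (w - j%:R)) (rpowC (x + 1) w).
Proof.
move=> x4; have x0 : 0 < x by lra.
have y0 : 0 <= x^-1 <= 4^-1 by rewrite invr_ge0 ltW//= lef_pV2 ?posrE.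
have -> : x + 1 = x * (1 + x^-1) by rewrite mulrDr mulr1 divff ?gt_eqF.
rewrite rpowCM//; last by have /andP[] := y0; lra.
apply: csum_ext (csumZ _ (binomial_series w y0)) => j.
by rewrite rpowCB_nat// exprVn fmorphV/=; ring.
Qed.

(** The truncated asymptotic expansion of [- w zeta(1 - w, x)] given by the
    Euler-Maclaurin formula; for a natural exponent it is a Bernoulli polynomial, up to
    a factorial. *)
Definition em K x w : R[i] :=
  \sum_(k < K.+1) ratr (beta k) * (ffall w k * rpowC x (w - k%:R)).

(** The defect of the difference equation [E(x + 1) - E(x) = w x^(w-1)] that the
    complete expansion would satisfy. *)
Definition em_rem K x w : R[i] := em K (x + 1) w - em K x w - w * rpowC x (w - 1).

Definition em_coef K l : R[i] := \sum_(k < K.+1) ratr (beta k) / (l - k)`!%:R.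

(** Expanding the powers of [x + 1] in powers of [1 / x], the Bernoulli recursion
    cancels every term up to order [K]. *)
Lemma em_rem_series K x w : (0 < K)%N -> 4 <= x ->
  csum (fun i => em_coef K (K.+1 + i) * (ffall w (K.+1 + i) * rpowC x (w - (K.+1 + i)%:R)))
    (em_rem K x w).
Proof.
move=> K0 x4.
pose X l := ffall w l * rpowC x (w - l%:R).
pose A k l := ratr (beta k) / (l - k)`!%:R * X l.
have h1 k : csum (fun j => A k (k + j)%N) (ratr (beta k) * (ffall w k * rpowC (x + 1) (w - k%:R))).
  apply: csum_ext (csumZ _ (csumZ _ (rpowC_succ (w - k%:R) x4))) => j.
  rewrite /A /X addKn ffallD /cbin natrD opprD addrA; ring.
have h2 : csum (fun i => \sum_(k < K.+1) A k (K.+1 + i)%N)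
   (\sum_(k < K.+1) (ratr (beta k) * (ffall w k * rpowC (x + 1) (w - k%:R)) -
      \sum_(j < (K - k).+1) A k (k + j)%N)).
  rewrite -(big_mkord xpredT (fun k => ratr (beta k) * (ffall w k * rpowC (x + 1) (w - k%:R)) -
      \sum_(j < (K - k).+1) A k (k + j)%N)).
  rewrite big_seq_cond (eq_bigl (fun i => i \in index_iota 0 K.+1)); last by move=> i; rewrite andbT.
  rewrite -big_seq.
  have -> : (fun i => \sum_(k < K.+1) A k (K.+1 + i)%N) =
            (fun i => \sum_(k <- index_iota 0 K.+1) if (k <= K)%N then A k (K.+1 + i)%N else 0).
    apply: funext => i; rewrite big_mkord; apply: eq_bigr => k _.
    by rewrite -ltnS ltn_ord.
  have -> : \sum_(0 <= k < K.+1) (ratr (beta k) * (ffall w k * rpowC (x + 1) (w - k%:R)) -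
      \sum_(j < (K - k).+1) A k (k + j)%N) = \sum_(k <- index_iota 0 K.+1) 
      if (k <= K)%N then (ratr (beta k) * (ffall w k * rpowC (x + 1) (w - k%:R)) -
      \sum_(j < (K - k).+1) A k (k + j)%N) else 0.
    by rewrite !big_mkord; apply: eq_bigr => k _; rewrite -ltnS ltn_ord.
  apply: csum_sum => k; case: ifP => kK.
    apply: csum_ext (csum_drop (K - k).+1 (h1 k)) => i.
    by rewrite addnA -subSn// subnKC// ltnW.
  by apply: cvgC_ext (cvgC_cst 0) => n; rewrite big1.
have -> : em_rem K x w = \sum_(k < K.+1) (ratr (beta k) * (ffall w k * rpowC (x + 1) (w - k%:R)) -
      \sum_(j < (K - k).+1) A k (k + j)%N).
  rewrite big_split/= sumrN sum_diag /em_rem -addrA; congr (_ + _); rewrite -opprD; congr (- _).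
  have -> : \sum_(l < K.+1) \sum_(k < l.+1) A k l = \sum_(l < K.+1) (ratr (beta l) + (l == 1 :> nat)%:R) * X l.
    apply: eq_bigr => l _; rewrite -bern1 /bern mulr_suml; apply: eq_bigr => k _.
    by rewrite expr1n mulr1.
  under [RHS]eq_bigr do rewrite mulrDl.
  rewrite big_split/=; congr (_ + _).
  case: K K0 {h1 h2} => // K _; rewrite !big_ord_recl/= mul0r add0r mul1r big1 ?addr0.
    by rewrite /X /ffall big_ord1 subr0.
  by move=> i _; rewrite mul0r.
apply: csum_ext h2 => i.
by rewrite /em_coef mulr_suml.
Qed.

Lemma em_coef_rrise K l Q : (K < l)%N ->
  normc (em_coef K l) * (rrise Q.+1 l)%:R <= (\sum_(k < K.+1) (rrise Q.+1 k)%:R) * 2 ^+ Q * 2 ^+ l.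
Proof.
move=> Kl; rewrite -mulrA -exprD mulr_suml.
apply: (@le_trans _ _ (\sum_(k < K.+1) normc (ratr (beta k) / (l - k)`!%:R : R[i]) * (rrise Q.+1 l)%:R)).
  by rewrite -mulr_suml ler_wpM2r//; exact: (normc_sum _ (fun k => ratr (beta k) / (l - k)`!%:R)).
apply: ler_sum => k _.
have kl : (k <= l)%N by rewrite (leq_trans _ Kl)// ltnW.
rewrite normcM normcV normc_nat.
apply: (@le_trans _ _ (1 / (l - k)`!%:R * (rrise Q.+1 l)%:R)).
  by rewrite ler_wpM2r// ler_wpM2r ?invr_ge0// normc_beta.
rewrite -[in rrise _ l](subnKC kl) rriseD addSn [rrise (Q + k).+1 _]rrise_bin !natrM mul1r.
rewrite [X in _ * X](_ : _ = (rrise Q.+1 k)%:R * 'C(Q + k + (l - k), l - k)%:R * (l - k)`!%:R); last by ring.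
rewrite mulrC mulfK ?fact_neq0// ler_wpM2l// -natrX ler_nat.
by rewrite -addnA subnKC// bin_le_exp2.
Qed.

Lemma expR_ln_mul x (n : nat) : 0 < x -> expR (n%:R * ln x) = x ^+ n.
Proof. by move=> x0; rewrite expRM_natl lnK. Qed.

(** The first surviving order is [K + 1], so the defect is [O(x^(Re w - K - 1))],
    which is [O(1 / x^2)] as soon as [K >= Re w + 1]. The estimate is on the
    coefficients of the expansion in [w], to pass to the infinite sum over [x + n]. *)
Lemma em_rem_pser K w0 r : (0 < K)%N -> 0 < r -> Re w0 + r + 1 <= K%:R ->
  exists2 C, 0 <= C & forall x, 4 <= x -> pser (em_rem K x) w0 r (C / x ^+ 2).
Proof.
move=> K0 r0 hK; have [Q hQ] := archi_nat (normc w0 + r).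
have [C1 C10 C1E] : exists2 C1 : R, 0 <= C1 & forall l, (K < l)%N ->
    normc (em_coef K l) * (rrise Q.+1 l)%:R <= C1 * 2 ^+ l.
  exists ((\sum_(k < K.+1) (rrise Q.+1 k)%:R) * 2 ^+ Q); last by move=> l; exact: em_coef_rrise.
  by rewrite mulr_ge0 ?exprn_ge0// sumr_ge0.
exists (C1 * 2 ^+ K.+1 * 2); first by rewrite mulr_ge0// mulr_ge0// exprn_ge0.
move=> x x4; have x0 : 0 < x by lra.
have x1 : 1 <= x by lra.
pose E := expR ((Re w0 + r) * ln x).
have E0 : 0 <= E by exact: expR_ge0.
apply: (pser_series (F := fun i w => em_coef K (K.+1 + i) * (ffall w (K.+1 + i) * rpowC x (w - (K.+1 + i)%:R)))
  (M := fun i => C1 * (2 / x) ^+ K.+1 * E * 2^-1 ^+ i)) => //.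
- move=> i; set l := (K.+1 + i)%N.
  have h := pserZ (x ^- l)%:C (pser_rpowC w0 (ltW r0) x1).
  have {}h := pserZ (em_coef K l) (pser_ffall_mul l (ltW r0) hQ h).
  apply: pser_ext (pser_le _ h) => [w _|].
    by rewrite rpowCB_nat// fmorphV/= [_ / _]mulrC.
  rewrite -/E normcR ger0_norm ?invr_ge0 ?exprn_ge0 ?(ltW x0)// !mulrA.
  apply: (@le_trans _ _ (C1 * 2 ^+ l / x ^+ l * E)).
    rewrite ler_wpM2r// ler_wpM2r ?invr_ge0 ?exprn_ge0 ?(ltW x0)//.
    by apply: C1E; rewrite /l addSn ltnS leq_addr.
  rewrite -[C1 * 2 ^+ l / _]mulrA -expr_div_n /l exprD.
  rewrite [leLHS](_ : _ = C1 * (2 / x) ^+ K.+1 * E * (2 / x) ^+ i); last by ring.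
  rewrite ler_wpM2l ?mulr_ge0 ?exprn_ge0 ?divr_ge0 ?(ltW x0)//.
  rewrite lerXn2r ?nnegrE ?divr_ge0 ?(ltW x0)//.
  by rewrite ler_pdivrMr//; lra.
- move=> N; rewrite -mulr_sumr.
  apply: (@le_trans _ _ (C1 * (2 / x) ^+ K.+1 * E * 2)).
    by rewrite ler_wpM2l ?half_pow_sum// !mulr_ge0 ?exprn_ge0 ?divr_ge0 ?(ltW x0).
  have EK : E <= x ^+ K.-1.
    rewrite -expR_ln_mul// ler_expR ler_wpM2r ?ln_ge0//.
    by case: K K0 hK {C1E} => // K _; rewrite -natr1 /=; lra.
  have -> : x ^+ 2 = x ^+ K.+1 / x ^+ K.-1.
    by case: K K0 {EK hK C1E} => // K _ /=; rewrite -[K.+2]/(2 + K)%N exprD mulfK// gt_eqF// exprn_gt0.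
  rewrite expr_div_n invf_div.
  rewrite [leLHS](_ : _ = C1 * 2 ^+ K.+1 * 2 * (E / x ^+ K.+1)); last by ring.
  by rewrite ler_wpM2l ?mulr_ge0 ?exprn_ge0// ler_wpM2r ?invr_ge0 ?exprn_ge0// ltW.
- move=> w _; exact: em_rem_series.
Qed.

(** Up to the factor [- w], the partial sum of the zeta series at [1 - w], corrected
    by the expansion at its end point: it converges for every [w] with
    [Re w + 2 <= K], and its limit is [- w zeta(1 - w, a)]. *)
Definition em_seq a K N w : R[i] :=
  em K (a + N%:R) w - w * \sum_(n < N) rpowC (a + n%:R) (w - 1).

Lemma em_seqS a K N w : em_seq a K N.+1 w = em_seq a K N w + em_rem K (a + N%:R) w.
Proof.
rewrite /em_seq /em_rem big_ord_recr/= -natr1 addrA; ring.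
Qed.

Lemma em_seqD a K N w :
  em_seq a K (4 + N) w = em_seq a K 4 w + \sum_(n < N) em_rem K (a + (4 + n)%:R) w.
Proof.
elim: N => [|N IH]; first by rewrite addn0 big_ord0 addr0.
rewrite addnS (em_seqS a K (4 + N)%N) IH.
rewrite -addrA; congr (_ + _).
by rewrite [RHS]big_ord_recr.
Qed.

(** Telescoping comparison with [1 / (n (n + 1))]. *)
Lemma sum_inv_sqr a N : 0 < a -> \sum_(n < N) (a + (4 + n)%:R) ^- 2 <= 1.
Proof.
move=> a0; suff : \sum_(n < N) (a + (4 + n)%:R) ^- 2 <= 1 - N.+1%:R^-1.
  by move/le_trans; apply; rewrite lerBlDr lerDl invr_ge0.
elim: N => [|N IH]; first by rewrite big_ord0 invr1 subrr.
rewrite big_ord_recr/= (le_trans (lerD IH (lexx _)))//.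
have N0 : 0 <= (N%:R : R) by [].
rewrite natrD -[N.+2%:R]natr1 -[N.+1%:R]natr1.
set n : R := N%:R.
have n0 : 0 <= n by [].
apply: (@le_trans _ _ (1 - (n + 1)^-1 + (n + 1)^-1 * (n + 1 + 1)^-1)).
  rewrite lerD2l -invfM lef_pV2 ?posrE ?exprn_gt0 ?mulr_gt0; nra.
rewrite le_eqVlt; apply/orP; left; apply/eqP; field.
by apply/andP; split; rewrite gt_eqF//; lra.
Qed.

Lemma Re_nat n : Re (n%:R : R[i]) = n%:R.
Proof. by rewrite -(rmorph_nat (real_complex R)). Qed.

Lemma expR_ln_cvg0 a (c : R) : 0 < a -> c < 0 ->
  (fun N => expR (c * ln (a + N%:R))) @ \oo --> (0 : R).
Proof.
move=> a0 c0; apply/cvgrPdist_lt => e e0.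
exists (Num.truncn (expR (ln e / c))).+1 => // N /= hN.
rewrite sub0r normrN ger0_norm ?expR_ge0// -[ltRHS]lnK// ltr_expR.
have aN : 0 < a + N%:R by rewrite ltr_pwDl.
rewrite mulrC -ltr_ndivrMr// -ltr_expR lnK ?posrE//.
rewrite (lt_le_trans (truncnS_gt _))// (le_trans (_ : _ <= N%:R)) ?ler_nat// lerDr ltW//.
Qed.

Lemma em_term_cvg0 a w k : 0 < a -> Re w < k%:R ->
  cvgC (fun N => ratr (beta k) * (ffall w k * rpowC (a + N%:R) (w - k%:R))) 0.
Proof.
move=> a0 wk.
have h : cvgC (fun N => rpowC (a + N%:R) (w - k%:R)) 0.
  rewrite /cvgC; under eq_fun do rewrite subr0 normc_rpowC ReD ReN Re_nat.
  by apply: expR_ln_cvg0 => //; rewrite subr_lt0.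
by have := cvgC_Z (ratr (beta k)) (cvgC_Z (ffall w k) h); rewrite !mulr0.
Qed.

(** Further correction terms tend to [0]; so the limits for the various [K] glue to
    one function of [w]. *)
Lemma em_seq_indep a K K' w l : 0 < a -> (K <= K')%N -> Re w <= K%:R ->
  cvgC (fun N => em_seq a K N w) l <-> cvgC (fun N => em_seq a K' N w) l.
Proof.
move=> a0 KK' wK; rewrite -(subnKC KK'); elim: (K' - K)%N => [|d IH]; first by rewrite addn0.
have e N : em_seq a (K + d.+1) N w = em_seq a (K + d) N w +
    ratr (beta (K + d).+1) * (ffall w (K + d).+1 * rpowC (a + N%:R) (w - (K + d).+1%:R)).
  by rewrite /em_seq /em addnS [X in X - _]big_ord_recr/= addrAC.
have t0 : cvgC (fun N => ratr (beta (K + d).+1) * (ffall w (K + d).+1 *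
    rpowC (a + N%:R) (w - (K + d).+1%:R))) 0.
  by apply: em_term_cvg0 => //; rewrite (le_lt_trans wK)// ltr_nat ltnS leq_addr.
rewrite IH; split=> h.
  by rewrite -[l]addr0; apply: cvgC_ext (cvgC_D h t0) => N; rewrite e.
rewrite -[l]addr0 -[0]oppr0 -mulN1r; apply: cvgC_ext (cvgC_D h (cvgC_Z (-1) t0)) => N.
by rewrite e mulN1r addrK.
Qed.

Lemma em_limit a w : 0 < a -> exists l, forall K, (0 < K)%N -> Re w + 2 <= K%:R ->
  cvgC (fun N => em_seq a K N w) l.
Proof.
move=> a0.
have [K0 hK0] := archi_nat (Re w + 2).
have [C C0 hC] := @em_rem_pser K0.+1 w 1 isT ltr01 ltac:(lra).
have [|S hS _] := @abs_csum R (fun n => em_rem K0.+1 (a + (4 + n)%:R) w) C.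
  move=> N; apply: (@le_trans _ _ (\sum_(n < N) C / (a + (4 + n)%:R) ^+ 2)).
    apply: ler_sum => n _; apply: (pser_bound (hC _ _)).
      by rewrite natrD; have : 0 <= (n%:R : R) by []; lra.
    by rewrite subrr normc0.
  by rewrite -mulr_sumr -[leRHS]mulr1 ler_wpM2l// sum_inv_sqr.
have hl : cvgC (fun N => em_seq a K0.+1 N w) (em_seq a K0.+1 4 w + S).
  apply/(cvgC_shift _ _ 4); apply: cvgC_ext (cvgC_D (cvgC_cst _) hS) => N.
  by rewrite addnC em_seqD.
exists (em_seq a K0.+1 4 w + S) => K Kp hK.
have [le|/ltnW le] := leqP K K0.+1.
  by apply/(em_seq_indep _ a0 le); [lra|].
by apply/(em_seq_indep _ a0 le); [lra|].
Qed.

Lemma pser_rpowC_ex x w0 : exists M, pser (rpowC x) w0 1 M.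
Proof.
eexists; have := pser_cexp (ln x)%:C w0 ler01.
by apply: pser_ext => z _; rewrite rpowCE.
Qed.

(** The limit is [em_seq] at [N = 4] plus the series of the defects, to which the
    Weierstrass theorem applies. *)
Lemma em_limit_pser a (Phi : R[i] -> R[i]) w0 : 0 < a ->
  (forall w K, (0 < K)%N -> Re w + 2 <= K%:R -> cvgC (fun N => em_seq a K N w) (Phi w)) ->
  exists M, pser Phi w0 1 M.
Proof.
move=> a0 hPhi.
have [K' hK] := archi_nat (Re w0 + 3); set K := K'.+1 in hK.
have [C C0 hC] := @em_rem_pser K w0 1 isT ltr01 ltac:(lra).
have [Q hQ] := archi_nat (normc w0 + 1).
have h1 : exists M, pser (em_seq a K 4) w0 1 M.
  have [M1 hM1] := pser_rpowC_ex (a + 4%:R) w0.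
  have hem : pser (em K (a + 4%:R)) w0 1 (\sum_(k <- index_iota 0 K.+1)
     normc (ratr (beta k) : R[i]) * ((rrise Q.+1 k)%:R * (normc (((a + 4%:R) ^- k)%:C : R[i]) * M1))).
    have := pser_sum (index_iota 0 K.+1) ler01 (fun k =>
      pserZ (ratr (beta k)) (pser_ffall_mul k ler01 hQ (pserZ ((a + 4%:R) ^- k)%:C hM1))).
    apply: pser_ext => z _; rewrite big_mkord; apply: eq_bigr => k _.
    rewrite rpowCB_nat ?fmorphV/= ?[_ / _]mulrC//.
    by rewrite ltr_pwDl.
  have [M Hm] := choice (fun n : nat => pser_rpowC_ex (a + n%:R) w0).
  have hs := pser_sum (index_iota 0 4) ler01 (fun n =>
      pserZ ((a + n%:R)^-1)%:C (Hm n)).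
  have hs' := pserZ (-1) (pser_affine 0 ler01 hs).
  eexists; apply: pser_ext (pserD ler01 hem hs') => z _.
  rewrite /em_seq addr0 mulN1r; congr (_ - _ * _).
  rewrite big_mkord; apply: eq_bigr => n _.
  have an : 0 < a + n%:R by rewrite ltr_pwDl.
  by rewrite -[X in z - X]/(1%:R) rpowCB_nat// expr1 fmorphV/= mulrC.
have [M hM] := h1; exists (M + C).
have h2 : pser (fun w => Phi w - em_seq a K 4 w) w0 1 C.
  apply: (@pser_series _ (fun n w => em_rem K (a + (4 + n)%:R) w) _ _ _
     (fun n => C / (a + (4 + n)%:R) ^+ 2)) => //.
  - move=> n; apply: hC; rewrite natrD; have : 0 <= (n%:R : R) by []; lra.
  - by move=> N; rewrite -mulr_sumr -[leRHS]mulr1 ler_wpM2l// sum_inv_sqr.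
  move=> w wr.
  have wK : Re w + 2 <= K%:R.
    have := Re_le_normc (w - w0); rewrite ReD ReN ler_norml => /andP[_ h].
    lra.
  have := (cvgC_shift _ _ 4).2 (hPhi w K isT wK) => h.
  apply: cvgC_ext (cvgC_D h (cvgC_cst (- em_seq a K 4 w))) => N.
  by rewrite addnC em_seqD addrAC subrr add0r.
by apply: pser_ext (pserD ler01 hM h2) => w _; rewrite addrC subrK.
Qed.

Lemma pser_shrink (f : R[i] -> R[i]) w0 r r' M : 0 <= r' <= r -> pser f w0 r M -> pser f w0 r' M.
Proof.
move=> /andP[r0 rr] [c [cM cf]]; exists c; split=> [n|z zr]; last by apply: cf; exact: le_trans rr.
rewrite (le_trans _ (cM n))// ler_sum// => i _; rewrite ler_wpM2l ?normc_ge0//.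
by rewrite lerXn2r ?nnegrE// (le_trans r0).
Qed.

Lemma ffall_nat m k : (k <= m)%N -> ffall (m%:R : R[i]) k = m`!%:R / (m - k)`!%:R.
Proof.
elim: k => [|k IH] km; first by rewrite /ffall big_ord0 subn0 divff ?fact_neq0.
rewrite ffallS IH 1?ltnW//.
have [d dm] : exists d, m = (k.+1 + d)%N by exists (m - k.+1)%N; rewrite subnKC.
have -> : (m - k = d.+1)%N by rewrite dm addSnnS addKn.
have -> : (m - k.+1 = d)%N by rewrite dm addKn.
have -> : (m%:R - k%:R : R[i]) = d.+1%:R by rewrite dm addSnnS natrD addrAC subrr add0r.
rewrite factS natrM; field.
by rewrite fact_neq0 nat1r pnatr_eq0.
Qed.

Lemma em_nat K m x : (m <= K)%N -> 0 < x -> em K x m%:R = m`!%:R * (bern m x)%:C.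
Proof.
move=> mK x0; rewrite /em -(subnKC mK) -addSn big_split_ord/= [X in _ + X]big1 ?addr0; last first.
  by move=> i _; rewrite ffall_nat_eq0 ?mul0r ?mulr0// ltnS leq_addr.
rewrite /bern rmorph_sum/= mulr_sumr; apply: eq_bigr => k _.
have km : (k <= m)%N by rewrite -ltnS ltn_ord.
rewrite ffall_nat// -natrB// rpowC_nat// fmorph_div/= rmorphM/= rmorph_nat -ratrC; ring.
Qed.

(** At a positive integer the expansion stops and the difference equation of the
    Bernoulli polynomials is exact: the sequence is constant. *)
Lemma em_seq_nat a K m N : (m.+1 <= K)%N -> 0 < a ->
  em_seq a K N m.+1%:R = m.+1`!%:R * (bern m.+1 a)%:C.
Proof.
move=> mK a0; elim: N => [|N IH].
  by rewrite /em_seq big_ord0 mulr0 subr0 addr0 em_nat.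
have aN : 0 < a + N%:R by rewrite ltr_pwDl.
rewrite em_seqS IH /em_rem !em_nat//; last by lra.
have e1 : m.+1%:R - 1 = m%:R :> R[i] by rewrite -natr1 addrK.
have e2 : (bern m.+1 (a + N%:R + 1))%:C = (bern m.+1 (a + N%:R))%:C + ((a + N%:R) ^+ m)%:C / m`!%:R.
  by rewrite bern_shift rmorphD/= rmorphM/= fmorphV/= rmorph_nat.
rewrite e2 e1 rpowC_nat//.
rewrite factS natrM; field; exact: fact_neq0.
Qed.

(** The continuation is [s |-> - Phi (1 - s) / (1 - s)] with [Phi] the limit of
    [em_seq]. For [Re s > 1] the correction terms vanish in the limit and leave the
    defining series; at [s = - m] the limit is, up to a factorial, a value of
    a Bernoulli polynomial. *)
Lemma hurwitz_exists a : 0 < a -> exists f, is_hurwitz_zeta a f /\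
  forall m, f (- m%:R) = - (m`!%:R * (bern m.+1 a)%:C).
Proof.
move=> a0.
have [Phi hPhi] := choice (fun w => em_limit w a0).
exists (fun s => - (Phi (1 - s) / (1 - s))); split; last first.
  move=> m; rewrite opprK -[X in X + _]/(1%:R) -natrD add1n.
  have -> : Phi m.+1%:R = m.+1`!%:R * (bern m.+1 a)%:C.
    have h := hPhi m.+1%:R m.+3 isT; rewrite Re_nat -natrD addn2 in h.
    have {}h := h (lexx _).
    apply: (cvgC_unique h); apply: cvgC_ext (cvgC_cst _) => N.
    by rewrite (em_seq_nat N (leqW (leqnSn _)) a0).
  rewrite factS natrM; congr (- _); field.
  by rewrite nat1r pnatr_eq0.
split=> [s s1|s s1].
  have w0 : Re (1 - s) < 0 by rewrite ReD ReN -[1]/(1%:R) Re_nat; lra.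
  have wn0 : 1 - s != 0 by apply: contraTneq w0 => ->; rewrite ltxx.
  have h := hPhi (1 - s) 2 isT ltac:(lra).
  apply/sums_toE; rewrite /csum.
  have e0 : cvgC (fun N => em 2 (a + N%:R) (1 - s)) 0.
    rewrite /em; have := fun k : nat => @em_term_cvg0 a (1 - s) k a0.
    have wk k : Re (1 - s) < k%:R by rewrite (lt_le_trans w0).
    move=> H; have := cvgC_D (cvgC_D (H 0%N (wk _)) (H 1%N (wk _))) (H 2%N (wk _)).
    by rewrite !addr0; apply: cvgC_ext => N; rewrite !big_ord_recr big_ord0/= add0r.
  have := cvgC_Z (1 - s)^-1 (cvgC_D e0 (cvgC_Z (-1) h)).
  rewrite add0r mulN1r mulrN [_^-1 * _]mulrC; apply: cvgC_ext => N.
  transitivity ((1 - s)^-1 * ((1 - s) * \sum_(n < N) rpowC (a + n%:R) (1 - s - 1))).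
    by congr (_ * _); rewrite /em_seq; ring.
  rewrite mulKf//.
  by apply: eq_bigr => n _; rewrite addrAC subrr add0r addrC.
have w0 : 1 - s != 0 by rewrite subr_eq0 eq_sym.
have nw0 : 0 < normc (1 - s) by rewrite lt_neqAle eq_sym normc_eq0 w0 normc_ge0.
have [M hM] := em_limit_pser (1 - s) a0 (fun w => hPhi w).
pose r := Num.min 1 (normc (1 - s) / 2).
have r0 : 0 < r by rewrite lt_min ltr01 divr_gt0.
have r1 : 0 <= r <= 1 by rewrite ltW//= ge_min lexx.
have r2 : r <= normc (1 - s) / 2 by rewrite ge_min lexx orbT.
have h := pserZ (-1) (pser_reflect (pser_div r0 r2 (pser_shrink r1 hM))).
apply: (pser_analytic r0 (M := _)); apply: pser_ext h => z _.
by rewrite mulN1r.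
Qed.
End HurwitzZeta.

(** * Uniqueness of the continuation and special values *)

Section HurwitzUniqueness.
Variable R : realType.
Implicit Types (s w z : R[i]) (a x r : R).

Lemma hurwitz_unique_Re_gt1 (a : R) (f g : R[i] -> R[i]) s : is_hurwitz_zeta a f -> is_hurwitz_zeta a g ->
  1 < Re s -> f s = g s.
Proof.
move=> [f1 _] [g1 _] s1.
by apply: (csum_unique ((sums_toE _ _).1 (f1 s s1)) ((sums_toE _ _).1 (g1 s s1))).
Qed.

(** Identity theorem along a real line: the set of parameters near whose image
    [f] vanishes is open and closed. *)
Lemma identity_line (f : R[i] -> R[i]) (z v : R[i]) (t1 t0 : R) :
  (forall t : R, analytic_at (f : (R[i] : numFieldType) -> _) (z + t%:C * v)) -> v != 0 ->
  (exists2 r, 0 < r & forall y, normc (y - (z + t1%:C * v)) < r -> f y = 0) ->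
  f (z + t0%:C * v) = 0.
Proof.
move=> an v0 [r1 r10 h1].
have nv : 0 < normc v by rewrite lt_neqAle eq_sym normc_eq0 v0 normc_ge0.
pose A : set R := [set t | exists2 r, 0 < r & forall y, normc (y - (z + t%:C * v)) < r -> f y = 0].
have dist (t t' : R) : normc ((z + t%:C * v) - (z + t'%:C * v)) = `|t - t'| * normc v.
  rewrite (_ : _ - _ = (t - t')%:C * v) ?normcM ?normcR//.
  by rewrite rmorphB/=; ring.
suff AT : A = setT.
  have [r r0 hr] : A t0 by rewrite AT.
  by apply: hr; rewrite subrr normc0.
have : connected [set: R] by apply/connected_intervalP.
apply; first by exists t1, r1.
- exists A; last by rewrite setTI.
  rewrite openE => t [r r0 hr].
  apply/nbhs_ballP; exists (r / 2 / normc v) => /=; first by rewrite !divr_gt0.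
  move=> t'; rewrite /ball/= => tt'.
  exists (r / 2); first by rewrite divr_gt0.
  move=> y hy; apply: hr.
  rewrite (_ : _ - _ = (y - (z + t'%:C * v)) + ((z + t'%:C * v) - (z + t%:C * v))); last by ring.
  rewrite (le_lt_trans (normcD _ _))// dist distrC.
  move: tt'; rewrite ltr_pdivlMr// => tt'; lra.
exists A; last by rewrite setTI.
rewrite closedE => t ht.
have [c /nearC[r r0 hr]] := an t.
have half : 0 < r / 2 by rewrite divr_gt0.
have cE y : normc (y - (z + t%:C * v)) < r -> csum (fun n => c n * (y - (z + t%:C * v)) ^+ n) (f y).
  by move=> yr; apply/sums_toE; exact: hr.
have [[r' r'0 hr']|nA] := pselect (A t); first by exists r'.
have small (e : R) : 0 < e -> exists t', [/\ A t', t' != t & `|t' - t| < e].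
  move=> e0; apply: contrapT => hn; apply: ht.
  apply/nbhs_ballP; exists e => //= t' tt' At'; apply: hn; exists t'; split=> //.
    by apply/eqP => tt; apply: nA; rewrite -tt.
  by rewrite distrC.
have [B hB] : exists B, forall n, normc (c n) * (r / 2) ^+ n <= B.
  have h2 : normc (z + t%:C * v + (r / 2)%:C - (z + t%:C * v)) = r / 2.
    by rewrite (_ : _ - _ = (r / 2)%:C) ?normcR ?ger0_norm ?ltW//; ring.
  have [|B hB] := csum_terms_bounded (cE (z + t%:C * v + (r / 2)%:C) _).
    by rewrite h2; lra.
  by exists B => n; have := hB n; rewrite normcM normcX h2.
have c0 : forall n, c n = 0.
  apply: (power_series_zero half hB) => e e0.
  have m0 : 0 < Num.min e r / normc v by rewrite divr_gt0// lt_min e0.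
  have [t' [At' tt' te]] := small _ m0.
  have dt : normc ((z + t'%:C * v) - (z + t%:C * v)) < Num.min e r.
    by rewrite dist -ltr_pdivlMr.
  move: dt; rewrite lt_min => /andP[de dr].
  exists ((z + t'%:C * v) - (z + t%:C * v)); split=> //.
    by rewrite -normc_eq0 dist mulf_eq0 normr_eq0 subr_eq0 (negbTE tt') (gt_eqF nv).
  have := cE _ dr; have [r' r'0 h'] := At'.
  by rewrite h'// subrr normc0.
exists r => // y yr; apply: (csum_unique (cE y yr)).
by apply: cvgC_ext (cvgC_cst 0) => n; rewrite big1// => i _; rewrite c0 mul0r.
Qed.

Lemma analyticB (f g : R[i] -> R[i]) z :
  analytic_at (f : (R[i] : numFieldType) -> _) z ->
  analytic_at (g : (R[i] : numFieldType) -> _) z ->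
  analytic_at ((fun y => f y - g y) : (R[i] : numFieldType) -> _) z.
Proof.
move=> [c hc] [d hd]; exists (fun n => c n - d n).
apply: filterS2 hc hd => y /sums_toE h1 /sums_toE h2; apply/sums_toE.
have := csumD h1 (csumZ (-1) h2); rewrite mulN1r; apply: csum_ext => n.
by rewrite mulrBl mulN1r.
Qed.

(** For real [s != 1], the line from [s] to the point [2 + i] meets the real axis
    only at [s], so it avoids the pole and ends where the series converges. *)
Lemma hurwitz_unique a (f g : R[i] -> R[i]) s : is_hurwitz_zeta a f -> is_hurwitz_zeta a g ->
  Im s = 0 -> s != 1 -> f s = g s.
Proof.
move=> hf hg s0 s1.
pose v : R[i] := (2 - Re s) +i* 1.
have v0 : v != 0 by apply/eqP => /(congr1 (@complex.Im R)) /= /eqP; rewrite oner_eq0.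
apply/eqP; rewrite -subr_eq0; apply/eqP.
have := @identity_line (fun y => f y - g y) s v 1 0; rewrite mul0r addr0; apply=> //.
  move=> t; have n1 : s + t%:C * v != 1.
    apply/eqP => h; have := congr1 (@complex.Im R) h; rewrite ImD s0 /= mul0r add0r mulr1 addr0.
    by move=> t0; move: h; rewrite t0 mul0r addr0; apply/eqP.
  by apply: analyticB; [exact: hf.2|exact: hg.2].
exists 1 => // y hy; apply/eqP; rewrite subr_eq0; apply/eqP.
apply: (hurwitz_unique_Re_gt1 hf hg).
have := le_lt_trans (Re_le_normc _) hy.
rewrite mul1r ReD ReN ReD /= ltr_norml => /andP[+ _]; lra.
Qed.

Lemma hurwitz_zetaP a : 0 < a -> is_hurwitz_zeta a (fun s => hurwitz_zeta s a).
Proof.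
move=> a0; have [f [hf _]] := hurwitz_exists a0.
have : exists f, [set f | is_hurwitz_zeta a f] f by exists f.
by move=> /(xgetPex (fun=> 0)).
Qed.

Lemma hurwitz_zeta_neg a m : 0 < a ->
  hurwitz_zeta (- m%:R) a = - (m`!%:R * (bern m.+1 a)%:C).
Proof.
move=> a0; have [f [hf <-]] := hurwitz_exists a0.
apply: (hurwitz_unique (hurwitz_zetaP a0) hf).
  by rewrite ImN -(rmorph_nat (real_complex R)) /= oppr0.
apply/eqP => /(congr1 (@complex.Re R)); rewrite ReN Re_nat /= => h.
by have : 0 <= (m%:R : R) by []; lra.
Qed.

Definition zetaR m a : R := Re (hurwitz_zeta m%:R a).

Lemma zetaR_sums a m : 0 < a -> (fun N => \sum_(n < N) (a + n%:R) ^- m.+2) @ \oo --> zetaR m.+2 a.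
Proof.
move=> a0; have [h _] := hurwitz_zetaP a0.
have : 1 < Re (m.+2%:R : R[i]) by rewrite Re_nat ltr1n.
move=> /h/sums_toE/csum_ReIm[/sums_toRE + _].
have e n : Re (rpowC (n%:R + a) (- m.+2%:R)) = (a + n%:R) ^- m.+2.
  have an : 0 < n%:R + a by rewrite ltr_wpDl.
  by rewrite rpowCN rpowC_nat// -fmorphV/= addrC.
by under eq_fun do under eq_bigr do rewrite e.
Qed.

Lemma hurwitz_zeta_nat a m : 0 < a -> hurwitz_zeta (m.+2%:R) a = (zetaR m.+2 a)%:C.
Proof.
move=> a0; rewrite /zetaR; have [h _] := hurwitz_zetaP a0.
have : 1 < Re (m.+2%:R : R[i]) by rewrite Re_nat ltr1n.
move=> /h/sums_toE/csum_ReIm[_ /sums_toRE].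
have e n : Im (rpowC (n%:R + a) (- m.+2%:R)) = 0.
  have an : 0 < n%:R + a by rewrite ltr_wpDl.
  by rewrite rpowCN rpowC_nat// -fmorphV/=.
under eq_fun do under eq_bigr do rewrite e.
under eq_fun do rewrite big1//.
move=> hi; have := cvg_unique _ hi (cvg_cst 0).
by case: (hurwitz_zeta _ _) => x y /= ->.
Qed.
End HurwitzUniqueness.

(** * Derivatives of the cotangent and values of the zeta function *)

Section Cotangent.
Variable R : realType.
Implicit Types (x y a : R) (n r k : nat).

(** The [n]-th derivative of the cotangent is this polynomial in the cotangent. *)
Fixpoint cotp n : {poly R} :=
  if n is n'.+1 then - (1 + 'X^2) * (cotp n')^`() else 'X.

Lemma coef_cotp n : (cotp n)`_n.+1 = (-1) ^+ n * n`!%:R /\ forall k, (n.+1 < k)%N -> (cotp n)`_k = 0.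
Proof.
elim: n => [|n [IH1 IH2]].
  split; first by rewrite /= coefX mulr1.
  by move=> [|[|k]]//= _; rewrite coefX.
have e k : (cotp n.+1)`_k.+2 = - ((cotp n)`_k.+3 *+ k.+3 + (cotp n)`_k.+1 *+ k.+1).
  rewrite /= mulNr mulrDl mul1r coefN coefD coefXnM/= !subSS subn0.
  by rewrite !coef_deriv.
split.
  rewrite e IH2// mul0rn add0r IH1 exprS factS natrM -mulr_natr; ring.
by move=> [|[|k]]// nk; rewrite e !IH2 ?mul0rn ?addr0 ?oppr0//; lia.
Qed.

Lemma horner_cotp n x : (cotp n).[x] = \sum_(k < n.+2) (cotp n)`_k * x ^+ k.
Proof.
apply: horner_coef_wide; apply/leq_sizeP => k; exact: (coef_cotp n).2.
Qed.

Lemma cotp_odd n x : (cotp n).[- x] = (-1) ^+ n.+1 * (cotp n).[x].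
Proof.
have h : cotp n \Po (- 'X) = (-1) ^+ n.+1 *: cotp n.
  elim: n => [|n IH]; first by rewrite comp_polyX expr1 scaleN1r.
  have := congr1 deriv IH; rewrite deriv_comp derivN derivX derivZ mulrN1 => h.
  have e : (- (1 + 'X^2)) \Po (- 'X) = - (1 + 'X^2) :> {poly R}.
    by rewrite rmorphN rmorphD rmorph1 /= comp_Xn_poly sqrrN.
  rewrite /= comp_polyM e.
  have e2 : (cotp n)^`() \Po (- 'X) = - ((-1) ^+ n.+1 *: (cotp n)^`()) by rewrite -h opprK.
  by rewrite e2 [(-1) ^+ n.+2]exprS mulN1r scaleNr scalerAr mulrN.
by have := congr1 (horner^~ x) h; rewrite horner_comp hornerN hornerX hornerZ.
Qed.

Lemma cot_derive x : sin x != 0 -> is_derive x 1 (@cot R) (- (1 + cot x ^+ 2)).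
Proof.
move=> s0; rewrite /cot.
have h1 := is_deriveV s0 (is_derive_sin x).
have h2 := is_deriveM (is_derive_cos x) h1.
apply: (is_derive_eq h2); rewrite /GRing.scale/=.
by field.
Qed.

Lemma cotp_cot_derive n x : sin x != 0 ->
  is_derive x 1 (fun x => (cotp n).[cot x]) (cotp n.+1).[cot x].
Proof.
move=> s0.
have h := is_derive1_comp (is_derive_poly (cotp n) (cot x)) (cot_derive s0).
apply: (is_derive_eq h).
by rewrite /= hornerM hornerN hornerD hornerXn hornerC mulrC.
Qed.

Lemma near_sin_neq0 x : sin x != 0 -> \forall y \near x, sin y != 0.
Proof.
move=> s0; have := @continuous_sin R x.
by move=> /cvgr_neq0; apply.
Qed.

Lemma derive1n_cot n x : sin x != 0 -> derive1n n (@cot R) x = (cotp n).[cot x].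
Proof.
elim: n x => [|n IH] x s0; first by rewrite derive1n0 hornerX.
rewrite derive1nS derive1E.
have e : \forall y \near x, derive1n n (@cot R) y = (cotp n).[cot y].
  by apply: filterS (near_sin_neq0 s0) => y; exact: IH.
rewrite (near_eq_derive _ e); exact: (@derive_val _ _ _ _ _ _ _ (cotp_cot_derive n s0)).
Qed.

Lemma sin_half_neq0 x : sin x != 0 -> sin (x / 2) != 0 /\ sin ((x + pi) / 2) != 0.
Proof.
have -> : sin x = 2 * (sin (x / 2) * cos (x / 2)).
  have -> : sin x = sin (x / 2 + x / 2) by congr sin; field.
  by rewrite sinD; ring.
rewrite !mulf_eq0 !negb_or => /andP[_ /andP[-> c0]]; split=> //.
by rewrite mulrDl sinDpihalf.
Qed.

Lemma cot_double x : sin x != 0 -> 2 * cot x = cot (x / 2) + cot ((x + pi) / 2).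
Proof.
move=> s0; have := s0.
have es : sin x = 2 * (sin (x / 2) * cos (x / 2)).
  have -> : sin x = sin (x / 2 + x / 2) by congr sin; field.
  by rewrite sinD; ring.
have ec : cos x = cos (x / 2) ^+ 2 - sin (x / 2) ^+ 2.
  have -> : cos x = cos (x / 2 + x / 2) by congr cos; field.
  by rewrite cosD; ring.
rewrite es !mulf_eq0 !negb_or => /andP[_ /andP[a0 c0]].
have -> : (x + pi) / 2 = x / 2 + pi / 2 by rewrite [LHS]mulrDl.
rewrite /cot es ec sinDpihalf cosDpihalf; field.
by rewrite a0 c0.
Qed.

(** Differentiating the duplication formula of the cotangent. *)
Lemma cotp_double n x : sin x != 0 ->
  2 ^+ n.+1 * (cotp n).[cot x] = (cotp n).[cot (x / 2)] + (cotp n).[cot ((x + pi) / 2)].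
Proof.
elim: n x => [|n IH] x s0; first by rewrite !hornerX expr1 cot_double.
have [s1 s2] := sin_half_neq0 s0.
have hl : is_derive x 1 (fun x => 2 ^+ n.+1 * (cotp n).[cot x]) (2 ^+ n.+1 * (cotp n.+1).[cot x]).
  exact: (is_deriveZ (2 ^+ n.+1) (cotp_cot_derive n s0)).
have hh (b : R) : is_derive x 1 (fun x => (x + b) / 2) 2^-1.
  have -> : (fun x => (x + b) / 2) = horner (2^-1 *: ('X + b%:P)).
    by apply: funext => y; rewrite hornerZ hornerD hornerX hornerC mulrC.
  apply: (is_derive_eq (is_derive_poly _ x)).
  by rewrite derivZ derivD derivX derivC addr0 hornerZ hornerC mulr1.
have h1 : is_derive x 1 (fun x => (cotp n).[cot (x / 2)]) ((cotp n.+1).[cot (x / 2)] * 2^-1).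
  have hh0 : is_derive x 1 (fun x => x / 2) 2^-1.
    by have := hh 0; under eq_fun do rewrite addr0.
  exact: (@is_derive1_comp R (fun x => (cotp n).[cot x]) (fun x => x / 2) x _ _ (cotp_cot_derive n s1) hh0).
have h2 : is_derive x 1 (fun x => (cotp n).[cot ((x + pi) / 2)]) ((cotp n.+1).[cot ((x + pi) / 2)] * 2^-1).
  exact: (@is_derive1_comp R (fun x => (cotp n).[cot x]) (fun x => (x + pi) / 2) x _ _ (cotp_cot_derive n s2) (hh pi)).
have hr := is_deriveD h1 h2.
have e : \forall y \near x, 2 ^+ n.+1 * (cotp n).[cot y] =
    ((fun x => (cotp n).[cot (x / 2)]) \+ (fun x => (cotp n).[cot ((x + pi) / 2)])) y.
  by apply: filterS (near_sin_neq0 s0) => y; exact: IH.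
have h3 := near_eq_is_derive e hl.
have := @derive_val _ _ _ _ _ _ _ h3; rewrite (@derive_val _ _ _ _ _ _ _ hr) => h.
by rewrite exprS -mulrA -h; field.
Qed.

Lemma sin_shift_neq0 x k : sin x != 0 -> sin (x + k%:R * pi) != 0.
Proof.
elim: k => [|k IH] s0; first by rewrite mul0r addr0.
rewrite -natr1 mulrDl mul1r addrA sinDpi oppr_eq0; exact: IH.
Qed.

Lemma sin_pow2_neq0 x r : sin x != 0 -> sin (x / 2 ^+ r) != 0.
Proof.
elim: r => [|r IH] s0; first by rewrite expr0 divr1.
by rewrite exprSr invfM mulrA; apply: (sin_half_neq0 _).1; exact: IH.
Qed.

Lemma cotp_double_iter n r x : sin x != 0 ->
  2 ^+ (n.+1 * r) * (cotp n).[cot x] = \sum_(k < 2 ^ r) (cotp n).[cot ((x + k%:R * pi) / 2 ^+ r)].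
Proof.
move=> s0; elim: r => [|r IH].
  by rewrite muln0 expn0 big_ord1 !expr0 mul1r divr1 mul0r addr0.
rewrite mulnS exprD -mulrA IH mulr_sumr expnS mul2n -addnn big_split_ord/= -big_split/=.
apply: eq_bigr => k _.
rewrite cotp_double; last exact/sin_pow2_neq0/sin_shift_neq0.
have t0 : (2 ^+ r : R) != 0 by rewrite expf_neq0.
congr ((cotp n).[cot _] + (cotp n).[cot _]).
  by rewrite exprSr invfM mulrA.
by rewrite natrD natrX exprSr; field.
Qed.

Lemma cotpi_sub x : cot (pi - x) = - cot x.
Proof.
by rewrite /cot cosB sinB cospi sinpi !mul0r mulN1r addr0 mulN1r sub0r opprK mulNr.
Qed.

(** Reflecting the upper half of the points [(x + k pi) / 2^(r+1)] brings every
    argument close to the pole at [0] as [r] grows. *)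
Lemma cotp_double_fold n r x : sin x != 0 ->
  2 ^+ (n.+1 * r.+1) * (cotp n).[cot x] =
  \sum_(k < 2 ^ r) ((cotp n).[cot ((x + k%:R * pi) / 2 ^+ r.+1)] +
    (-1) ^+ n.+1 * (cotp n).[cot ((pi - x + k%:R * pi) / 2 ^+ r.+1)]).
Proof.
move=> s0; rewrite cotp_double_iter// expnS mul2n -addnn big_split_ord/= [RHS]big_split/=.
congr (_ + _); rewrite [LHS](reindex_inj rev_ord_inj)/=; apply: eq_bigr => k _.
rewrite -cotp_odd -cotpi_sub; congr ((cotp n).[cot _]).
have t0 : (2 ^+ r : R) != 0 by rewrite expf_neq0.
rewrite natrD natrB// natrX -natr1 exprSr; field.
exact: t0.
Qed.

Lemma ge0_from_derive (f df : R -> R) y : (forall x, is_derive x 1 f (df x)) -> f 0 = 0 ->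
  0 <= y -> (forall x, 0 <= x <= y -> 0 <= df x) -> 0 <= f y.
Proof.
move=> hd f0 y0 hp.
have [|c] := @MVT_segment R f df 0 y y0 (fun x _ => hd x).
  apply: derivable_within_continuous => x _; exact: (@ex_derive _ _ _ _ _ _ _ (hd x)).
rewrite in_itv /= => cy; rewrite f0 !subr0 => ->.
by rewrite mulr_ge0// hp.
Qed.

Lemma sin_ge_mulcos y : 0 <= y <= pi -> y * cos y <= sin y.
Proof.
move=> /andP[y0 yp]; rewrite -subr_ge0.
apply: (@ge0_from_derive (fun y => sin y - y * cos y) (fun x => x * sin x)) => // [x||x /andP[x0 xy]].
- have h := is_deriveB (is_derive_sin x) (is_deriveM (is_derive_id x 1) (is_derive_cos x)).
  apply: (is_derive_eq h); rewrite /GRing.scale/=; ring.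
- by rewrite sin0 mul0r subr0.
- by rewrite mulr_ge0// sin_ge0_pi// x0 (le_trans xy).
Qed.

Lemma sin_le_id y : 0 <= y -> sin y <= y.
Proof.
move=> y0; rewrite -subr_ge0.
have hd (x : R) : is_derive x 1 (fun y => y - sin y) (1 - cos x).
  exact: (is_derive_eq (is_deriveB (is_derive_id x 1) (is_derive_sin x))).
apply: (ge0_from_derive hd _ y0); first by rewrite sin0 subr0.
by move=> x _; rewrite subr_ge0 cos_le1.
Qed.

Lemma mul_cot_bounds y : 0 < y <= pi / 2 -> cos y <= y * cot y <= 1.
Proof.
move=> /andP[y0 yp]; have p0 := pi_gt0 R.
have s0 : 0 < sin y by rewrite sin_gt0_pi// y0/=; lra.
have c0 : 0 <= cos y by rewrite cos_ge0_pihalf//; lra.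
rewrite /cot mulrA ler_pdivlMr// ler_pdivrMr// mul1r; apply/andP; split.
  by rewrite mulrC ler_wpM2r// sin_le_id// ltW.
by apply: sin_ge_mulcos; lra.
Qed.

(** Near the pole [y c] stays bounded for [c = cot y], and the powers of [y] carry
    the decay. *)
Lemma cotp_scaled n y c : y ^+ n.+1 * (cotp n).[c] =
  \sum_(k < n.+2) (cotp n)`_k * y ^+ (n.+1 - k) * (y * c) ^+ k.
Proof.
rewrite horner_cotp mulr_sumr; apply: eq_bigr => k _.
have kn : (k <= n.+1)%N by rewrite -ltnS ltn_ord.
have -> : y ^+ n.+1 = y ^+ (n.+1 - k) * y ^+ k by rewrite -exprD subnK.
by rewrite exprMn; ring.
Qed.

(** Only the leading term of the polynomial survives near the pole. *)
Lemma cotp_pole n (y : nat -> R) : (forall r, 0 < y r <= pi / 2) -> y @ \oo --> (0 : R) ->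
  (fun r => y r ^+ n.+1 * (cotp n).[cot (y r)]) @ \oo --> ((-1) ^+ n * n`!%:R : R).
Proof.
move=> hy y0.
have hc : (fun r => y r * cot (y r)) @ \oo --> (1 : R).
  have h1 : (fun r => cos (y r)) @ \oo --> (1 : R).
    by rewrite -(cos0 R); apply: (continuous_cvg _ _ y0); exact: continuous_cos.
  apply: (squeeze_cvgr _ h1 (cvg_cst (1 : R))); apply: nearW => r; exact: mul_cot_bounds.
have pw (u : nat -> R) (l : R) k : u @ \oo --> l -> (fun r => u r ^+ k) @ \oo --> (l ^+ k : R).
  move=> hu; elim: k => [|k IH]; first by under eq_fun do rewrite expr0; exact: cvg_cst.
  under eq_fun do rewrite exprS; rewrite exprS; exact: cvgM.
under eq_fun do rewrite cotp_scaled//.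
have -> : (-1) ^+ n * n`!%:R = \sum_(k < n.+2) (cotp n)`_k * 0 ^+ (n.+1 - k) * 1 ^+ k.
  rewrite big_ord_recr/= subnn expr0 expr1n !mulr1 (coef_cotp n).1 big1 ?add0r// => k _.
  by rewrite expr0n subn_eq0 leqNgt ltn_ord mulr0 mul0r.
apply: (@cvg_sum_ord R (fun k r => (cotp n)`_k * y r ^+ (n.+1 - k) * (y r * cot (y r)) ^+ k)
  (fun k => (cotp n)`_k * 0 ^+ (n.+1 - k) * 1 ^+ k)) => k.
by apply: cvgM; [apply: cvgM; [exact: cvg_cst|exact: pw]|exact: pw].
Qed.

Lemma cotp_bound n : exists C : R, forall y, 0 < y <= pi / 2 -> `|y ^+ n.+1 * (cotp n).[cot y]| <= C.
Proof.
exists (\sum_(k < n.+2) `|(cotp n)`_k| * (pi / 2) ^+ (n.+1 - k)) => y yb.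
have /andP[y0 yp] := yb; have p0 := pi_gt0 R.
have c0 : 0 <= cos y by rewrite cos_ge0_pihalf//; lra.
have /andP[h1 h2] := mul_cot_bounds yb.
rewrite cotp_scaled// (le_trans (ler_norm_sum _ _ _))// ler_sum// => k _.
rewrite !normrM !normrX -[leRHS]mulr1 ler_pM ?mulr_ge0 ?exprn_ge0//.
  by rewrite ler_wpM2l// lerXn2r ?nnegrE ?normr_ge0 ?(ger0_norm (ltW y0))//; lra.
have h0 : 0 <= y * cot y by lra.
by rewrite (ger0_norm h0) exprn_ile1.
Qed.

Lemma zetaR_le m a N : 0 < a -> \sum_(n < N) (a + n%:R) ^- m.+2 <= zetaR m.+2 a.
Proof.
move=> a0; have h := @zetaR_sums R a m a0.
have -> : zetaR m.+2 a = limn (fun N => \sum_(n < N) (a + n%:R) ^- m.+2) by apply/esym/cvg_lim.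
apply: nondecreasing_cvgn_le; last by apply/cvg_ex; eexists; exact: h.
apply/nondecreasing_seqP => k; rewrite big_ord_recr lerDl invr_ge0 exprn_ge0//.
by rewrite addr_ge0// ltW.
Qed.

(** Partial fractions for the derivatives of the cotangent. Iterating the
    duplication formula writes the value as a finite sum over the points
    [(x + k pi) / 2^r], which Tannery's theorem takes to the limit. *)
Lemma cotp_zeta n a : 0 < a < 1 -> pi ^+ n.+2 * (cotp n.+1).[cot (pi * a)] =
  (-1) ^+ n.+1 * n.+1`!%:R * (zetaR n.+2 a + (-1) ^+ n.+2 * zetaR n.+2 (1 - a)).
Proof.
move=> /andP[a0 a1]; have p0 := pi_gt0 R.
have b0 : 0 < 1 - a by lra.
have s0 : sin (pi * a) != 0.
  rewrite gt_eqF// sin_gt0_pi// mulr_gt0//=.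
  by rewrite -[ltRHS]mulr1 ltr_pM2l.
have t2 r : 0 < (2 ^+ r : R) by rewrite exprn_gt0.
have [C hC] := cotp_bound n.+1.
(* the scaled value at the point of index b; it tends to the term b^-(n+2) *)
pose g r (b : R) := (pi / 2 ^+ r.+1) ^+ n.+2 * (cotp n.+1).[cot (pi * b / 2 ^+ r.+1)].
have gE r (b : R) : b != 0 -> g r b = (pi * b / 2 ^+ r.+1) ^+ n.+2 * (cotp n.+1).[cot (pi * b / 2 ^+ r.+1)] * b ^- n.+2.
  move=> bn; rewrite /g [RHS]mulrAC; congr (_ * _).
  by rewrite [pi * b / _]mulrAC [in RHS]exprMn mulfK// expf_neq0.
have yb r (b : R) : 0 < b <= 2 ^+ r -> 0 < pi * b / 2 ^+ r.+1 <= pi / 2.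
  move=> /andP[hb1 hb2]; rewrite divr_gt0 ?mulr_gt0//= ler_pdivrMr//.
  rewrite exprS mulrA divfK// ler_pM2l//.
have gC r (b : R) : 0 < b <= 2 ^+ r -> `|g r b| <= C * b ^- n.+2.
  move=> hb; have /andP[hb1 hb2] := hb; rewrite gE ?gt_eqF// normrM [X in _ * X]ger0_norm; last first.
    by rewrite invr_ge0 exprn_ge0// ltW.
  by rewrite ler_wpM2r ?invr_ge0 ?exprn_ge0 ?(ltW hb1)// hC// yb.
have glim (b : R) : 0 < b -> (fun r => g r b) @ \oo --> ((-1) ^+ n.+1 * n.+1`!%:R * b ^- n.+2 : R).
  move=> hb; have [k0 hk0] := archi_nat b.
  have hk r : b <= 2 ^+ (r + k0.+1).
    rewrite (le_trans hk0)// -natrX ler_nat (leq_trans (ltnW (ltn_expl _ (ltnSn 1))))//.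
    by rewrite leq_exp2l// leq_addl.
  rewrite -(cvg_shiftn k0.+1).
  under eq_fun do rewrite gE ?gt_eqF//.
  apply: cvgM; last exact: cvg_cst.
  apply: (@cotp_pole n.+1 (fun r => pi * b / 2 ^+ (r + k0.+1).+1)) => [r|].
    by apply: yb; rewrite hb hk.
  have h : (fun r => geometric (pi * b / 2 ^+ k0.+2) (2^-1) r) @ \oo --> (0 : R).
    by apply: cvg_geometric; rewrite ger0_norm// invf_lt1 ?ltr1n.
  apply: cvg_trans h; apply: near_eq_cvg; apply: nearW => r /=.
  have -> : (r + k0.+1).+1 = (k0.+2 + r)%N by lia.
  by rewrite exprVn [in RHS]exprD [in RHS]invfM [RHS]mulrA.
have M0 k : a + k%:R <= k.+1%:R by rewrite -natr1 addrC lerD2l ltW.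
have M1 k : 1 - a + k%:R <= k.+1%:R by rewrite -natr1; lra.
have ak k : 0 < a + k%:R by rewrite ltr_pwDl.
have bk k : 0 < 1 - a + k%:R by rewrite ltr_pwDl.
have kr r k : (k < 2 ^ r)%N -> (k.+1%:R : R) <= 2 ^+ r by rewrite -natrX ler_nat.
pose t k r := if (k < 2 ^ r)%N then g r (a + k%:R) + (-1) ^+ n.+2 * g r (1 - a + k%:R) else 0.
pose l k := (-1) ^+ n.+1 * n.+1`!%:R * ((a + k%:R) ^- n.+2 + (-1) ^+ n.+2 * (1 - a + k%:R) ^- n.+2).
have C0 : 0 <= C.
  have := hC (pi / 2); rewrite lexx andbT divr_gt0// => /(_ isT); exact: le_trans.
have [k|k r|N|r|S [h1 h2]] := @tanneryR R t (fun k => C * (a + k%:R) ^- n.+2 + C * (1 - a + k%:R) ^- n.+2)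
    (C * zetaR n.+2 a + C * zetaR n.+2 (1 - a)) l (fun r => pi ^+ n.+2 * (cotp n.+1).[cot (pi * a)]).
- have h : (fun r => g r (a + k%:R) + (-1) ^+ n.+2 * g r (1 - a + k%:R)) @ \oo --> l k.
    rewrite /l mulrDr; apply: cvgD; first exact: glim.
    by rewrite mulrCA; apply: cvgM; [exact: cvg_cst|exact: glim].
  apply: cvg_trans h; apply: near_eq_cvg; exists k => // r /= kr'.
  by rewrite /t (leq_ltn_trans kr' (ltn_expl _ (ltnSn 1))).
- rewrite /t; case: ifP => kr'; last first.
    by rewrite normr0 addr_ge0// mulr_ge0// invr_ge0 exprn_ge0// ltW.
  rewrite (le_trans (ler_normD _ _))// lerD//.
    by apply: gC; rewrite ak (le_trans (M0 k))// kr.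
  rewrite normrM normrX normrN1 expr1n mul1r; apply: gC.
  by rewrite bk (le_trans (M1 k))// kr.
- by rewrite big_split/= -!mulr_sumr lerD// ler_wpM2l// zetaR_le.
- have -> : pi ^+ n.+2 * (cotp n.+1).[cot (pi * a)] = \sum_(k < 2 ^ r) t k r.
    have := cotp_double_fold n.+1 r s0 => /(congr1 (fun X => (pi / 2 ^+ r.+1) ^+ n.+2 * X)).
    rewrite mulrA {1}expr_div_n -exprM mulnC divfK ?expf_neq0// => ->.
    rewrite mulr_sumr; apply: eq_bigr => k _; rewrite /t ltn_ord /g mulrDr mulrCA.
    congr (_ * (cotp _).[cot (_ / _)] + _ * (_ * (cotp _).[cot (_ / _)])); ring.
  have h : (fun _ : nat => \sum_(k < 2 ^ r) t k r) @ \oo --> (\sum_(k < 2 ^ r) t k r : R).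
    exact: cvg_cst.
  apply: cvg_trans h; apply: near_eq_cvg; exists (2 ^ r)%N => // N /= hN.
  rewrite -(subnKC hN) big_split_ord/= [X in _ = _ + X]big1 ?addr0// => k _.
  by rewrite /t ltnNge leq_addr.
rewrite -(cvg_unique _ h2 (cvg_cst _))//.
have h3 : (fun N => (-1) ^+ n.+1 * n.+1`!%:R * (\sum_(k < N) (a + k%:R) ^- n.+2 +
    (-1) ^+ n.+2 * \sum_(k < N) (1 - a + k%:R) ^- n.+2)) @ \oo -->
    ((-1) ^+ n.+1 * n.+1`!%:R * (zetaR n.+2 a + (-1) ^+ n.+2 * zetaR n.+2 (1 - a)) : R).
  apply: cvgM; first exact: cvg_cst.
  by apply: cvgD; [exact: zetaR_sums|apply: cvgM; [exact: cvg_cst|exact: zetaR_sums]].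
apply: (cvg_unique _ _ h3) => //; apply: cvg_trans h1; apply: near_eq_cvg; apply: nearW => N.
by rewrite mulr_sumr -big_split/= mulr_sumr.
Qed.
End Cotangent.

(** * Algebraic integers in a field of characteristic zero *)

Section AlgebraicIntegers.
Variable K : numFieldType.
Implicit Types z w : K.

Definition aint z := integralOver (intr : int -> K) z.

Lemma aint_int (n : int) : aint n%:~R.
Proof. exact: integral_id. Qed.

Lemma aint_nat (n : nat) : aint n%:R.
Proof. exact: (aint_int n). Qed.

Lemma aint0 : aint 0. Proof. exact: (aint_int 0). Qed.
Lemma aint1 : aint 1. Proof. exact: (aint_int 1). Qed.

Lemma aintD z w : aint z -> aint w -> aint (z + w).
Proof. exact: integral_add. Qed.

Lemma aintM z w : aint z -> aint w -> aint (z * w).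
Proof. exact: integral_mul. Qed.

Lemma aintN z : aint z -> aint (- z).
Proof. exact: integral_opp. Qed.

Lemma aintX z n : aint z -> aint (z ^+ n).
Proof. by move=> hz; elim: n => [|n IH]; [exact: aint1|rewrite exprS; exact: aintM]. Qed.

Lemma aint_sum I (s : seq I) (P : pred I) (F : I -> K) :
  (forall i, P i -> aint (F i)) -> aint (\sum_(i <- s | P i) F i).
Proof. by move=> h; apply: (big_ind aint); [exact: aint0|exact: aintD|]. Qed.

Lemma aint_prod I (s : seq I) (P : pred I) (F : I -> K) :
  (forall i, P i -> aint (F i)) -> aint (\prod_(i <- s | P i) F i).
Proof. by move=> h; apply: (big_ind aint); [exact: aint1|exact: aintM|]. Qed.

Lemma aint_unity_root z n : (0 < n)%N -> z ^+ n = 1 -> aint z.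
Proof.
move=> n0 zn; exists ('X^n - 1); first by rewrite monicXnsubC.
by rewrite rmorphB/= map_polyXn rmorph1 rootE !hornerE zn subrr.
Qed.

(** The monic equation transfers to [algC], where rational algebraic integers are
    known to be integers. *)
Lemma aint_rat (q : rat) : aint (ratr q) -> exists n : int, q = n%:~R.
Proof.
move=> [P mP]; rewrite rootE => h.
have e (F : numFieldType) : (map_poly intr P).[ratr q] = ratr (map_poly intr P).[q] :> F.
  rewrite -horner_map/= -map_poly_comp; congr (_.[_]).
  by apply: eq_map_poly => n /=; rewrite ratr_int.
move: h; rewrite e fmorph_eq0 => /eqP h.
have hA : (ratr q : algC) \in Aint.
  apply: (@root_monic_Aint (map_poly intr P)).
  - by rewrite rootE e h rmorph0.
  - exact: monic_map.
  - by apply/polyOverP => i; rewrite coef_map /= intr_int.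
have := Cint_rat_Aint (Crat_rat q) hA.
move=> /intrP[n hn]; exists n; apply: (fmorph_inj (ratr : {rmorphism rat -> algC})); rewrite [RHS]ratr_int.
exact: hn.
Qed.
End AlgebraicIntegers.

(** * The quadratic character modulo an odd prime *)

Section QuadraticCharacter.
Variables (p m : nat).
Hypothesis p_prime : prime p.
Hypothesis p_odd : p = m.*2.+1.
Hypothesis m_gt0 : (0 < m)%N.
Implicit Types (x y : 'F_p) (a b : int) (j k : nat).

Lemma Fp_nat_eq0 j : ((j%:R : 'F_p) == 0) = (p %| j)%N.
Proof. by rewrite (dvdn_pcharf (pchar_Fp p_prime)). Qed.

Lemma Fp_int_eq0 a : ((a%:~R : 'F_p) == 0) = (p %| a)%Z.
Proof. by rewrite (dvdz_pcharf (pchar_Fp p_prime)). Qed.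

Lemma Fp_natK x : (val x)%:R = x.
Proof. exact: natr_Zp. Qed.

Lemma Fp_val_lt x : (val x < p)%N.
Proof. by rewrite -[ltnRHS](Fp_cast p_prime) ltn_ord. Qed.

Lemma Fp_expf x : x != 0 -> x ^+ m.*2 = 1.
Proof.
move=> x0; apply: (mulfI x0); rewrite -exprS -p_odd mulr1.
by have := finfield.expf_card x; rewrite card_Fp.
Qed.

Lemma sum_Fp (V : nmodType) (F : nat -> V) :
  \sum_(0 <= j < p) F j = \sum_(x : 'F_p) F (val x).
Proof. by rewrite -[in LHS](Fp_cast p_prime) big_mkord. Qed.

Lemma sum_Fp_neq0 (V : nmodType) (F : nat -> V) : 
  \sum_(1 <= j < p) F j = \sum_(x : 'F_p | x != 0) F (val x).
Proof.
have h := sum_Fp F; have p0 := prime_gt0 p_prime.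
have := sum_Fp (fun j => if j == 0 then 0 else F j).
rewrite big_ltn//= add0r => e.
transitivity (\sum_(1 <= i < p) (if i == 0 then 0 else F i)).
  by apply: eq_big_nat => -[|i].
rewrite e [RHS]big_mkcond; apply: eq_bigr => x _.
by rewrite -(inj_eq val_inj)/=; case: eqP.
Qed.

Lemma natr_Fp_inj j k : (j < p)%N -> (k < p)%N -> (j%:R : 'F_p) = k%:R -> j = k.
Proof. by move=> jp kp /(congr1 val); rewrite /= !val_Fp_nat// !modn_small. Qed.

Lemma unity_roots_le n (s : seq 'F_p) : (0 < n)%N -> uniq s ->
  (forall x, x \in s -> x ^+ n = 1) -> (size s <= n)%N.
Proof.
move=> n0 us hs; apply: max_unity_roots => //; apply/allP => x xs.
by apply/unity_rootP; exact: hs.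
Qed.

(** The [m] nonzero squares already exhaust the roots of [X^m - 1]. *)
Lemma Fp_nonsquare x : x != 0 -> (forall y, y ^+ 2 != x) -> x ^+ m = -1.
Proof.
move=> x0 nsq; have := Fp_expf x0.
rewrite -mul2n mulnC exprM => /eqP; rewrite sqrf_eq1 => /orP[|/eqP//].
move=> /eqP xm; exfalso.
pose s := [seq (i%:R : 'F_p) ^+ 2 | i <- iota 1 m].
have us : uniq s.
  rewrite map_inj_in_uniq ?iota_uniq// => i j; rewrite !mem_iota => hi hj.
  move=> /eqP; rewrite eqf_sqr => /orP[/eqP|].
    by apply: natr_Fp_inj; lia.
  rewrite -subr_eq0 opprK -natrD Fp_nat_eq0 => /dvdn_leq h; lia.
have := @unity_roots_le m (x :: s) m_gt0.
rewrite /= size_map size_iota ltnn => h.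
suff : false by []; apply: h.
  rewrite us andbT; apply/mapP => -[i _ h].
  by have := nsq i%:R; rewrite h eqxx.
move=> y; rewrite inE => /orP[/eqP->//|/mapP[j]].
rewrite mem_iota => hi ->; rewrite -exprM mul2n Fp_expf//.
rewrite Fp_nat_eq0; apply/negP => /dvdn_leq; lia.
Qed.

(** Euler's criterion. *)
Lemma legendreE a : ((legendre a p)%:~R : 'F_p) = a%:~R ^+ m.
Proof.
rewrite /legendre -Fp_int_eq0; case: eqP => [->|/eqP a0].
  by rewrite expr0n gtn_eqF.
have sqE (i : nat) : ((i%:Z ^+ 2 == a %[mod p])%Z) = ((i%:R : 'F_p) ^+ 2 == a%:~R).
  by rewrite eqz_mod_dvd -Fp_int_eq0 rmorphB/= subr_eq0 rmorphXn.
case: existsP => [[ i ]|nsq].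
  rewrite sqE => /eqP h; rewrite -h -exprM mul2n Fp_expf//.
  by apply: contraNneq a0; rewrite -h => ->; rewrite expr0n.
rewrite Fp_nonsquare// => y; apply/negP => /eqP h; apply: nsq.
by exists (Ordinal (Fp_val_lt y)); rewrite sqE /= Fp_natK h.
Qed.

Lemma legendre_values a : legendre a p \in [:: 0; 1; -1].
Proof. by rewrite /legendre; case: ifP => // _; case: ifP. Qed.

(** Values in [{0, 1, -1}] are determined by their residues since [p > 2]. *)
Lemma small_int_eq a b : a \in [:: 0; 1; -1 : int] -> b \in [:: 0; 1; -1 : int] ->
  (a%:~R : 'F_p) = b%:~R -> a = b.
Proof.
move=> ha hb /eqP; rewrite -subr_eq0 -rmorphB/= Fp_int_eq0.
have : (2 < p)%N by lia.
move: ha hb; rewrite !inE => /or3P[] /eqP -> /or3P[] /eqP -> //; 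
  rewrite /dvdz => p2 /dvdn_leq; simpl; lia.
Qed.

Definition chi x : int := legendre (val x : nat) p.

Lemma chiE x : ((chi x)%:~R : 'F_p) = x ^+ m.
Proof. by rewrite /chi legendreE [_%:~R]Fp_natK. Qed.

Lemma chi_eq x b : b \in [:: 0; 1; -1 : int] -> (b%:~R : 'F_p) = x ^+ m -> chi x = b.
Proof. by move=> hb h; apply: small_int_eq; rewrite ?legendre_values// chiE h. Qed.

Lemma chi_values x : chi x \in [:: 0; 1; -1].
Proof. exact: legendre_values. Qed.

Lemma chiM x y : chi (x * y) = chi x * chi y.
Proof.
apply: chi_eq; last by rewrite rmorphM/= !chiE exprMn.
have := chi_values x; have := chi_values y; rewrite !inE.
by move=> /or3P[] /eqP -> /or3P[] /eqP ->.
Qed.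

Lemma chi0 : chi 0 = 0.
Proof. by apply: chi_eq => //; rewrite expr0n gtn_eqF. Qed.

Lemma chi_sqr x : x != 0 -> chi x * chi x = 1.
Proof.
move=> x0; have /eqP := chiE x.
have := chi_values x; rewrite !inE => /or3P[] /eqP -> //.
by rewrite eq_sym expf_eq0 (negbTE x0) andbF.
Qed.

Lemma chiN x : chi (- x) = (-1) ^+ m * chi x.
Proof.
rewrite -[- x]mulN1r chiM; congr (_ * _); apply: chi_eq; last by rewrite rmorphXn rmorphN1.
by rewrite -signr_odd; case: (odd m).
Qed.

Lemma legendre_int a : legendre a p = chi (a%:~R).
Proof. by apply/esym/chi_eq; [exact: legendre_values|rewrite legendreE]. Qed.

Lemma exists_nonsquare : exists2 x, x != 0 & chi x = -1.
Proof.
have [//|h] := pselect (exists2 x, x != 0 & chi x = -1); exfalso.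
have all1 x : x != 0 -> x ^+ m = 1.
  move=> x0; have := chiE x; have := chi_values x; rewrite !inE => /or3P[] /eqP h1.
  - by have := chi_sqr x0; rewrite h1.
  - by rewrite h1.
  - by case: h; exists x.
have := @unity_roots_le m [seq (i%:R : 'F_p) | i <- iota 1 m.+1] m_gt0.
rewrite size_map size_iota ltnn => H.
suff : false by []; apply: H.
  rewrite map_inj_in_uniq ?iota_uniq// => i j; rewrite !mem_iota => hi hj.
  by apply: natr_Fp_inj; lia.
move=> y /mapP[j]; rewrite mem_iota => hi ->; apply: all1.
rewrite Fp_nat_eq0; apply/negP => /dvdn_leq; lia.
Qed.

Lemma sum_chi : \sum_x chi x = 0.
Proof.
have [y y0 hy] := exists_nonsquare.
have : \sum_x chi x = - \sum_x chi x.
  rewrite {1}(reindex_inj (mulfI y0))/= -sumrN; apply: eq_bigr => x _.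
  by rewrite chiM hy mulN1r.
lia.
Qed.

(** Each nonzero square has two roots, so summing over squares weights by [1 + chi]. *)
Lemma sum_squares (V : zmodType) (F : 'F_p -> V) :
  \sum_(x | x != 0) F (x ^+ 2) = \sum_(x | x != 0) (F x *~ (1 + chi x)).
Proof.
rewrite (partition_big (fun x => x ^+ 2) (fun y => y != 0))/=; last first.
  by move=> x x0; rewrite expf_neq0.
apply: eq_bigr => y y0.
have [[z hz]|nsq] := pselect (exists z, z ^+ 2 = y).
  have z0 : z != 0 by apply: contraNneq y0 => z0; rewrite -hz z0 expr0n.
  have zN : z != - z.
    rewrite -subr_eq0 opprK -mulr2n -mulr_natl mulf_eq0 (negbTE z0) orbF Fp_nat_eq0.
    apply/negP => /dvdn_leq; lia.
  have -> : chi y = 1 by rewrite -hz expr2 chiM chi_sqr.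
  rewrite (eq_bigr (fun=> F y)); last by move=> i /andP[_ /eqP ->].
  rewrite (eq_bigl (fun i => i \in [:: z; - z])); last first.
    move=> i; rewrite !inE -eqf_sqr hz andb_idl// => /eqP h.
    by apply: contraNneq y0 => i0; rewrite -h i0 expr0n.
  by rewrite -big_uniq/= ?inE ?zN// big_cons big_seq1.
have -> : chi y = -1.
  apply: chi_eq => //; rewrite Fp_nonsquare ?rmorphN1// => z.
  by apply/eqP => h; apply: nsq; exists z.
rewrite subrr mulr0z big1// => i /andP[_ /eqP h].
by case: nsq; exists i.
Qed.

(** Multiplication by [y] permutes the field and scales the sum by [y^n != 1]. *)
Lemma sum_Fp_exp n : (n < m.*2)%N -> \sum_(x : 'F_p) x ^+ n = 0.
Proof.
move=> nm; case: n nm => [|n] nm.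
  under eq_bigr do rewrite expr0.
  by rewrite sumr_const card_Fp// pchar_Fp_0.
have [y [y0 hy]] : exists y : 'F_p, y != 0 /\ y ^+ n.+1 != 1.
  apply: contrapT => h.
  have all1 x : x != 0 -> x ^+ n.+1 = 1.
    by move=> x0; apply: contrapT => /eqP h1; apply: h; exists x.
  have := @unity_roots_le n.+1 [seq (i%:R : 'F_p) | i <- iota 1 n.+2] isT.
  rewrite size_map size_iota ltnn => H.
  suff : false by []; apply: H.
    rewrite map_inj_in_uniq ?iota_uniq// => i j; rewrite !mem_iota => hi hj.
    by apply: natr_Fp_inj; lia.
  move=> y /mapP[j]; rewrite mem_iota => hi ->; apply: all1.
  rewrite Fp_nat_eq0; apply/negP => /dvdn_leq; lia.
have : \sum_(x : 'F_p) x ^+ n.+1 = y ^+ n.+1 * \sum_(x : 'F_p) x ^+ n.+1.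
  rewrite {1}(reindex_inj (mulfI y0))/= mulr_sumr; apply: eq_bigr => x _.
  by rewrite exprMn.
move/eqP; rewrite -subr_eq0 -{1}[\sum_x _]mul1r -mulrBl mulf_eq0 subr_eq0 eq_sym (negbTE hy).
by move/eqP.
Qed.

Lemma sum_Fp_exp_top : \sum_(x : 'F_p) x ^+ m.*2 = -1.
Proof.
rewrite (bigD1 0)//= expr0n double_eq0 gtn_eqF// add0r.
under eq_bigr => x x0 do rewrite Fp_expf//.
rewrite sumr_const cardC1 card_Fp//; apply: (@addIr _ 1).
by rewrite addNr natr1 prednK ?prime_gt0// pchar_Fp_0.
Qed.

Lemma Fp_val_gt0 x : x != 0 -> (0 < val x)%N.
Proof.
by move=> x0; rewrite lt0n -[X in _ != X]/(val (0 : 'F_p)) (inj_eq val_inj).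
Qed.

Lemma Fp_val_opp x : x != 0 -> val (- x) = (p - val x)%N.
Proof.
move=> x0; have vp := Fp_val_lt x; have v0 := Fp_val_gt0 x0.
have -> : - x = (p - val x)%:R by rewrite natrB ?(ltnW vp)// pchar_Fp_0// natr_Zp sub0r.
by rewrite /= val_Fp_nat// modn_small// ltn_subrL v0 prime_gt0.
Qed.

Lemma sum_neq0_opp (V : nmodType) (F : 'F_p -> V) :
  \sum_(x | x != 0) F x = \sum_(x | x != 0) F (- x).
Proof.
by rewrite (reindex_inj oppr_inj)/=; apply: eq_bigl => x; rewrite oppr_eq0.
Qed.

(** Pair [x] with [- x]; the classes [1, ..., m] represent the pairs. *)
Lemma sum_even (V : zmodType) (F : 'F_p -> V) : (forall x, x != 0 -> F (- x) = F x) ->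
  \sum_(x | x != 0) F x = (\sum_(1 <= k < m.+1) F k%:R) *+ 2.
Proof.
move=> hF; have -> : \sum_(x | x != 0) F x = \sum_(1 <= k < p) F k%:R.
  by rewrite (sum_Fp_neq0 (fun k => F k%:R)); apply: eq_bigr => x _; rewrite natr_Zp.
rewrite (@big_cat_nat _ _ _ m.+1)//=; last by lia.
rewrite mulr2n; congr (_ + _).
rewrite big_nat_rev /= -{1}[m.+1]add1n big_addn.
have -> : (p - m = m.+1)%N by lia.
apply: eq_big_nat => k hk.
have -> : (m.+1 + p - (k + m).+1 = p - k)%N by lia.
rewrite natrB; last by lia.
rewrite pchar_Fp_0// sub0r hF// Fp_nat_eq0//.
by apply/negP => /dvdn_leq; lia.
Qed.

(** * The Gauss sum and its sign *)

Variables (K : numFieldType) (w : K).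
Hypothesis w_prim : p.-primitive_root w.
Implicit Types (z : K) (i l : nat).

Let p_gt0 : (0 < p)%N := prime_gt0 p_prime.

Lemma w_neq0 : w != 0.
Proof.
apply/eqP => w0; have := prim_expr_order w_prim.
by move/eqP; rewrite w0 expr0n gtn_eqF// eq_sym oner_eq0.
Qed.

Lemma w_aint j : aint (w ^+ j).
Proof. by apply/aintX/(aint_unity_root p_gt0); rewrite prim_expr_order. Qed.

(** The additive character of the prime field. *)
Definition ech x : K := w ^+ val x.

Lemma ech_nat j : ech j%:R = w ^+ j.
Proof. by rewrite /ech /= val_Fp_nat// prim_expr_mod. Qed.

Lemma echD x y : ech (x + y) = ech x * ech y.
Proof. by rewrite -[in LHS](natr_Zp x) -[in LHS](natr_Zp y) -natrD ech_nat exprD. Qed.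

Lemma ech0 : ech 0 = 1. Proof. by rewrite -[0]/(0%:R) ech_nat expr0. Qed.

Lemma ech_eq1 x : (ech x == 1) = (x == 0).
Proof.
by rewrite /ech -(expr0 w) (eq_prim_root_expr w_prim) mod0n modn_small ?Fp_val_lt.
Qed.

Lemma sum_ech y : \sum_x ech (x * y) = if y == 0 then p%:R else 0.
Proof.
case: eqVneq => [->|y0].
  under eq_bigr do rewrite mulr0 ech0.
  by rewrite sumr_const card_Fp.
have : \sum_x ech (x * y) = ech y * \sum_x ech (x * y).
  rewrite {1}(reindex_inj (addIr 1))/= mulr_sumr; apply: eq_bigr => x _.
  by rewrite mulrDl mul1r echD mulrC.
move/eqP; rewrite -subr_eq0 -{1}[\sum_x _]mul1r -mulrBl mulf_eq0 subr_eq0 eq_sym ech_eq1 (negbTE y0).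
by move/eqP.
Qed.

Definition gauss : K := \sum_x (chi x)%:~R * ech x.

Lemma gauss_twist y : \sum_x (chi x)%:~R * ech (x * y) = (chi y)%:~R * gauss.
Proof.
case: (eqVneq y 0) => [->|y0].
  rewrite chi0 mul0r; under eq_bigr do rewrite mulr0 ech0 mulr1.
  by rewrite -rmorph_sum/= sum_chi.
rewrite /gauss mulr_sumr (reindex_inj (mulIf y0) (F := fun x => (chi y)%:~R * ((chi x)%:~R * ech x)))/=.
apply: eq_bigr => x _; rewrite mulrA; congr (_ * _).
by rewrite -rmorphM/= chiM mulrCA chi_sqr// mulr1.
Qed.

Lemma gauss_sqr : gauss ^+ 2 = (-1) ^+ m * p%:R.
Proof.
rewrite expr2 {1}/gauss mulr_suml.
transitivity (\sum_x \sum_y (chi y)%:~R * ech (x * (y + 1))).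
  apply: eq_bigr => x _; rewrite mulrAC -gauss_twist mulr_suml; apply: eq_bigr => y _.
  by rewrite -mulrA -echD mulrDr mulr1 [x * y]mulrC.
rewrite exchange_big/= (bigD1 (-1))//= [X in _ + X]big1 ?addr0.
  rewrite -mulr_sumr sum_ech addNr eqxx; congr (_ * _).
  have -> : chi (-1) = (-1) ^+ m * chi 1 by rewrite -chiN.
  have -> : chi 1 = 1 by apply: chi_eq => //; rewrite expr1n.
  by rewrite mulr1 rmorphXn rmorphN1.
move=> y y1; rewrite -mulr_sumr sum_ech.
by rewrite addr_eq0 (negbTE y1) mulr0.
Qed.

(** Modulo [p] the exponent [l] is a multiple of [j], so [w^l] is a power of [w^j]. *)
Lemma one_minus_div j l : ~~ (p %| j)%N -> exists2 g, aint g & 1 - w ^+ l = (1 - w ^+ j) * g.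
Proof.
move=> pj; pose k := val ((l%:R : 'F_p) / j%:R).
have e : w ^+ l = (w ^+ j) ^+ k.
  rewrite -exprM -(ech_nat (j * k)) natrM /k natr_Zp mulrC divfK ?Fp_nat_eq0//.
  by rewrite ech_nat.
exists (\sum_(i < k) (w ^+ j) ^+ i).
  by apply: aint_sum => i _; apply/aintX/w_aint.
by rewrite e -opprB subrX1 -mulNr opprB.
Qed.

Lemma prod_one_minus z : p.-primitive_root z -> \prod_(1 <= i < p) (1 - z ^+ i) = p%:R.
Proof.
move=> hz; have h := factor_Xn_sub_1 hz.
have : 'X^p - 1 = ('X - 1) * \sum_(i < p) 'X^i :> {poly K} by rewrite -subrX1.
rewrite -h big_ltn// expr0 => /(mulfI _) e.
have /e/(congr1 (horner^~ 1)) : 'X - 1%:P != 0 :> {poly K} by rewrite polyXsubC_eq0.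
rewrite horner_prod horner_sum.
under eq_bigr do rewrite hornerD hornerN hornerX hornerC.
move=> ->; under eq_bigr do rewrite hornerXn expr1n.
by rewrite sumr_const card_ord.
Qed.

Let mu := w - 1.

Lemma mu_neq0 : mu != 0.
Proof.
rewrite subr_eq0; apply/eqP => w1; have := ech_eq1 1%:R.
rewrite ech_nat expr1 w1 eqxx Fp_nat_eq0 dvdn1 => /esym/eqP; lia.
Qed.

(** [p] is the product of the [1 - w^i], each a multiple of [1 - w]. *)
Lemma p_mu : exists2 v, aint v & (p%:R : K) = mu ^+ m.*2 * v.
Proof.
exists (\prod_(1 <= i < p) \sum_(k < i) w ^+ k).
  by apply: aint_prod => i _; apply: aint_sum => k _; exact: w_aint.
rewrite -(prod_one_minus w_prim).
have -> : mu ^+ m.*2 = \prod_(1 <= i < p) (1 - w).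
  rewrite prodr_const_nat subn1 p_odd /= -opprB exprNn -signr_odd odd_double expr0 mul1r; by [].
rewrite -big_split/=; apply: eq_bigr => i _.
by rewrite -[1 - w ^+ i]opprB subrX1 -mulNr opprB.
Qed.

(** Conversely [1 - w] is a multiple of every [1 - w^i]. *)
Lemma mu_p : exists2 v, aint v & mu ^+ m.*2 = p%:R * v.
Proof.
have H i : exists g, aint g /\ ((1 <= i < p)%N -> 1 - w ^+ 1 = (1 - w ^+ i) * g).
  have [ip|] := boolP (1 <= i < p)%N; last by exists 1; split=> //; exact: aint1.
  have [|g hg1 hg2] := @one_minus_div i 1; last by exists g.
  by apply/negP => /dvdn_leq; lia.
have [g hg] := choice H.
exists (\prod_(1 <= i < p) g i); first by apply: aint_prod => i _; exact: (hg i).1.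
rewrite -(prod_one_minus w_prim) -big_split/=.
have -> : mu ^+ m.*2 = \prod_(1 <= i < p) (1 - w).
  by rewrite prodr_const_nat subn1 p_odd /= -opprB exprNn -signr_odd odd_double expr0 mul1r.
by apply: eq_big_nat => i ip; rewrite -(hg i).2// expr1.
Qed.

(** [mu^(p-1)] is [p] times an algebraic integer, so [n^(p-1) / p] is a rational
    algebraic integer. *)
Lemma mu_dvd (n : int) z : aint z -> n%:~R = mu * z -> (p %| n)%Z.
Proof.
move=> hz hn; have [v hv hmu] := mu_p.
pose q : rat := n%:~R ^+ m.*2 / p%:R.
have p0 : (p%:R : rat) != 0 by rewrite pnatr_eq0 -lt0n.
have [k hk] : exists k : int, q = k%:~R.
  apply: (@aint_rat K).
  rewrite /q fmorph_div/= rmorphXn/= ratr_int ratr_nat hn exprMn hmu.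
  have pK : (p%:R : K) != 0 by rewrite pnatr_eq0 -lt0n.
  rewrite [_ / _](_ : _ = v * z ^+ m.*2); first by apply: aintM => //; exact: aintX.
  by field.
have e : n ^+ m.*2 = k * p%:Z.
  apply: (@intr_inj rat); rewrite rmorphXn rmorphM/= -hk /q.
  by rewrite divfK.
have : (p %| n ^+ m.*2)%Z by rewrite e dvdz_mull.
by rewrite -!(Fp_int_eq0) rmorphXn expf_eq0 => /andP[].
Qed.

Definition cong z (n : int) := exists2 v, aint v & z = n%:~R + mu * v.

Lemma mu_aint : aint mu.
Proof. by apply: aintD; [rewrite -[w]expr1; exact: w_aint|exact/aintN/aint1]. Qed.

Lemma cong_int n : cong n%:~R n.
Proof. by exists 0; [exact: aint0|rewrite mulr0 addr0]. Qed.

Lemma cong_aint z n : cong z n -> aint z.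
Proof.
move=> [v hv ->]; apply: aintD; first exact: aint_int.
by apply: aintM => //; exact: mu_aint.
Qed.

Lemma congD z z' n n' : cong z n -> cong z' n' -> cong (z + z') (n + n').
Proof.
move=> [v hv ->] [v' hv' ->]; exists (v + v'); first exact: aintD.
by rewrite rmorphD/=; ring.
Qed.

Lemma congM z z' n n' : cong z n -> cong z' n' -> cong (z * z') (n * n').
Proof.
move=> c1 c2; have [v hv e] := c1; have [v' hv' e'] := c2.
exists (n%:~R * v' + v * z').
  apply: aintD; first by apply: aintM => //; exact: aint_int.
  by apply: aintM => //; exact: cong_aint c2.
by rewrite {1}e {1}e' rmorphM/= e'; ring.
Qed.

Lemma cong_w j : cong (w ^+ j) 1.
Proof.
exists (\sum_(i < j) w ^+ i); first by apply: aint_sum => i _; exact: w_aint.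
by rewrite -subrX1 addrC subrK.
Qed.

Lemma cong_unique z n n' : cong z n -> cong z n' -> (p %| n - n')%Z.
Proof.
move=> [v hv ->] [v' hv' e]; apply: (@mu_dvd _ (v' - v)); first by apply/aintD/aintN.
have -> : (n - n')%:~R = n%:~R + mu * v - mu * v - n'%:~R :> K by rewrite addrK rmorphB.
by rewrite e; ring.
Qed.

Lemma cong_sum_w j : cong (\sum_(i < j) w ^+ i) j%:Z.
Proof.
elim: j => [|j IH]; first by rewrite big_ord0; exact: (cong_int 0).
by rewrite big_ord_recr/= -addn1 PoszD; apply: congD => //; exact: cong_w.
Qed.

(** For [w = exp (2 pi i / p)] the factors are [2 i sin (2 pi k / p)]: this is the
    product by which Gauss expressed his sum. *)
Definition sinprod : K := \prod_(1 <= k < m.+1) (w ^+ k - w ^- k).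

Lemma w_inv k : (k <= p)%N -> w ^- k = w ^+ (p - k).
Proof.
move=> kp; apply: (mulfI (expf_neq0 k w_neq0)).
by rewrite divff ?expf_neq0 ?w_neq0// -exprD subnKC// prim_expr_order.
Qed.

Lemma sin_factor k : (k <= p)%N -> w ^+ k - w ^- k = mu * (w ^+ (p - k) * \sum_(i < k.*2) w ^+ i).
Proof.
move=> kp; rewrite mulrCA -subrX1 mulrBr mulr1 -w_inv// -addnn exprD mulrA.
by rewrite mulVf ?mul1r// expf_neq0 ?w_neq0.
Qed.

Lemma sinprod_sqr : sinprod ^+ 2 = (-1) ^+ m * p%:R.
Proof.
have w2 : p.-primitive_root (w ^+ 2).
  by rewrite (prim_root_exp_coprime 2 w_prim) coprime_sym prime_coprime//; apply/negP => /dvdn_leq; lia.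
have h := prod_one_minus w2.
rewrite -h (@big_cat_nat _ _ _ m.+1)//=; last by lia.
rewrite [X in _ * (_ * X)](_ : _ = \prod_(1 <= k < m.+1) (1 - (w ^+ 2) ^- k)); last first.
  rewrite big_nat_rev /= p_odd; rewrite -{1}[m.+1]add1n big_addn.
  rewrite (_ : m.*2.+1 - m = m.+1)%N; last by lia.
  apply: eq_big_nat => k hk; congr (1 - _).
  have -> : (w ^+ 2) ^- k = (w ^+ 2) ^+ (p - k).
    have kp : (k <= p)%N by lia.
    apply: (mulfI (expf_neq0 k (expf_neq0 2 w_neq0))).
    by rewrite divff ?expf_neq0 ?w_neq0// -exprD subnKC// (prim_expr_order w2).
  congr (_ ^+ _); lia.
rewrite -big_split/= expr2 /sinprod -big_split/=.
have -> : (-1) ^+ m = \prod_(1 <= k < m.+1) (-1) :> K by rewrite prodr_const_nat subn1.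
rewrite -big_split/=; apply: eq_bigr => k _.
rewrite -!exprM -!exprVn mul2n -addnn !exprD.
have : w ^+ k * w^-1 ^+ k = 1 by rewrite exprVn divff// expf_neq0 ?w_neq0.
set a := w ^+ k; set b := w^-1 ^+ k => ab.
transitivity (a * a + b * b - (a * b) *+ 2); first by rewrite mulr2n; ring.
transitivity (a * a + b * b - 1 - (a * b) * (a * b)); last by ring.
by rewrite ab mulr2n; ring.
Qed.

(** [w^k - w^-k] is [mu] times an algebraic integer congruent to [2 k]. *)
Lemma sinprod_mu : exists2 U, cong U (2 ^+ m * m`!%:Z) & sinprod = mu ^+ m * U.
Proof.
suff H n : (n <= m)%N -> exists2 U, cong U (2 ^+ n * n`!%:Z) &
    \prod_(1 <= k < n.+1) (w ^+ k - w ^- k) = mu ^+ n * U by exact: H.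
elim: n => [|n IH] nm.
  by exists 1; [exact: (cong_int 1)|rewrite big_geq// mul1r].
have [U hU e] := IH (ltnW nm).
exists (U * (w ^+ (p - n.+1) * \sum_(i < n.+1.*2) w ^+ i)).
  have -> : 2 ^+ n.+1 * n.+1`!%:Z = 2 ^+ n * n`!%:Z * (1 * n.+1.*2%:Z).
    by rewrite factS PoszM -muln2 PoszM exprS; ring.
  apply: congM => //; apply: congM; [exact: cong_w|exact: cong_sum_w].
by rewrite big_nat_recr//= e sin_factor ?exprSr; [ring|lia].
Qed.

Lemma Fp_Wilson : (-1) ^+ m * (m`!%:R ^+ 2) = -1 :> 'F_p.
Proof.
have mp : (m <= p.-1)%N by rewrite p_odd /= -addnn leq_addr.
have h1 : ((p.-1)`!%:R : 'F_p) = -1.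
  have := Wilson (prime_gt1 p_prime); rewrite p_prime => /esym.
  by rewrite -Fp_nat_eq0 -natr1 addr_eq0 => /eqP.
rewrite -[RHS]h1 -(ffact_fact mp).
have -> : (p.-1 - m = m)%N by rewrite p_odd /= -addnn addnK.
rewrite natrM expr2 mulrA; congr (_ * _).
have pm : p.-1%:R = -1 :> 'F_p.
  by apply: (@addIr _ 1); rewrite addNr natr1 prednK// pchar_Fp_0.
suff H n : (n <= m)%N -> (p.-1 ^_ n)%:R = (-1) ^+ n * n`!%:R :> 'F_p by rewrite H.
elim: n => [|n IH] nm; first by rewrite ffactn0 mul1r.
rewrite ffactnSr natrM IH ?(ltnW nm)// natrB; last by lia.
by rewrite pm factS natrM exprS -natr1; ring.
Qed.

(** Up to [k!] the binomial coefficient is a monic polynomial of degree [k] in [x],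
    and by Euler's criterion the character is [x^m]: only a monomial of degree
    [2 m = p - 1] has a nonzero sum. *)
Lemma binom_sum_Fp k : (k <= m)%N ->
  (k`!%:R : 'F_p) * (\sum_(x : 'F_p) chi x * 'C(val x, k)%:Z)%:~R = if k == m then -1 else 0.
Proof.
move=> km.
pose f : {poly 'F_p} := \prod_(i < k) ('X - (i%:R)%:P).
have hf x : (k`!%:R : 'F_p) * ('C(val x, k)%:R) = f.[x].
  rewrite mulrC -natrM bin_ffact /f horner_prod.
  under eq_bigr do rewrite hornerD hornerN hornerX hornerC.
  elim: k {km f} => [|k IH]; first by rewrite ffactn0 big_ord0.
  rewrite ffactnSr big_ord_recr/= -IH natrM.
  have [kx|xk] := leqP k (val x); first by rewrite natrB// natr_Zp.
  by rewrite ffact_small// !mul0r.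
have fm : f \is monic by apply: monic_prod => i _; exact: monicXsubC.
have fs : size f = k.+1.
  by rewrite /f size_prod_XsubC -[index_enum _]enumT size_enum_ord.
have fk : f`_k = 1 by have /eqP := fm; rewrite lead_coefE fs.
rewrite rmorph_sum mulr_sumr.
transitivity (\sum_(x : 'F_p) \sum_(i < k.+1) f`_i * x ^+ (m + i)).
  apply: eq_bigr => x _; rewrite rmorphM/= chiE // mulrCA hf -fs horner_coef mulr_sumr.
  by apply: eq_bigr => i _; rewrite exprD mulrCA.
rewrite exchange_big/= big_ord_recr/= big1 ?add0r; last first.
  move=> i _; rewrite -mulr_sumr sum_Fp_exp ?mulr0// -addnn ltn_add2l.
  exact: leq_trans (ltn_ord i) km.
rewrite -mulr_sumr fk mul1r; case: eqVneq => [->|kNm]; first by rewrite addnn sum_Fp_exp_top.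
by rewrite sum_Fp_exp// -addnn ltn_add2l ltn_neqAle kNm.
Qed.

(** Expand [w^x = (1 + mu)^x] by the binomial theorem: modulo [p] the character
    annihilates the terms of order less than [m], and [p] itself is of order
    [2 m] in [mu]. *)
Lemma gauss_mu : exists A : int, [/\ (m`!%:R : 'F_p) * A%:~R = -1 &
  exists2 V, cong V A & gauss = mu ^+ m * V].
Proof.
pose A k := \sum_(x : 'F_p) chi x * 'C(val x, k)%:Z.
have e : gauss = \sum_(k < p) (A k)%:~R * mu ^+ k.
  rewrite /gauss; under [RHS]eq_bigr do rewrite rmorph_sum/= mulr_suml.
  rewrite exchange_big/=; apply: eq_bigr => x _.
  have -> : ech x = \sum_(k < p) 'C(val x, k)%:R * mu ^+ k.
    have -> : ech x = (1 + mu) ^+ val x by rewrite /ech /mu addrC subrK.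
    rewrite exprDn -(big_mkord xpredT (fun k => 'C(val x, k)%:R * mu ^+ k)).
    rewrite (@big_cat_nat _ _ _ (val x).+1)//= ?Fp_val_lt// [X in _ + X]big_nat [X in _ + X]big1 ?addr0.
      by rewrite big_mkord; apply: eq_bigr => k _; rewrite expr1n mul1r mulr_natl.
    by move=> k /andP[xk _]; rewrite bin_small// mul0r.
  by rewrite mulr_sumr; apply: eq_bigr => k _; rewrite rmorphM/= mulrA.
have [v hv pv] := p_mu.
have hA k : (k < m)%N -> A k = (A k %/ p)%Z * p.
  move=> km; rewrite divzK //; have := binom_sum_Fp (ltnW km).
  rewrite -/(A k) (ltn_eqF km) => /eqP.
  rewrite mulf_eq0 Fp_nat_eq0 Fp_int_eq0 => /orP[|//].
  rewrite -[(p %| _)%N]negbK.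
  have : ~~ (p %| k`!)%N; last by move=> ->.
  elim: k km => [|k IH] km; first by rewrite fact0 dvdn1; lia.
  rewrite factS Euclid_dvdM// negb_or IH ?(ltnW km)// andbT.
  by apply/negP => /dvdn_leq; lia.
exists (A m); split; first by have := binom_sum_Fp (leqnn m); rewrite eqxx.
have [V1 hV1 e1] : exists2 V1, aint V1 & \sum_(k < m) (A k)%:~R * mu ^+ k = mu ^+ m.+1 * V1.
  exists (\sum_(k < m) (A k %/ p)%Z%:~R * mu ^+ k * v * mu ^+ (m.*2 - m.+1)).
    apply: aint_sum => k _; apply: aintM; last exact/aintX/mu_aint.
    by apply: aintM => //; apply: aintM; [exact: aint_int|exact/aintX/mu_aint].
  rewrite mulr_sumr; apply: eq_bigr => k _.
  rewrite {1}(hA k (ltn_ord k)) rmorphM/= -[p%:~R]/(p%:R) pv.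
  have -> : mu ^+ m.*2 = mu ^+ m.+1 * mu ^+ (m.*2 - m.+1).
    by rewrite -exprD subnKC//; lia.
  by ring.
have [V2 hV2 e2] : exists2 V2, aint V2 & \sum_(m.+1 <= k < p) (A k)%:~R * mu ^+ k = mu ^+ m.+1 * V2.
  exists (\sum_(m.+1 <= k < p) (A k)%:~R * mu ^+ (k - m.+1)).
    by apply: aint_sum => k _; apply: aintM; [exact: aint_int|exact/aintX/mu_aint].
  rewrite mulr_sumr; apply: eq_big_nat => k /andP[mk _].
  by rewrite mulrCA -exprD subnKC.
exists ((A m)%:~R + mu * (V1 + V2)); first by exists (V1 + V2) => //; exact: aintD.
rewrite e -(big_mkord xpredT (fun k => (A k)%:~R * mu ^+ k)) (@big_cat_nat _ _ _ m)//=; last by lia.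
rewrite big_mkord e1 big_ltn; last by lia.
by rewrite e2 exprSr; ring.
Qed.

(** The squares determine the quotient up to sign. The sign is found by comparing
    the leading terms of order [m] in [mu] modulo [p], with Wilson's theorem. The
    identity is purely algebraic: it holds for every primitive root of unity. *)
Theorem gauss_sinprod : gauss = (legendre (-2) p)%:~R * sinprod.
Proof.
have [A [hA [V hV eV]]] := gauss_mu; have [U hU eU] := sinprod_mu.
have : gauss ^+ 2 == sinprod ^+ 2 by rewrite gauss_sqr sinprod_sqr.
have [e [he ge]] : exists e : int, (e \in [:: 0; 1; -1 : int]) /\ (gauss ^+ 2 == sinprod ^+ 2 -> gauss = e%:~R * sinprod).
  rewrite eqf_sqr; case: (eqVneq gauss sinprod) => [->|h1]; first by exists 1; split=> // _; rewrite mul1r.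
  by exists (-1); split=> // /eqP ->; rewrite mulN1r.
move=> /ge {}ge; rewrite ge; congr (_%:~R * _); apply/esym; rewrite legendre_int.
apply: chi_eq => //.
have mm0 : mu ^+ m != 0 by rewrite expf_neq0 ?mu_neq0.
have VU : V = e%:~R * U.
  by apply: (mulfI mm0); rewrite -eV ge eU mulrCA.
have hc : cong V (e * (2 ^+ m * m`!%:Z)) by rewrite VU; apply: congM => //; exact: cong_int.
have := cong_unique hV hc; rewrite -Fp_int_eq0 rmorphB/= subr_eq0 => /eqP hAe.
move: hA; rewrite hAe rmorphM rmorphM/= rmorphXn/= -Fp_Wilson => h.
have f0 : (m`!%:R : 'F_p) != 0.
  apply/eqP => f0; have /eqP := Fp_Wilson.
  by rewrite f0 expr0n mulr0 eq_sym oppr_eq0 oner_eq0.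
have {}h : (e%:~R : 'F_p) * 2 ^+ m = (-1) ^+ m.
  by apply: (mulIf (expf_neq0 2 f0)); rewrite -h; ring.
have two : (2 : 'F_p) ^+ m * 2 ^+ m = 1.
  rewrite -exprD addnn Fp_expf// Fp_nat_eq0; apply/negP => /dvdn_leq; lia.
have -> : ((-2)%:~R : 'F_p) ^+ m = (-1) ^+ m * 2 ^+ m.
  by rewrite -exprMn mulN1r rmorphN.
by rewrite -h -mulrA two mulr1.
Qed.

(** * Fourier transform of the Bernoulli polynomials at the points [j / p] *)

(** With [u = 1 / (z - 1)], the [n]-fold application of [z d/dz] to [u] is this
    polynomial in [u]. *)
Fixpoint dpol n : {poly K} :=
  if n is n'.+1 then - ('X + 'X^2) * (dpol n')^`() else 'X.

(** What integrality needs: the coefficients are algebraic integers, and the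
    degree is bounded. *)
Lemma coef_dpol n k : aint (dpol n)`_k /\ ((n.+1 < k)%N -> (dpol n)`_k = 0).
Proof.
elim: n k => [|n IH] k.
  rewrite /= coefX; split; first by case: (k == 1%N); [exact: aint1|exact: aint0].
  by case: k => [|[|k]].
have e : (dpol n.+1)`_k = - ((if k is k'.+1 then (dpol n)`_k *+ k else 0) +
    (if k is k'.+2 then (dpol n)`_k'.+1 *+ k'.+1 else 0)).
  rewrite /= mulNr mulrDl coefN coefD coefXM coefXnM !coef_deriv.
  by case: k => [|[|k]]//=; rewrite ?subn2 ?addr0.
have aMn z i : aint z -> aint (z *+ i) by move=> hz; rewrite -mulr_natr; apply: aintM => //; exact: aint_nat.
split.
  rewrite e; apply: aintN; apply: aintD.
    by case: k {e} => [|k]; [exact: aint0|apply: aMn; exact: (IH _).1].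
  by case: k {e} => [|[|k]]; [exact: aint0|exact: aint0|apply: aMn; exact: (IH _).1].
move=> nk; rewrite e; case: k nk {e} => [|[|k]]// nk.
by rewrite !(IH _).2 ?mul0rn ?addr0 ?oppr0//; lia.
Qed.

(** Put [z = e^t], so that [t]-differentiation is [z d/dz]: this is the Leibniz
    expansion of the [n]-th derivative of [z u = 1 + u], multiplied by [u]. *)
Lemma dpol_rec n : (1 + 'X) * (\sum_(i < n.+1) dpol i *+ 'C(n, i)) =
  'X * dpol n + (n == 0)%:R *: 'X.
Proof.
pose A k := \sum_(i < k.+1) dpol i *+ 'C(k, i).
have AS k : A k.+1 = A k - ('X + 'X^2) * (A k)^`().
  rewrite /A big_ord_recl/= bin0 mulr1n.
  have -> : \sum_(i < k.+1) dpol (bump 0 i) *+ 'C(k.+1, bump 0 i) =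
      \sum_(i < k.+1) dpol i.+1 *+ 'C(k, i.+1) + \sum_(i < k.+1) dpol i.+1 *+ 'C(k, i).
    by rewrite -big_split/=; apply: eq_bigr => i _; rewrite /bump/= add1n binS mulrnDr.
  rewrite addrA; congr (_ + _).
    rewrite big_ord_recr/= bin_small// mulr0n addr0.
    by rewrite [RHS]big_ord_recl/= bin0 mulr1n.
  have -> : (\sum_(i < k.+1) dpol i *+ 'C(k, i))^`() = \sum_(i < k.+1) (dpol i)^`() *+ 'C(k, i).
    by rewrite (raddf_sum (@deriv K)); apply: eq_bigr => i _; exact: derivMn.
  rewrite -mulNr mulr_sumr; apply: eq_bigr => i _.
  by rewrite mulrnAr.
rewrite -/(A n); elim: n => [|n IH].
  by rewrite /A big_ord1 bin0 mulr1n scale1r mulrDl mul1r addrC.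
have := congr1 deriv IH.
rewrite derivM !derivD derivM derivZ derivX -[1]/(1%:P) derivC add0r mul1r /= scale0r addr0 AS.
rewrite -[1%:P]/(1 : {poly K}) => h.
rewrite mulrBr mulrCA.
have -> : (1 + 'X) * (A n)^`() = dpol n + 'X * (dpol n)^`() + (n == 0)%:R *: 1 - A n.
  by apply: (@addrI _ (A n)); rewrite h; ring.
rewrite -[(n == 0)%:R *: 1]mulr_algl -[(n == 0)%:R *: 'X]mulr_algl in IH *.
transitivity (((1 + 'X) * A n - ('X * dpol n + (n == 0)%:R%:A * 'X)) * (1 + 'X) - 'X * (('X + 'X^2) * (dpol n)^`())).
  by ring.
by rewrite IH subrr mul0r sub0r mulNr mulrN.
Qed.

Definition udiv x : K := (ech x - 1)^-1.

(** The Taylor coefficient of order [n] of [t |-> 1 / (ech x e^t - 1)]. *)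
Definition dval n x : K := (dpol n).[udiv x] / n`!%:R.

Lemma ech_sub1_neq0 x : x != 0 -> ech x - 1 != 0.
Proof. by move=> x0; rewrite subr_eq0 ech_eq1. Qed.

Lemma dval_rec n x : x != 0 ->
  ech x * \sum_(i < n.+1) dval i x / (n - i)`!%:R = dval n x + (n == 0)%:R.
Proof.
move=> x0; have e0 := ech_sub1_neq0 x0.
have := congr1 (horner^~ (udiv x)) (dpol_rec n).
rewrite !(hornerM, hornerD, hornerZ, hornerX, hornerC) horner_sum.
have -> : 1 + udiv x = ech x * udiv x.
  by rewrite /udiv; field.
have -> : \sum_(i < n.+1) (dpol i *+ 'C(n, i)).[udiv x] = n`!%:R * \sum_(i < n.+1) dval i x / (n - i)`!%:R.
  rewrite mulr_sumr; apply: eq_bigr => i _; rewrite hornerMn /dval -mulr_natr.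
  have ni : (i <= n)%N by rewrite -ltnS ltn_ord.
  by rewrite -(bin_fact ni) !natrM; field; rewrite !fact_neq0.
move=> h; have u0 : udiv x != 0 by rewrite invr_eq0.
apply: (mulfI u0); apply: (mulfI (fact_neq0 K n)).
transitivity (ech x * udiv x * (n`!%:R * (\sum_(i < n.+1) dval i x / (n - i)`!%:R))); first by ring.
rewrite h /dval; case: n {h} => [|n] /=; first by rewrite fact0; field.
by field; exact: fact_neq0.
Qed.

Definition dfourier n y : K := \sum_(x | x != 0) ech (- (x * y)) * dval n x.

(** Corrects the order [0] of the recursion below, where the frequency [x = 0] has
    been left out. *)
Definition fourier_const n y : K := if n == 0%N then (if y == 0 then p%:R else 0) - 1 else 0.

Lemma dfourier_rec n y :
  dfourier n y + fourier_const n y = \sum_(i < n.+1) dfourier i (y - 1) / (n - i)`!%:R.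
Proof.
have -> : fourier_const n y = \sum_(x | x != 0) ech (- (x * y)) * (n == 0)%:R.
  rewrite /fourier_const -mulr_suml; case: eqP => _; last by rewrite mulr0.
  rewrite mulr1; have := sum_ech (- y); rewrite oppr_eq0 (bigD1 0)//= mul0r ech0 => <-.
  by rewrite [1 + _]addrC addrK; apply: eq_bigr => x _; rewrite mulrN.
rewrite -big_split/=.
under [RHS]eq_bigr do rewrite mulr_suml.
rewrite exchange_big/=; apply: eq_bigr => x x0.
rewrite -mulrDr -dval_rec// mulrA mulr_sumr; apply: eq_bigr => i _.
rewrite mulrA; congr (_ * _ / _); rewrite -echD; congr ech; ring.
Qed.

(** The subtracted constant is the contribution of the frequency [0]. *)
Definition bfourier n y : K :=
  p%:R ^+ n.+1 * bern n.+1 ((val y)%:R / p%:R) - ratr (beta n.+1).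

Lemma bern_scaled_shift (q : K) n (x : K) : q != 0 ->
  q ^+ n * bern n (x + q^-1) = \sum_(i < n.+1) q ^+ i * bern i x / (n - i)`!%:R.
Proof.
move=> q0; rewrite bernD mulr_sumr; apply: eq_bigr => i _.
have ni : (i <= n)%N by rewrite -ltnS ltn_ord.
have -> : q ^+ n = q ^+ i * q ^+ (n - i) by rewrite -exprD subnKC.
by rewrite exprVn; field; rewrite fact_neq0 expf_neq0.
Qed.

Lemma bern_0 (x : K) : bern 0 x = 1.
Proof. by rewrite /bern big_ord1 expr0 fact0 divr1 mulr1 betaE big_ord0 subr0 /= rmorph1. Qed.

Lemma bfourier_rec n y :
  bfourier n y + fourier_const n y = \sum_(i < n.+1) bfourier i (y - 1) / (n - i)`!%:R.
Proof.
have pK : (p%:R : K) != 0 by rewrite pnatr_eq0 -lt0n.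
set k := val (y - 1).
have e1 : p%:R ^+ n.+1 * bern n.+1 (k.+1%:R / p%:R) - (ratr (beta n.+1) + (n.+1 == 1%N)%:R) =
    \sum_(i < n.+1) bfourier i (y - 1) / (n - i)`!%:R :> K.
  have -> : k.+1%:R / p%:R = k%:R / p%:R + p%:R^-1 :> K by rewrite -natr1 mulrDl mul1r.
  rewrite bern_scaled_shift// -bern1 /bern.
  rewrite big_ord_recl [X in _ - X]big_ord_recl/= -/(bern 0 _) bern_0 !expr1n.
  rewrite betaE big_ord0 subr0 /= rmorph1 !mulr1 opprD addrACA subrr add0r -sumrB.
  apply: eq_bigr => i _; rewrite /bump/= add1n subSS expr1n mulr1 -mulrBl /bfourier -/k.
  by congr (_ / _).
rewrite -e1 /bfourier /fourier_const eqSS.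
have kp : (k < p)%N by exact: Fp_val_lt.
have yk : y = k.+1%:R by rewrite -natr1 /k natr_Zp subrK.
have [y0|y0] := eqVneq y 0.
  have hk : k.+1 = p.
    apply/eqP; rewrite eqn_leq kp/= dvdn_leq// -Fp_nat_eq0 -yk y0; exact: eqxx.
  rewrite hk divff// y0 /= mul0r bern0 bern1.
  by case: n {e1} => [|n]; rewrite /= ?expr1; ring.
have -> : val y = k.+1.
  rewrite yk /= val_Fp_nat// modn_small// ltn_neqAle kp andbT.
  by apply: contraNneq y0 => hk; rewrite yk hk pchar_Fp_0.
by case: (n == 0)%N; rewrite /=; ring.
Qed.

(** Both sides satisfy the same recursion in [y], so their difference satisfies the
    homogeneous one. If the orders below [n] vanish, the order [n] is invariant
    under [y - 1], hence constant, and summing the order [n + 1] over a period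
    shows that the constant is [0]. *)
Lemma dfourierE n y : dfourier n y = bfourier n y.
Proof.
pose E k (z : 'F_p) := dfourier k z - bfourier k z.
have ER k (z : 'F_p) : E k z = \sum_(i < k.+1) E i (z - 1) / (k - i)`!%:R.
  rewrite /E; under eq_bigr do rewrite mulrBl.
  by rewrite sumrB -dfourier_rec -bfourier_rec; ring.
suff H : forall z : 'F_p, E n z = 0 by apply/eqP; rewrite -subr_eq0; apply/eqP; exact: H.
elim/ltn_ind: n {y} => n IH.
have E1 (z : 'F_p) : E n z = E n (z - 1).
  rewrite [LHS]ER big_ord_recr/= subnn fact0 divr1 big1 ?add0r// => i _.
  by rewrite IH ?mul0r.
have Ek k : E n k%:R = E n 0.
  elim: k => [|k IHk]; first by [].
  by rewrite E1 -natr1 addrK.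
have Ec (z : 'F_p) : E n z = E n 0 by rewrite -[z]natr_Zp Ek.
have pK : (p%:R : K) != 0 by rewrite pnatr_eq0 -lt0n.
have : \sum_z E n.+1 z = \sum_z E n.+1 z + p%:R * E n 0.
  rewrite [in RHS](reindex_inj (addIr (-1)))/=.
  have -> : p%:R * E n 0 = \sum_(z : 'F_p) E n (z - 1).
    under eq_bigr do rewrite Ec.
    by rewrite sumr_const card_Fp// mulr_natl.
  rewrite -big_split/=; apply: eq_bigr => z _.
  rewrite ER big_ord_recr/= subnn fact0 divr1 addrC; congr (_ + _).
  rewrite big_ord_recr/= subSnn divr1 big1 ?add0r// => i _.
  by rewrite IH ?mul0r.
move/eqP; rewrite -subr_eq0 opprD addNKr oppr_eq0 mulf_eq0 (negbTE pK) => /eqP E0 z; by rewrite Ec.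
Qed.

(** Multiplying by the Gauss sum replaces [chi x] by the Fourier transform of the
    character; exchange the sums and apply [dfourierE]. *)
Lemma gauss_dval n : gauss * \sum_(x | x != 0) (chi x)%:~R * dval n x =
  (-1) ^+ m * (p%:R ^+ n.+1 * \sum_y (chi y)%:~R * bern n.+1 ((val y)%:R / p%:R)).
Proof.
transitivity (\sum_y (chi (- y))%:~R * dfourier n y).
  rewrite mulr_sumr; under [RHS]eq_bigr do rewrite mulr_sumr.
  rewrite exchange_big/=; apply: eq_bigr => x _.
  rewrite mulrA [gauss * _]mulrC -gauss_twist mulr_suml.
  rewrite (reindex_inj oppr_inj)/=; apply: eq_bigr => y _.
  by rewrite mulNr [y * x]mulrC -mulrA.
have e y : (chi (- y))%:~R * dfourier n y = (-1) ^+ m * ((chi y)%:~R *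
    (p%:R ^+ n.+1 * bern n.+1 ((val y)%:R / p%:R)) - ratr (beta n.+1) * (chi y)%:~R).
  rewrite dfourierE /bfourier chiN rmorphM/= rmorphXn rmorphN1; ring.
under eq_bigr do rewrite e.
rewrite -mulr_sumr sumrB -mulr_sumr -rmorph_sum/= sum_chi mulr0 subr0; congr (_ * _).
by rewrite mulr_sumr; apply: eq_bigr => y _; rewrite mulrCA.
Qed.

(** Each of the [m] factors of the product is divisible by [ech x - 1]. *)
Lemma sinprod_udiv_aint x n : x != 0 -> (n <= m)%N -> aint (sinprod * udiv x ^+ n).
Proof.
move=> x0 nm.
have e0 := ech_sub1_neq0 x0.
have -> : sinprod * udiv x ^+ n = sinprod * udiv x ^+ m * (ech x - 1) ^+ (m - n).
  have -> : udiv x ^+ m = udiv x ^+ n * udiv x ^+ (m - n) by rewrite -exprD subnKC.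
  by rewrite -!mulrA -exprMn mulVf// expr1n mulr1.
apply: aintM; last by apply: aintX; apply: aintD; [exact: w_aint|exact/aintN/aint1].
have -> : udiv x ^+ m = \prod_(1 <= k < m.+1) udiv x by rewrite prodr_const_nat subn1.
rewrite /sinprod -big_split/= big_nat; apply: aint_prod => k hk.
have px : ~~ (p %| val x)%N by rewrite -Fp_nat_eq0 natr_Zp.
have [g hg e] := one_minus_div k.*2 px.
have kp : (k <= p)%N by lia.
rewrite sin_factor// mulrCA -subrX1 -opprB e /udiv /ech.
rewrite -mulNr opprB mulrA mulrAC mulfK//.
by apply: aintM => //; exact: w_aint.
Qed.

Lemma sinprod_dpol_aint x : x != 0 -> aint (sinprod * (dpol m.-1).[udiv x]).
Proof.
move=> x0; rewrite (@horner_coef_wide _ m.+1).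
  rewrite mulr_sumr; apply: aint_sum => i _; rewrite mulrCA; apply: aintM.
    exact: (coef_dpol _ _).1.
  by apply: sinprod_udiv_aint => //; rewrite -ltnS.
by apply/leq_sizeP => k mk; apply: (coef_dpol _ _).2; rewrite prednK.
Qed.
End QuadraticCharacter.

(** * The cotangent at rational multiples of pi *)

Section RootsOfUnity.
Variables (R : realType) (p : nat).
Hypothesis p_prime : prime p.
Hypothesis p_gt2 : (2 < p)%N.
Implicit Types (x y : 'F_p) (j k : nat).

Definition ang j : R := pi * j%:R / p%:R.

Definition omega : R[i] := cexp (0 +i* (2 * pi / p%:R)).

Lemma pR_gt0 : 0 < p%:R :> R.
Proof. by rewrite ltr0n prime_gt0. Qed.

Lemma omega_exp k : omega ^+ k = cos (ang k *+ 2) +i* sin (ang k *+ 2).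
Proof.
rewrite /omega -cexpMn cexpE /=.
have -> : (k%:R : R[i]) = k%:R +i* 0 by rewrite -(rmorph_nat (real_complex R)).
rewrite /= !mul0r subr0 addr0 mulr0 expR0 !mul1r.
by have -> : k%:R * (2 * pi / p%:R) = ang k *+ 2 by rewrite /ang mulr2n; ring.
Qed.

Lemma ang_bounds k : (0 < k < p)%N -> 0 < ang k < pi.
Proof.
move=> /andP[k0 kp]; have p0 := pR_gt0; have pp := pi_gt0 R.
rewrite /ang divr_gt0 ?mulr_gt0 ?ltr0n//=; last exact: prime_gt0.
by rewrite ltr_pdivrMr// ltr_pM2l// ltr_nat.
Qed.

Lemma sin_ang_gt0 k : (0 < k < p)%N -> 0 < sin (ang k).
Proof. by move=> /ang_bounds; exact: sin_gt0_pi. Qed.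

Lemma sin_ang_neq0 k : ~~ (p %| k)%N -> sin (ang k) != 0.
Proof.
move=> pk; have p0 := pR_gt0.
have -> : ang k = ang (k %% p) + (k %/ p)%:R * pi.
  rewrite /ang {1}(divn_eq k p) natrD natrM; field; exact: lt0r_neq0.
apply: sin_shift_neq0; rewrite gt_eqF// sin_ang_gt0//.
by rewrite lt0n ltn_mod prime_gt0 ?andbT.
Qed.

Lemma omega_prim : p.-primitive_root omega.
Proof.
have p0 := prime_gt0 p_prime.
have h : omega ^+ p = 1.
  rewrite omega_exp /ang mulfK ?lt0r_neq0 ?pR_gt0//.
  by rewrite cos2pi sin2pi.
have [k hk] := prim_order_exists p0 h.
move=> kp.
have : k != 1%N.
  apply/eqP => k1; move: hk; rewrite k1 => /prim_expr_order.
  rewrite omega_exp => /eqP; rewrite eq_complex => /andP[_ /=].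
  have /sin_ang_gt0 : (0 < 2 < p)%N by [].
  have -> : ang 2 = ang 1 *+ 2 by rewrite /ang mulr2n; ring.
  by move=> /gt_eqF ->.
by move=> k1; rewrite -(prime_nt_dvdP p_prime k1 kp).
Qed.

Lemma cot_ang_mod j : cot (ang j) = cot (ang (j %% p)).
Proof.
have p0 := pR_gt0.
have -> : ang j = ang (j %% p) + (j %/ p)%:R * pi.
  rewrite /ang {1}(divn_eq j p) natrD natrM; field; exact: lt0r_neq0.
elim: (_ %/ _)%N => [|k IH]; first by rewrite mul0r addr0.
by rewrite -natr1 mulrDl mul1r addrA /cot sinDpi cosDpi invrN mulrNN.
Qed.

Lemma cot_ang_opp x : x != 0 -> cot (ang (val (- x))) = - cot (ang (val x)).
Proof.
move=> x0; rewrite -cotpi_sub; congr cot; rewrite /ang.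
rewrite (Fp_val_opp p_prime x0).
rewrite natrB ?(ltnW (Fp_val_lt p_prime x))//; field.
exact/lt0r_neq0/pR_gt0.
Qed.

(** [cot t = i (z + 1) / (z - 1)] with [z = exp (2 i t)]. *)
Lemma omega_cot x : x != 0 -> (cot (ang (val x)))%:C = 'i * (1 + udiv omega x *+ 2).
Proof.
move=> x0; have e0 := ech_sub1_neq0 p_prime omega_prim x0.
have s0 : sin (ang (val x)) != 0.
  by apply: sin_ang_neq0; rewrite -(Fp_nat_eq0 p_prime) natr_Zp.
apply: (mulfI e0); rewrite mulrCA mulrDr mulr1 mulrnAr /udiv divff//.
rewrite /ech omega_exp /cot mulr2n cosD sinD.
apply/eqP; rewrite eq_complex /=; apply/andP; split; apply/eqP; move: s0.
  move: (cos2Dsin2 (ang (val x))); set s := sin _; set c := cos _ => h s0.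
  have -> : c * c = 1 - s * s by rewrite -!expr2 -h addrK.
  by field.
move: (cos2Dsin2 (ang (val x))); set s := sin _; set c := cos _ => h s0.
have cc : c * c = 1 - s * s by rewrite -!expr2 -h addrK.
have -> : (s * c + c * s - 0) * (c / s) = (c * c) *+ 2 by rewrite mulr2n; field.
by rewrite cc mulr2n; ring.
Qed.
End RootsOfUnity.

(** * The constant and its expressions *)

Section CotangentSums.
Variables (R : realType) (p n : nat).
Local Notation m := n.+2.
Hypothesis p_prime : prime p.
Hypothesis p_odd : p = m.*2.+1.
Implicit Types (x y : 'F_p) (j k : nat).

Let m_gt0 : (0 < m)%N. Proof. by []. Qed.
Let p_gt2 : (2 < p)%N. Proof. by rewrite p_odd. Qed.
Let w_prim := @omega_prim R p p_prime p_gt2.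
Local Notation w := (omega R p).

(** The sines are positive since [2 k < p], so the sign of the square root is known. *)
Lemma sinprod_sqrt : sinprod m w = (Num.sqrt p%:R)%:C * 'i ^+ m.
Proof.
pose S : R := \prod_(1 <= k < m.+1) (sin (ang R p k.*2) *+ 2).
have e : sinprod m w = S%:C * 'i ^+ m.
  rewrite /S rmorph_prod/= /sinprod.
  have -> : ('i : R[i]) ^+ m = \prod_(1 <= k < m.+1) 'i by rewrite prodr_const_nat subn1.
  rewrite -big_split/=; apply: eq_big_nat => k _.
  have -> : w ^- k = cos (ang R p k *+ 2) -i* sin (ang R p k *+ 2).
    have w0 := w_neq0 p_prime w_prim.
    apply: (mulfI (expf_neq0 k w0)); rewrite divff ?expf_neq0// omega_exp.
    apply/eqP; rewrite eq_complex /=; apply/andP; split; apply/eqP; last by ring.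
    by rewrite mulrN opprK -!expr2 cos2Dsin2.
  rewrite omega_exp.
  have -> : ang R p k.*2 = ang R p k *+ 2 by rewrite /ang -addnn natrD mulr2n; ring.
  apply/eqP; rewrite eq_complex /=; apply/andP; split; apply/eqP; ring.
rewrite e; congr (_%:C * _).
have S0 : 0 <= S.
  rewrite /S big_nat; apply: prodr_ge0 => k hk.
  by rewrite mulrn_wge0// ltW// sin_ang_gt0//; lia.
rewrite -[LHS]ger0_norm// -sqrtr_sqr; congr Num.sqrt.
have := sinprod_sqr p_prime p_odd m_gt0 w_prim; rewrite e exprMn -exprM muln2 -mul2n exprM sqr_i.
rewrite mulrC => /(mulfI _) h.
have {}h : (S ^+ 2)%:C = p%:R by rewrite rmorphXn/=; apply: h; rewrite signr_eq0.
by apply: (fmorph_inj (real_complex R)); rewrite /= h rmorph_nat.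
Qed.

(** The change of variable [cot t = i (1 + 2 u)] where [u = 1 / (e^(2 i t) - 1)]. *)
Lemma cotp_dpol k : map_poly (real_complex R) (cotp R k) \Po ('i%:P + (2 * 'i) *: 'X) =
  (2 * 'i) ^+ k.+1 *: dpol R[i] k + (if k == 0%N then 'i%:P else 0).
Proof.
elim: k => [|k IH]; first by rewrite /= map_polyX comp_polyX expr1 addrC.
set q := _ + _ *: 'X in IH *.
have /(congr1 deriv) := IH.
rewrite deriv_comp derivD derivZ derivD derivC derivZ derivX add0r.
rewrite (_ : (if _ then _ else _)^`() = 0); last by case: ifP => _; rewrite ?derivC ?deriv0.
rewrite addr0 => h.
rewrite /= addr0 rmorphM rmorphN rmorphD rmorph1 rmorphXn/= map_polyX -deriv_map.
rewrite comp_polyM raddfN /= comp_polyD comp_polyC rmorphXn/= comp_polyX.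
move: h; rewrite alg_polyC -!mul_polyC !rmorphXn/= /q -mul_polyC.
have -> : (2 * 'i : R[i])%:P = 2 * 'i%:P by rewrite rmorphM/= -[2 in LHS]/(2%:R) rmorph_nat.
set D := _ \Po _; set d := deriv _; set I := 'i%:P => h.
have II : I * I = -1 by rewrite /I -rmorphM/= -expr2 sqr_i rmorphN1.
have -> : 1%:P + (I + 2 * I * 'X) ^+ 2 = - 4 * ('X + 'X^2).
  transitivity (1 + I * I * (1 + 2 * 'X) ^+ 2); first by rewrite polyC1; ring.
  by rewrite II; ring.
transitivity (- ('X + 'X^2) * (- 4 * D)); first by ring.
have -> : - 4 * D = D * (2 * I) * (2 * I).
  by transitivity (4 * (I * I) * D); [rewrite II; ring|ring].
by rewrite h [in RHS]exprS; move: (_ ^+ k.+1) => J; ring.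
Qed.

Lemma cotp_dpol_ang k x : x != 0 ->
  ((cotp R k.+1).[cot (ang R p (val x))])%:C = (2 * 'i) ^+ k.+2 * (dpol R[i] k.+1).[udiv w x].
Proof.
move=> x0; have := congr1 (horner^~ (udiv w x)) (cotp_dpol k.+1).
rewrite addr0 hornerZ horner_comp => <-.
rewrite -[in LHS]horner_map/= (omega_cot R p_prime p_gt2 x0) hornerD hornerC hornerZ hornerX.
by congr (_.[_]); rewrite mulrDr mulr1 mulr2n; ring.
Qed.

Lemma cotp_ang_opp k x : x != 0 -> (cotp R k).[cot (ang R p (val (- x)))] =
  (-1) ^+ k.+1 * (cotp R k).[cot (ang R p (val x))].
Proof. by move=> x0; rewrite cot_ang_opp// cotp_odd. Qed.

Definition frc x : R := (val x)%:R / p%:R.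

Lemma frc_bounds x : x != 0 -> 0 < frc x < 1.
Proof.
move=> x0; have p0 : 0 < p%:R :> R by rewrite ltr0n prime_gt0.
have v0 := Fp_val_gt0 x0.
rewrite /frc; apply/andP; split; first by rewrite divr_gt0// ltr0n.
by rewrite ltr_pdivrMr// mul1r ltr_nat; exact: Fp_val_lt.
Qed.

Lemma frc_opp x : x != 0 -> frc (- x) = 1 - frc x.
Proof.
move=> x0; have p0 : p%:R != 0 :> R by rewrite pnatr_eq0 -lt0n prime_gt0.
rewrite /frc.
by rewrite (Fp_val_opp p_prime x0) natrB ?(ltnW (Fp_val_lt p_prime x))// mulrBl divff.
Qed.

Definition zsum : R := \sum_(x : 'F_p | x != 0) (chi x)%:~R * zetaR m (frc x).
Definition cotsum : R := \sum_(x : 'F_p | x != 0) (chi x)%:~R * (cotp R n.+1).[cot (ang R p (val x))].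
Definition bernsum (F : numFieldType) : F :=
  \sum_(x : 'F_p | x != 0) (chi x)%:~R * bern m ((val x)%:R / p%:R : F).

(** Partial fractions at [x] involve the zeta values at [x] and [- x], which agree
    after twisting by the character since [chi (-1) = (-1)^m]. *)
Lemma cotsum_zsum : pi ^+ m * cotsum = (-1) ^+ n.+1 * n.+1`!%:R * (zsum *+ 2).
Proof.
rewrite /cotsum mulr_sumr.
transitivity (\sum_(x : 'F_p | x != 0) (-1) ^+ n.+1 * n.+1`!%:R *
   ((chi x)%:~R * zetaR m (frc x) + (chi (- x))%:~R * zetaR m (frc (- x)))).
  apply: eq_bigr => x x0; rewrite mulrCA.
  have -> : ang R p (val x) = pi * frc x by rewrite /ang /frc mulrA.
  rewrite cotp_zeta ?frc_bounds// (chiN p_prime p_odd m_gt0) frc_opp//.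
  by rewrite rmorphM/= rmorphXn rmorphN1; ring.
rewrite -mulr_sumr big_split/= -(sum_neq0_opp (fun x => (chi x)%:~R * zetaR m (frc x))).
by rewrite mulr2n.
Qed.

(** The constant of the theorem, as a real number. *)
Definition cval : R := Num.sqrt p%:R * n.+1`!%:R / (2 * pi) ^+ m * zsum.

Lemma cval_cotsum : cval = (-1) ^+ n.+1 * (Num.sqrt p%:R / 2 ^+ m.+1) * cotsum.
Proof.
have p0 : (pi : R) != 0 by rewrite lt0r_neq0 ?pi_gt0.
apply: (mulfI (expf_neq0 m p0)).
rewrite [RHS]mulrCA cotsum_zsum.
have s1 : (-1) ^+ n.+1 * (-1) ^+ n.+1 = 1 :> R by rewrite -exprMn mulrNN mulr1 expr1n.
transitivity ((-1) ^+ n.+1 * (-1) ^+ n.+1 * (Num.sqrt p%:R / 2 ^+ m.+1) * (n.+1`!%:R * (zsum *+ 2))); last by ring.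
rewrite s1 mul1r /cval exprMn [2 ^+ m.+1]exprS -[zsum *+ 2]mulr_natr.
by field; rewrite !expf_neq0 ?pnatr_eq0.
Qed.

Lemma cval_dpol : cval%:C = (-1) ^+ n.+1 / 2 *
  (sinprod m w * \sum_(x : 'F_p | x != 0) (chi x)%:~R * (dpol R[i] n.+1).[udiv w x]).
Proof.
have e : cotsum%:C = (2 * 'i) ^+ m * \sum_(x : 'F_p | x != 0) (chi x)%:~R * (dpol R[i] n.+1).[udiv w x].
  rewrite /cotsum rmorph_sum/= mulr_sumr; apply: eq_bigr => x x0.
  by rewrite rmorphM/= cotp_dpol_ang// rmorph_int mulrCA.
rewrite cval_cotsum !rmorphM/= e fmorphV rmorphXn/= rmorphN1 sinprod_sqrt.
rewrite exprMn rmorphXn/= rmorph_nat [2 ^+ m.+1]exprS.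
by field; rewrite ?expf_neq0 ?pnatr_eq0.
Qed.

(** The square root of [p] in the constant is, up to a power of [i], the product
    [sinprod], which the Gauss sum turns into the Legendre symbol of [-2]. *)
Lemma cval_bernsumC : cval%:C =
  - (legendre (-2) p)%:~R / 2 * n.+1`!%:R * p%:R ^+ m * bernsum R[i].
Proof.
have hb : \sum_(y : 'F_p) (chi y)%:~R * bern m ((val y)%:R / p%:R) = bernsum R[i].
  by rewrite (bigD1 0)//= (chi0 p_prime p_odd m_gt0) mul0r add0r.
have := gauss_dval p_prime p_odd m_gt0 w_prim n.+1.
rewrite hb (gauss_sinprod p_prime p_odd m_gt0 w_prim).
have -> : \sum_(x : 'F_p | x != 0) (chi x)%:~R * dval w n.+1 x =
    (\sum_(x : 'F_p | x != 0) (chi x)%:~R * (dpol R[i] n.+1).[udiv w x]) / n.+1`!%:R.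
  by rewrite mulr_suml; apply: eq_bigr => x _; rewrite /dval mulrA.
rewrite cval_dpol; set D := \sum_(x | _) _; set B := bernsum _; set e := (legendre _ _)%:~R.
have ee : e * e = 1 :> R[i].
  rewrite /e -rmorphM/= (legendre_int p_prime p_odd m_gt0) (chi_sqr p_prime p_odd m_gt0)//.
  rewrite rmorphN oppr_eq0 (Fp_int_eq0 p_prime 2); apply/negP => /(dvdn_leq (isT : (0 < 2)%N)); lia.
move=> h; have {}h : e * (sinprod m w * D) = (-1) ^+ m * (p%:R ^+ m * B) * n.+1`!%:R.
  by rewrite -h -!mulrA mulVf ?mulr1// fact_neq0.
have -> : sinprod m w * D = e * (e * (sinprod m w * D)) by rewrite mulrA ee mul1r.
rewrite h [(-1) ^+ m]exprS.
have s1 : (-1) ^+ n.+1 * (-1) ^+ n.+1 = 1 :> R[i] by rewrite -exprMn mulrNN mulr1 expr1n.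
transitivity (- ((-1) ^+ n.+1 * (-1) ^+ n.+1) * (e / 2 * n.+1`!%:R * p%:R ^+ m * B)); first by ring.
by rewrite s1; ring.
Qed.

Lemma bernsum_rat (F : numFieldType) : bernsum F = ratr (bernsum rat).
Proof.
rewrite /bernsum rmorph_sum/=; apply: eq_bigr => x _; rewrite rmorphM/= ratr_int; congr (_ * _).
rewrite /bern rmorph_sum/=; apply: eq_bigr => k _.
have h : ratr (beta k) = beta k :> rat by exact: divq_num_den.
by rewrite h fmorph_div rmorphM/= rmorphXn/= fmorph_div/= !ratr_nat.
Qed.

(** The Bernoulli expression is rational. The cotangent expression is an algebraic
    integer: its terms at [x] and [- x] coincide, which absorbs the factor [1 / 2],
    and [sinprod] clears the denominators. *)
Lemma cval_int : exists k : int, cval = k%:~R.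
Proof.
pose q : rat := - (legendre (-2) p)%:~R / 2 * n.+1`!%:R * p%:R ^+ m * bernsum rat.
have e (F : numFieldType) : - (legendre (-2) p)%:~R / 2 * n.+1`!%:R * p%:R ^+ m * bernsum F = ratr q.
  by rewrite /q 2!rmorphM/= rmorphXn 2!rmorphM/= fmorphV rmorphN/= ratr_int !ratr_nat bernsum_rat.
have [k hk] : exists k : int, q = k%:~R.
  apply: (@aint_rat R[i]); rewrite -e -cval_bernsumC cval_dpol mulr_sumr.
  rewrite (sum_even p_prime p_odd m_gt0 (F := fun x : 'F_p => sinprod m w * ((chi x)%:~R * (dpol R[i] n.+1).[udiv w x]))); last first.
    move=> x x0; congr (_ * _).
    have hd : (dpol R[i] n.+1).[udiv w (- x)] = (-1) ^+ m * (dpol R[i] n.+1).[udiv w x].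
      have t0 : (2 * 'i) ^+ m != 0 :> R[i].
        by rewrite expf_neq0// mulf_neq0 ?pnatr_eq0// -normr_eq0 normCi oner_eq0.
      apply: (mulfI t0); rewrite -cotp_dpol_ang ?oppr_eq0// cotp_ang_opp//.
      by rewrite rmorphM/= rmorphXn rmorphN1 cotp_dpol_ang//; ring.
    rewrite hd (chiN p_prime p_odd m_gt0) rmorphM/= rmorphXn rmorphN1 mulrACA.
    by rewrite -exprMn mulrNN mulr1 expr1n mul1r.
  set S := \sum_(1 <= k < _) _; rewrite -[S *+ 2]mulr_natl mulrA divfK ?pnatr_eq0// /S.
  apply: aintM; first by apply/aintX/aintN/aint1.
  rewrite big_nat; apply: aint_sum => k hk; rewrite mulrCA; apply: aintM; first exact: aint_int.
  apply: (sinprod_dpol_aint p_prime p_odd m_gt0 w_prim).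
  by rewrite Fp_nat_eq0//; apply/negP => /dvdn_leq; lia.
exists k; apply: (fmorph_inj (real_complex R)).
by rewrite /= cval_bernsumC e hk ratr_int rmorph_int.
Qed.

Lemma cval_bernsum : cval = - (legendre (-2) p)%:~R / 2 * n.+1`!%:R * p%:R ^+ m * bernsum R.
Proof.
apply: (fmorph_inj (real_complex R)); rewrite /= cval_bernsumC.
rewrite bernsum_rat [bernsum R]bernsum_rat 2!rmorphM/= fmorph_rat rmorphXn/= 2!rmorphM/=.
by rewrite fmorphV rmorphN/= rmorph_int !rmorph_nat.
Qed.

(** The terms of the Dirichlet series [L(m, chi)]. *)
Definition Lterm (l : nat) : R := (legendre l p)%:~R / l%:R ^+ m.

Lemma legendre_nat j : legendre j p = chi (j%:R : 'F_p).
Proof. exact: (legendre_int p_prime p_odd m_gt0 j). Qed.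

(** Sorting the positive integers by residue modulo [p]. *)
Lemma zsum_partial N :
  \sum_(x : 'F_p | x != 0) (chi x)%:~R * \sum_(i < N) (frc x + i%:R) ^- m =
  p%:R ^+ m * \sum_(0 <= l < N * p) Lterm l.
Proof.
have p0 : p%:R != 0 :> R by rewrite pnatr_eq0 -lt0n prime_gt0.
elim: N => [|N IH].
  by rewrite mul0n big_geq// mulr0 big1// => x _; rewrite big_ord0 mulr0.
under eq_bigr do rewrite big_ord_recr/= mulrDr.
rewrite big_split/= IH mulSnr [in RHS](@big_cat_nat _ _ _ (N * p))//= ?leq_addr// mulrDr.
congr (_ + _).
rewrite -{1}[(N * p)%N]add0n big_addn addKn (sum_Fp p_prime) [in RHS](bigD1 0)//=.
rewrite {1}/Lterm legendre_nat natrD natrM pchar_Fp_0// mulr0 addr0 (chi0 p_prime p_odd m_gt0) mul0r add0r.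
rewrite mulr_sumr; apply: eq_bigr => x x0.
rewrite /Lterm legendre_nat natrD natrM pchar_Fp_0// mulr0 addr0 natr_Zp mulrCA; congr (_ * _).
have -> : frc x + N%:R = (val x + N * p)%:R / p%:R by rewrite /frc natrD natrM; field.
by rewrite expr_div_n invf_div.
Qed.

Lemma Lterm_ge l : (0 < l)%N -> - l%:R ^- 2 <= Lterm l.
Proof.
move=> l0; have l1 : 1 <= l%:R :> R by rewrite ler1n.
have h : l%:R ^- m <= l%:R ^- 2 :> R.
  by rewrite lef_pV2 ?posrE ?exprn_gt0 ?ltr0n// ler_weXn2l.
have h0 : 0 <= l%:R ^- m :> R by rewrite invr_ge0 exprn_ge0.
have := legendre_values p l; rewrite /Lterm !inE => /or3P[] /eqP ->.
- by rewrite mul0r oppr_le0 (le_trans h0).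
- by rewrite mul1r (le_trans _ h0)// oppr_le0 (le_trans h0).
- by rewrite mulN1r lerN2.
Qed.

(** The first term is [1], the second at least [- 1/4], and the others telescope
    against [1 / (l (l - 1))] to at most [1/2] in absolute value. *)
Lemma Lterm_sum_ge M : (2 < M)%N -> 4^-1 <= \sum_(0 <= l < M) Lterm l.
Proof.
move=> M2; suff : 4^-1 + M.-1%:R^-1 <= \sum_(0 <= l < M) Lterm l.
  by apply: le_trans; rewrite lerDl invr_ge0.
have -> : M = (M - 3).+3 by lia.
elim: (M - 3)%N => [|k IH].
  rewrite !big_nat_recr//= big_geq// add0r.
  have -> : Lterm 0 = 0 by rewrite /Lterm legendre_nat (chi0 p_prime p_odd m_gt0) mul0r.
  have -> : Lterm 1 = 1.
    rewrite /Lterm expr1n divr1 legendre_nat (_ : chi _ = 1)//.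
    by apply: (chi_eq p_prime p_odd m_gt0) => //; rewrite expr1n.
  have /= := @Lterm_ge 2 isT; lra.
rewrite big_nat_recr//=.
have := @Lterm_ge k.+3 isT; move: IH => /=.
have -> : k.+3%:R = k.+2%:R + 1 :> R by rewrite natr1.
have k0 : 0 < k.+2%:R :> R by rewrite ltr0n.
move: (k.+2%:R : R) k0 => t t0 h1 h2.
suff : (t + 1)^-1 <= t^-1 - (t + 1) ^- 2 by lra.
rewrite -subr_ge0.
have -> : t^-1 - (t + 1) ^- 2 - (t + 1)^-1 = (t * (t + 1) ^+ 2)^-1.
  by field; rewrite ?lt0r_neq0//; lra.
by rewrite invr_ge0 mulr_ge0 ?exprn_ge0//; lra.
Qed.

Lemma zsum_gt0 : 0 < zsum.
Proof.
have p0 : 0 < p%:R :> R by rewrite ltr0n prime_gt0.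
apply: (@lt_le_trans _ _ (p%:R ^+ m * 4^-1)); first by rewrite mulr_gt0 ?exprn_gt0.
have h : (fun N => \sum_(x : 'F_p | x != 0) (chi x)%:~R * \sum_(i < N) (frc x + i%:R) ^- m) @ \oo --> (zsum : R).
  apply: cvg_big => [|x x0]; first exact: add_continuous.
  apply: cvgMr; apply: zetaR_sums.
  by have /andP[] := frc_bounds x0.
have e : zsum = limn (fun N => \sum_(x : 'F_p | x != 0) (chi x)%:~R * \sum_(i < N) (frc x + i%:R) ^- m).
  by apply/esym/cvg_lim.
rewrite e; apply: limr_ge; first by apply/cvg_ex; exists zsum.
near=> N; rewrite zsum_partial ler_pM2l ?exprn_gt0//; apply: Lterm_sum_ge.
have N0 : (0 < N)%N by near: N; exact: nbhs_infty_gt.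
by rewrite (leq_trans p_gt2)// leq_pmull.
Unshelve. all: by end_near. Qed.

Lemma cval_nat : exists2 c : nat, (0 < c)%N & cval = c%:R.
Proof.
have c0 : 0 < cval.
  rewrite /cval mulr_gt0 ?zsum_gt0// divr_gt0 ?exprn_gt0 ?mulr_gt0 ?pi_gt0 ?ltr0n ?fact_gt0//.
  by rewrite sqrtr_gt0 ltr0n prime_gt0.
have [[k|k] hk] := cval_int.
  by exists k => //; rewrite -(ltr0n R) -[k%:R]/(k%:~R) -hk.
by move: c0; rewrite hk NegzE ltr0z.
Qed.

Lemma hurwitz_sum : \sum_(1 <= j < p) (legendre j p)%:~R * hurwitz_zeta m%:R (j%:R / p%:R : R) = zsum%:C.
Proof.
rewrite (sum_Fp_neq0 p_prime (fun j => (legendre j p)%:~R * hurwitz_zeta m%:R (j%:R / p%:R : R))).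
rewrite /zsum rmorph_sum/=; apply: eq_bigr => x x0.
rewrite rmorphM/= rmorph_int hurwitz_zeta_nat//.
by have /andP[] := frc_bounds x0.
Qed.

Lemma hurwitz_neg_sum : \sum_(1 <= j < p) (legendre j p)%:~R *
  hurwitz_zeta (- n.+1%:R) (j%:R / p%:R : R) = - (n.+1`!%:R * (bernsum R)%:C).
Proof.
rewrite (sum_Fp_neq0 p_prime (fun j => (legendre j p)%:~R * hurwitz_zeta (- n.+1%:R) (j%:R / p%:R : R))).
rewrite /bernsum rmorph_sum/= mulr_sumr -sumrN; apply: eq_bigr => x x0.
rewrite rmorphM/= rmorph_int hurwitz_zeta_neg; last by have /andP[] := frc_bounds x0.
by rewrite mulrN mulrCA.
Qed.

Lemma derive_cot_sum : \sum_(1 <= j < p) (legendre j p)%:~R *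
  derive1n n.+1 (@cot R) (pi * j%:R / p%:R) = cotsum.
Proof.
rewrite (sum_Fp_neq0 p_prime (fun j => (legendre j p)%:~R * derive1n n.+1 (@cot R) (pi * j%:R / p%:R))).
apply: eq_bigr => x x0; congr (_ * _); apply: derive1n_cot.
by apply: sin_ang_neq0 => //; rewrite -Fp_nat_eq0// natr_Zp.
Qed.

Lemma bernoulli_sum : \sum_(1 <= j < p) (legendre j p)%:~R *
  (bernoulli_poly R m).[j%:R / p%:R] = m`!%:R * bernsum R.
Proof.
rewrite (sum_Fp_neq0 p_prime (fun j => (legendre j p)%:~R * (bernoulli_poly R m).[j%:R / p%:R])).
rewrite mulr_sumr; apply: eq_bigr => x x0.
by rewrite bernoulli_polyE bernoulliE mulrCA.
Qed.

(** The squares are counted by [1 + chi], whose constant part cancels against an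
    odd function. *)
Lemma sum_squares_odd (F : 'F_p -> R) : odd m -> (forall x, x != 0 -> F (- x) = - F x) ->
  \sum_(x | x != 0) F (x ^+ 2) = \sum_(x | x != 0) (chi x)%:~R * F x.
Proof.
move=> om hF; rewrite (sum_squares p_prime p_odd m_gt0).
under eq_bigr do rewrite mulrzDr mulr1z.
rewrite big_split/= [X in X + _](_ : _ = 0) ?add0r.
  by apply: eq_bigr => x _; rewrite mulrzl.
have : \sum_(x | x != 0) F x = - \sum_(x | x != 0) F x.
  by rewrite {1}(sum_neq0_opp F) -sumrN; apply: eq_bigr => x; exact: hF.
lra.
Qed.

Lemma val_sqr x : val (x ^+ 2) = (val x ^ 2 %% p)%N.
Proof. by rewrite -{1}[x]natr_Zp -natrX /= val_Fp_nat. Qed.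

Lemma derive_cot_squares : odd m ->
  \sum_(1 <= j < p) derive1n n.+1 (@cot R) (pi * (j ^ 2)%:R / p%:R) = cotsum.
Proof.
move=> om; rewrite (sum_Fp_neq0 p_prime (fun j => derive1n n.+1 (@cot R) (pi * (j ^ 2)%:R / p%:R))).
rewrite /cotsum -(sum_squares_odd om (F := fun x => (cotp R n.+1).[cot (ang R p (val x))])).
  apply: eq_bigr => x x0; rewrite derive1n_cot; last first.
    apply: sin_ang_neq0 => //; rewrite -Fp_nat_eq0// natrX natr_Zp expf_eq0/=.
    exact: x0.
  by rewrite val_sqr -cot_ang_mod.
by move=> x x0; rewrite cotp_ang_opp// -signr_odd om expr1 mulN1r.
Qed.

Lemma frac_part_div j : frac_part (j%:R / p%:R : R) = (j %% p)%:R / p%:R.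
Proof.
have p0 : 0 < p%:R :> R by rewrite ltr0n prime_gt0.
have e : j%:R / p%:R = (j %/ p)%:R + (j %% p)%:R / p%:R :> R.
  by rewrite {1}(divn_eq j p) natrD natrM; field; exact: lt0r_neq0.
rewrite /frac_part (_ : Num.floor _ = (j %/ p)%N); first by rewrite e addrC addKr.
apply: floor_def; rewrite e intrD1.
rewrite lerDl divr_ge0// ?ler0n//= ltrD2l ltr_pdivrMr// mul1r ltr_nat ltn_mod.
exact: prime_gt0.
Qed.

Lemma bernoulli_squares : odd m ->
  \sum_(1 <= j < p) (bernoulli_poly R m).[frac_part ((j ^ 2)%:R / p%:R)] = m`!%:R * bernsum R.
Proof.
move=> om; rewrite (sum_Fp_neq0 p_prime (fun j => (bernoulli_poly R m).[frac_part ((j ^ 2)%:R / p%:R)])).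
rewrite /bernsum -(sum_squares_odd om (F := fun x => bern m (frc x))).
  rewrite mulr_sumr; apply: eq_bigr => x x0.
  by rewrite bernoulli_polyE bernoulliE frac_part_div /frc val_sqr.
by move=> x x0; rewrite frc_opp// bern_reflect -signr_odd om expr1 mulN1r.
Qed.
End CotangentSums.

Theorem proposition2p2 (R : realType) (p : nat) (p_prime : prime p)
    (p_ge5 : (5 <= p)%N) :
  exists c : nat,
  [/\ (0 < c)%N /\ Kp R p = 1 / c%:R,
      (* (i) *)
      c%:R = (Num.sqrt (p%:R : R) * ((p - 3) %/ 2)`!%:R
                / (2 * pi) ^+ ((p - 1) %/ 2))%:C *
        \sum_(1 <= j < p) (legendre j p)%:~R *
          hurwitz_zeta ((p - 1) %/ 2)%:R (j%:R / p%:R : R),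
      (* (ii) *)
      c%:R = 1 / 2 * (legendre (- 2) p)%:~R * p%:R ^+ ((p - 1) %/ 2) *
        \sum_(1 <= j < p) (legendre j p)%:~R *
          hurwitz_zeta (- ((p - 3) %/ 2)%:R) (j%:R / p%:R : R),
      (* (iii) *)
      c%:R = (-1) ^+ ((p - 3) %/ 2) *
        (Num.sqrt p%:R / 2 ^+ ((p + 1) %/ 2)) *
        \sum_(1 <= j < p) (legendre j p)%:~R *
          derive1n ((p - 3) %/ 2) (@cot R) (pi * j%:R / p%:R)
    & (* (iv) *)
      c%:R = - (legendre (- 2) p)%:~R *
        (p%:R ^+ ((p - 1) %/ 2) / (p - 1)%:R) *
        \sum_(1 <= j < p) (legendre j p)%:~R *
          (bernoulli_poly R ((p - 1) %/ 2)).[j%:R / p%:R] ] /\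
  (p = 3 %[mod 4] ->
      (* (v) *)
      c%:R = Num.sqrt p%:R / 2 ^+ ((p + 1) %/ 2) *
        \sum_(1 <= j < p)
          derive1n ((p - 3) %/ 2) (@cot R) (pi * (j ^ 2)%:R / p%:R) /\
      (* (vi) *)
      c%:R = - (legendre (- 2) p)%:~R *
        (p%:R ^+ ((p - 1) %/ 2) / (p - 1)%:R) *
        \sum_(1 <= j < p)
          (bernoulli_poly R ((p - 1) %/ 2)).[frac_part ((j ^ 2)%:R / p%:R)]).
Proof.
have podd : odd p by case/even_prime: (p_prime) => // p2; lia.
have [n p_odd] : exists n, p = n.+2.*2.+1 by exists (p - 5)./2; lia.
have -> : ((p - 1) %/ 2 = n.+2)%N by lia.
have -> : ((p - 3) %/ 2 = n.+1)%N by lia.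
have -> : ((p + 1) %/ 2 = n.+3)%N by lia.
have pm : (p - 1)%:R = 2 * n.+2%:R :> R by rewrite -natrM; congr _%:R; lia.
have [c c0 hc] := cval_nat R p_prime p_odd.
have cB : c%:R = - (legendre (-2) p)%:~R / 2 * n.+1`!%:R * p%:R ^+ n.+2 * bernsum p n R.
  by rewrite -hc cval_bernsum.
have cB' : c%:R = - (legendre (-2) p)%:~R * (p%:R ^+ n.+2 / (p - 1)%:R) *
    (n.+2`!%:R * bernsum p n R).
  have n0 : n.+2%:R != 0 :> R by rewrite pnatr_eq0.
  rewrite cB pm factS [(n.+2 * _)%:R]natrM.
  set a : R := n.+2%:R in n0 *; set b := p%:R ^+ n.+2; set d := n.+1`!%:R.
  by field.
exists c; split; [split|].
- split => //; rewrite /Kp.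
  have -> : ((p - 1) %/ 2 = n.+2)%N by lia.
  have -> : ((p - 3) %/ 2 = n.+1)%N by lia.
  rewrite (hurwitz_sum R n p_prime) -(rmorph_nat (real_complex R)) -hc /cval /=.
  have z0 := zsum_gt0 R p_prime p_odd.
  rewrite -rmorphM/= -fmorphV -rmorphM/= -[X in _ = X / _]/(1%:C) -fmorphV -rmorphM/=; congr _%:C.
  have sp : 0 < Num.sqrt p%:R :> R by rewrite sqrtr_gt0 ltr0n prime_gt0.
  have pp : 0 < (2 * pi) ^+ n.+2 :> R by rewrite exprn_gt0// mulr_gt0// pi_gt0.
  by field; rewrite !lt0r_neq0// ltr0n fact_gt0.
- rewrite (hurwitz_sum R n p_prime) -(rmorph_nat (real_complex R)) -hc /cval.
  by rewrite -rmorphM.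
- rewrite (hurwitz_neg_sum R n p_prime) -(rmorph_nat (real_complex R)) cB.
  rewrite 2!rmorphM/= rmorphXn 2!rmorphM/= fmorphV rmorphN/= rmorph_int !rmorph_nat.
  ring.
- by rewrite (derive_cot_sum R n p_prime) -(cval_cotsum R p_prime p_odd) hc.
- by rewrite (bernoulli_sum R n p_prime).
move=> p34; have om : odd n.+2 by lia.
split; last by rewrite (bernoulli_squares R p_prime p_odd).
rewrite (derive_cot_squares R p_prime p_odd)// -hc cval_cotsum//.
have -> : (-1) ^+ n.+1 = 1 :> R by rewrite -signr_odd; move: om => /=; case: odd.
by rewrite mul1r.
Qed.
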